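(* Let $G$ be an irreducible map on a surface $S$. Then every edge of $G$ is essentially noncontractible.
   Context: A surface is a compact two-dimensional manifold (without boundary). All graphs are simple. A map on $S$ is a connected simple graph $G$ embedded in $S$ such that every face (connected component of $S\setminus G$) is homeomorphic to an open disk. A face whose boundary walk traverses edges $v_1v_2,\dots,v_mv_1$ is denoted $v_1\cdots v_m$ (vertices need not be distinct, subscripts mod $m$) and has size $m$; a face of size $m\ge4$ is large; a face of size $3$ is a $3$-face. A large face $v_1\cdots v_m$ is irreducible if $v_i$ and $v_{i+2}$ are adjacent for all $i$. A map is face irreducible if every face is an irreducible face or a $3$-face. If $v_1v_2,v_2v_3,v_3v_1$ are edges, their union is the $3$-cycle $v_1v_2v_3$. An edge is contractible if it lies on exactly two $3$-cycles and both of them are (boundaries of) $3$-faces. An irreducible map is a face irreducible map in which no edge is contractible. A $3$-cycle is essential if it does not bound a disk in $S$; an edge is essentially noncontractible if at least one $3$-cycle containing it is essential.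
   Formalization: The triangle K_3 embedded in the sphere is excluded: it is an irreducible map under the definitions given (each edge lies on only one 3-cycle, so none is contractible), yet its only 3-cycle bounds a disk, so the claim fails for it. *)

(* Defs.v *)
From mathcomp Require Import all_boot all_order all_algebra.
From mathcomp Require Import all_classical all_reals all_analysis.

Set Implicit Arguments.
Unset Strict Implicit.
Unset Printing Implicit Defensive.

Import Order.TTheory GRing.Theory Num.Theory.
Import numFieldNormedType.Exports.

Local Open Scope classical_set_scope.
Local Open Scope ring_scope.

Definition homeomorphic (T U : topologicalType) (A : set T) (B : set U) : Prop :=
  exists (f : T -> U) (g : U -> T),
    [/\ {within A, continuous f}, {within B, continuous g},
        (forall x, A x -> B (f x) /\ g (f x) = x) &
        (forall y, B y -> A (g y) /\ f (g y) = y)].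

Section Models.
Variable R : realType.

Definition open_disk : set (R * R) := [set p | p.1 ^+ 2 + p.2 ^+ 2 < 1].
Definition closed_disk : set (R * R) := [set p | p.1 ^+ 2 + p.2 ^+ 2 <= 1].
Definition unit_circle : set (R * R) := [set p | p.1 ^+ 2 + p.2 ^+ 2 = 1].
Definition unit_sphere : set (R * R * R) :=
  [set p | p.1.1 ^+ 2 + p.1.2 ^+ 2 + p.2 ^+ 2 = 1].

Definition circle_point (s : R) : R * R := (cos (2 * pi * s), sin (2 * pi * s)).

(* Second countability is automatic for a compact locally Euclidean space, and
   connectedness of S follows from the existence of a map on S. *)
Definition surface (S : topologicalType) : Prop :=
  [/\ compact [set: S], hausdorff_space S &
      forall x : S, exists U : set S,
        [/\ open U, U x & homeomorphic U open_disk]].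

(* Needed to exclude the triangle K_3 on the sphere: each of its edges lies on a
   single 3-cycle, so none is contractible and the map is irreducible, yet that
   3-cycle bounds a disk. *)
Definition sphere (S : topologicalType) : Prop :=
  homeomorphic [set: S] unit_sphere.

(* A finite simple graph embedded in S.  For adjacent u and v, [earc u v]
   restricted to [0, 1] parametrizes the edge uv from u to v; its values are
   irrelevant when u and v are not adjacent or outside [0, 1]. *)
Record embedded_graph (S : topologicalType) := EmbeddedGraph {
  vertex :> finType;
  adj : rel vertex;
  adj_sym : symmetric adj;
  adj_irr : irreflexive adj;
  vpoint : vertex -> S;
  vpoint_inj : injective vpoint;
  earc : vertex -> vertex -> R -> S;
  earc_continuous : forall u v, adj u v -> {within `[0, 1], continuous (earc u v)};
  earc_inj : forall u v, adj u v -> {in `[0, 1] &, injective (earc u v)};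
  earc0 : forall u v, adj u v -> earc u v 0 = vpoint u;
  earc1 : forall u v, adj u v -> earc u v 1 = vpoint v;
  earc_rev : forall u v (t : R), adj u v -> t \in `[0, 1] -> earc v u t = earc u v (1 - t);
  earc_vertex : forall u v w (t : R), adj u v -> t \in `]0, 1[ -> earc u v t <> vpoint w;
  earc_disjoint : forall u v u' v' (s t : R), adj u v -> adj u' v' ->
    s \in `]0, 1[ -> t \in `]0, 1[ -> earc u v s = earc u' v' t ->
    (u' = u /\ v' = v) \/ (u' = v /\ v' = u)
}.

Section Maps.
Variables (S : topologicalType) (G : embedded_graph S).

Definition edge (u v : G) : set S := earc u v @` `[0, 1].

Definition graph_set : set S :=
  range (@vpoint S G) `|` [set x | exists u v : G, adj u v /\ edge u v x].

Definition face (F : set S) : Prop :=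
  exists2 x, ~ graph_set x & F = connected_component (~` graph_set) x.

Definition is_map : Prop :=
  [/\ (0 < #|G|)%N, forall u v : G, connect (@adj S G) u v &
      forall F, face F -> homeomorphic F open_disk].

(* A closed walk of length m is a function on 'I_m; [ordS] is the successor
   modulo m. *)
Definition closed_walk m (w : 'I_m -> G) : Prop :=
  forall i, adj (w i) (w (ordS i)).

Definition walk_set m (w : 'I_m -> G) : set S :=
  \bigcup_(i : 'I_m) edge (w i) (w (ordS i)).

(* F is the face w_0 ... w_(m-1): F is the image of the interior of an m-gon,
   modelled by the disk with its boundary circle cut into m equal arcs, under a
   map that extends continuously to the boundary and runs there through the
   edges w_0 w_1, ..., w_(m-1) w_0 in this order.  (The restriction to the open
   disk is a homeomorphism onto F, by compactness of the closed disk.) *)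
Definition boundary_walk (F : set S) m (w : 'I_m -> G) : Prop :=
  closed_walk w /\
  exists phi : R * R -> S,
    [/\ {within closed_disk, continuous phi},
        {in open_disk &, injective phi},
        phi @` open_disk = F &
        forall (i : 'I_m) (t : R), t \in `[0, 1] ->
          phi (circle_point ((i%:R + t) / m%:R)) = earc (w i) (w (ordS i)) t].

Definition three_face (F : set S) : Prop :=
  face F /\ exists w : 'I_3 -> G, boundary_walk F w.

Definition irreducible_face (F : set S) : Prop :=
  face F /\ exists m (w : 'I_m -> G),
    [/\ (4 <= m)%N, boundary_walk F w &
        forall i, adj (w i) (w (ordS (ordS i)))].

Definition face_irreducible : Prop :=
  forall F, face F -> irreducible_face F \/ three_face F.

Definition three_cycle (C : set S) : Prop :=
  exists2 w : 'I_3 -> G, closed_walk w & C = walk_set w.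

Definition bounds_three_face (C : set S) : Prop :=
  exists (F : set S) (w : 'I_3 -> G),
    [/\ face F, boundary_walk F w & C = walk_set w].

Definition contractible (u v : G) : Prop :=
  exists C1 C2 : set S,
    [/\ C1 <> C2,
        [set C | three_cycle C /\ edge u v `<=` C] = [set C1; C2],
        bounds_three_face C1 & bounds_three_face C2].

Definition irreducible_map : Prop :=
  [/\ is_map, face_irreducible & forall u v : G, adj u v -> ~ contractible u v].

Definition bounds_disk (C : set S) : Prop :=
  exists phi : R * R -> S,
    [/\ {within closed_disk, continuous phi},
        {in closed_disk &, injective phi} &
        phi @` unit_circle = C].

Definition essential (C : set S) : Prop := ~ bounds_disk C.

Definition essentially_noncontractible (u v : G) : Prop :=
  exists C, [/\ three_cycle C, edge u v `<=` C & essential C].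

End Maps.
End Models.

(* Main.v *)
Require Import Defs.
From mathcomp Require Import all_boot all_order all_algebra.
From mathcomp Require Import all_classical all_reals all_analysis.
From mathcomp Require Import ring lra.

(** Suppose that every 3-cycle through the edge uv bounds a disk. In such a disk,
    choose a 3-cycle that surrounds some vertex x and as few faces as possible. The
    3-cycles through x then surround no vertex at all, so each of them bounds a
    3-face, and this makes every edge at x contractible. Hence the disk contains no
    vertex and is itself a 3-face. So all 3-cycles through uv are facial, and then
    either uv is contractible or the map is the triangle on the sphere.

    The edges are arbitrary continuous arcs, and all the plane topology rests on a
    single question: does z - q have a continuous square root on a given set K of
    complex numbers? If K is a closed curve, this is the parity of its winding number
    around q. Borsuk's theorem on odd maps shows that the boundary of an embedded disk
    winds an odd number of times around the points of its interior. This gives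
    invariance of domain, hence the fact that every edge is on exactly two sides of
    faces, and, by moving one arc of a theta curve, the fact that the parity changes
    when an edge of a 3-cycle is crossed. The faces on which the parity is odd are the
    ones that a 3-cycle surrounds. A nonempty set of faces of the disk has a nonempty
    border, because a compact subset of the plane cannot be a neighbourhood of all but
    finitely many of its points. *)

Set Implicit Arguments.
Unset Strict Implicit.
Unset Printing Implicit Defensive.

Import Order.TTheory GRing.Theory Num.Theory.
Import numFieldNormedType.Exports.

(** * Faces and triangles of a graph on a closed surface *)

Section FaceWalks.
Import mathcomp.boot.finset mathcomp.boot.fintype.
Local Open Scope set_scope.

Lemma eq_set2 (T : finType) (a b c d : T) :
  ([set a; b] == [set c; d]) = (a == c) && (b == d) || (a == d) && (b == c).
Proof.
apply/eqP/idP => [/setP abcd|/orP[] /andP[/eqP-> /eqP->] //]; last by rewrite setUC.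
have := abcd a; have := abcd b; have := abcd c; have := abcd d.
rewrite !inE !eqxx ?orbT/= ![c == _]eq_sym ![d == _]eq_sym.
by case: (a == c); case: (a == d); case: (b == c); case: (b == d).
Qed.

Lemma eq_set2P (T : finType) (a b c d : T) :
  [set a; b] = [set c; d] <-> (a = c /\ b = d) \/ (a = d /\ b = c).
Proof.
split=> [/eqP|[[-> ->]|[-> ->]]] //; last by rewrite setUC.
by rewrite eq_set2 => /orP[] /andP[/eqP-> /eqP->]; [left|right].
Qed.

Variables (V : finType) (adj : rel V).

(* The boundary walk of a face is extended periodically to all of [nat]. The last
   field holds for irreducible faces and for 3-faces. *)
Record face_walks (FT : Type) := FaceWalks {
  degree : FT -> nat;
  walk : FT -> nat -> V;
  degree_gt2 : forall F, 2 < degree F;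
  walk_periodic : forall F j, walk F (j + degree F) = walk F j;
  walk_adj : forall F j, adj (walk F j) (walk F j.+1);
  walk_adj2 : forall F j, adj (walk F j) (walk F j.+2)
}.

Definition triangle (C : {set V}) :=
  #|C| = 3 /\ {in C &, forall u v, u != v -> adj u v}.

Hypothesis adjC : symmetric adj.
Hypothesis adjI : irreflexive adj.

Lemma adj_neq u v : adj u v -> u != v.
Proof. by apply: contraTneq => ->; rewrite adjI. Qed.

Lemma cards3 (u v t : V) : u != v -> u != t -> v != t -> #|[set u; v; t]| = 3.
Proof.
by move=> uv ut vt; rewrite -setUA !cardsU1 cards1 !inE negb_or uv ut vt.
Qed.

Lemma triangle3 u v t : adj u v -> adj u t -> adj v t -> triangle [set u; v; t].
Proof.
move=> uv ut vt; split; first by rewrite cards3 ?adj_neq.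
by move=> a b; rewrite !inE -!orbA => /or3P[] /eqP-> /or3P[] /eqP->;
  rewrite ?eqxx// adjC.
Qed.

Lemma triangle_vertex C u : triangle C -> u \in C ->
  exists v t, [/\ adj u v, adj u t, adj v t & C = [set u; v; t]].
Proof.
move=> [C3 Cadj] uC; have := C3; rewrite (cardsD1 u) uC => -[] /eqP/cards2P.
move=> [v [t [vt Cu]]]; have CE : C = [set u; v; t] by rewrite -(setD1K uC) Cu setUA.
have : u \notin [set v; t] by rewrite -Cu !inE eqxx.
rewrite !inE negb_or => /andP[uv ut].
by exists v, t; split=> //; apply: Cadj => //; rewrite CE !inE eqxx ?orbT.
Qed.

Lemma triangle_edge C u v : triangle C -> u \in C -> v \in C -> u != v ->
  exists t, [/\ adj u t, adj v t & C = [set u; v; t]].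
Proof.
move=> tC uC vC uv; have [a [b [ua ub ab CE]]] := triangle_vertex tC uC.
move: vC uv; rewrite CE !inE -orbA => /or3P[] /eqP->; rewrite ?eqxx// => _.
  by exists b.
by exists a; split; rewrite ?[adj b a]adjC// -!setUA; congr (_ :|: _); rewrite setUC.
Qed.

Section Walks.
Variables (FT : Type) (W : face_walks FT).
Implicit Types (F : FT) (u v : V).

Definition side := {F : FT & 'I_(degree W F)}.

Definition side_edge F j : {set V} := [set walk W F j; walk W F j.+1].

Definition on_edge (p : side) u v := side_edge (tag p) (tagged p) == [set u; v].

Definition edge_sides u v (p q : side) :=
  p <> q /\ forall r, on_edge r u v <-> r = p \/ r = q.

Definition two_sided := forall u v, adj u v -> exists p q, edge_sides u v p q.

Definition link F j : {set V} := [set walk W F j; walk W F j.+2].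

(* Two faces that share a corner fill a neighbourhood of its apex. *)
Definition closed_corners := forall F1 j1 F2 j2, F1 <> F2 ->
  walk W F1 j1.+1 = walk W F2 j2.+1 -> link F1 j1 = link F2 j2 ->
  forall v, adj (walk W F1 j1.+1) v -> v \in link F1 j1.

Definition face_vertices F : {set V} := [set walk W F j | j : 'I_(degree W F)].

Definition facial C := exists2 F, degree W F = 3 & C = face_vertices F.

Definition contractible_edge u v := exists T1 T2,
  [/\ T1 != T2, facial T1, facial T2 &
      forall C, [/\ triangle C, u \in C & v \in C] <-> C = T1 \/ C = T2].

Definition twin_faces F1 F2 := [/\ F1 <> F2, degree W F1 = 3, degree W F2 = 3 &
  face_vertices F1 = face_vertices F2].

Lemma degree_gt0 F : 0 < degree W F.
Proof. exact: leq_trans (degree_gt2 W F). Qed.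

Definition side_at F j : side := Tagged _ (Ordinal (ltn_pmod j (degree_gt0 F))).

Lemma walk_eqmod F j k : j = k %[mod degree W F] -> walk W F j = walk W F k.
Proof.
have walk_modn i : walk W F (i %% degree W F) = walk W F i.
  rewrite {2}(divn_eq i (degree W F)); elim: (i %/ _) => [|n ih]; first by rewrite mul0n.
  by rewrite mulSn -addnA addnC walk_periodic.
by move=> jk; rewrite -walk_modn jk walk_modn.
Qed.

Lemma walk_pred F j : exists k, forall i, walk W F (k.+1 + i) = walk W F (j + i).
Proof.
exists (j + (degree W F).-1) => i.
by rewrite -addnS prednK ?degree_gt0// addnAC walk_periodic.
Qed.

Lemma side_edge_eqmod F j k : j = k %[mod degree W F] -> side_edge F j = side_edge F k.
Proof.
move=> jk; rewrite /side_edge (walk_eqmod jk) (@walk_eqmod F j.+1 k.+1)//.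
by rewrite -addn1 -modnDml jk modnDml addn1.
Qed.

Lemma on_edge_side_at F j u v : on_edge (side_at F j) u v = (side_edge F j == [set u; v]).
Proof. by rewrite /on_edge/= (@side_edge_eqmod F _ j)// modn_mod. Qed.

Lemma side_at_inj F j k : side_at F j = side_at F k -> j = k %[mod degree W F].
Proof. by move=> /(congr1 (fun p : side => val (tagged p))). Qed.

Lemma eq_side (p q : side) :
  tag p = tag q -> tagged p = tagged q %[mod degree W (tag p)] -> p = q.
Proof.
case: p q => F j [F' k] /= FF'; rewrite -{F'}FF' in k *; rewrite !modn_small// => jk.
by congr Tagged; exact: val_inj.
Qed.

Lemma on_edgeC p u v : on_edge p u v = on_edge p v u.
Proof. by rewrite /on_edge setUC. Qed.

Lemma on_edge_adj p u v : on_edge p u v -> adj u v.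
Proof.
rewrite /on_edge /side_edge eq_set2.
by move=> /orP[] /andP[/eqP<- /eqP<-]; [|rewrite adjC]; exact: walk_adj.
Qed.

Lemma edge_sides_on u v p q : edge_sides u v p q -> on_edge p u v /\ on_edge q u v.
Proof. by move=> [_ pqP]; split; apply/pqP; [left|right]. Qed.

Lemma edge_sides_sym u v p q : edge_sides u v p q -> edge_sides u v q p.
Proof.
move=> [pq pqP]; split=> [qp|r]; first exact/pq/esym.
by split=> [/pqP[]|rqp]; [right|left|apply/pqP; case: rqp; [right|left]].
Qed.

Lemma third_side u v p q r : two_sided -> on_edge p u v -> on_edge q u v ->
  on_edge r u v -> p <> q -> p <> r -> q = r.
Proof.
move=> two pe; have [s [t [st stP]]] := two _ _ (on_edge_adj pe).
by move: pe => /stP[]-> /stP[]-> /stP[]->.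
Qed.

Lemma mem_walk F j : walk W F j \in face_vertices F.
Proof.
apply/imsetP; exists (Ordinal (ltn_pmod j (degree_gt0 F))) => //=.
by apply: walk_eqmod; rewrite modn_mod.
Qed.

Lemma face_vertices_walk F v : v \in face_vertices F -> exists j, walk W F j.+1 = v.
Proof.
move=> /imsetP[j _ ->]; have [k kj] := walk_pred F j.
by exists k; have := kj 0; rewrite !addn0.
Qed.

Lemma on_edge_mem p u v : on_edge p u v ->
  u \in face_vertices (tag p) /\ v \in face_vertices (tag p).
Proof.
by rewrite /on_edge /side_edge eq_set2 => /orP[] /andP[/eqP<- /eqP<-];
  rewrite !mem_walk.
Qed.

Lemma walk_triangle F j : triangle [set walk W F j; walk W F j.+1; walk W F j.+2].
Proof. by apply: triangle3; rewrite ?walk_adj ?walk_adj2. Qed.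

Lemma walk_wrap F j :
  walk W F j.+3 \in [set walk W F j; walk W F j.+1; walk W F j.+2] ->
  walk W F j.+3 = walk W F j.
Proof.
rewrite !inE -orbA [_ == walk W F j.+1]eq_sym [_ == walk W F j.+2]eq_sym.
rewrite (negbTE (adj_neq (walk_adj2 W F j.+1))) (negbTE (adj_neq (walk_adj W F j.+2))).
by rewrite !orbF => /eqP.
Qed.

Lemma degree3_walk F j : degree W F = 3 -> walk W F j.+3 = walk W F j.
Proof. by move=> F3; rewrite -addn3 -F3 walk_periodic. Qed.

Lemma degree3_vertices F j : degree W F = 3 ->
  face_vertices F = [set walk W F j; walk W F j.+1; walk W F j.+2].
Proof.
move=> F3; apply/esym/eqP; rewrite eqEcard (walk_triangle F j).1; apply/andP; split.
  by apply/subsetP => v; rewrite !inE -orbA => /or3P[] /eqP->; exact: mem_walk.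
by rewrite -F3 -[leqRHS]card_ord; exact: leq_imset_card.
Qed.

Lemma degree3_walk_inj F j k : degree W F = 3 -> walk W F j = walk W F k ->
  j = k %[mod degree W F].
Proof.
move=> F3; rewrite F3 -(@walk_eqmod F (j %% 3) j) ?F3 ?modn_mod//.
rewrite -(@walk_eqmod F (k %% 3) k) ?F3 ?modn_mod//.
have := adj_neq (walk_adj W F 0); have := adj_neq (walk_adj W F 1).
have := adj_neq (walk_adj2 W F 0).
have := ltn_pmod j (isT : 0 < 3); have := ltn_pmod k (isT : 0 < 3).
case: (k %% 3) => [|[|[|//]]] _; case: (j %% 3) => [|[|[|//]]] _ //;
  by move=> n02 n12 n01 jk; rewrite jk eqxx in n01 n12 n02.
Qed.

Lemma degree3_link F j : degree W F = 3 ->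
  link F j = face_vertices F :\ walk W F j.+1.
Proof.
move=> F3; rewrite (degree3_vertices j F3) [[set walk W F j; _]]setUC -setUA setU1K//.
by rewrite !inE negb_or eq_sym !adj_neq ?walk_adj.
Qed.

Lemma degree3_side F u v : degree W F = 3 -> u != v -> u \in face_vertices F ->
  v \in face_vertices F -> exists j, side_edge F j = [set u; v].
Proof.
move=> F3 uv /face_vertices_walk[j wu]; rewrite (degree3_vertices j.+1 F3) wu !inE -orbA.
move=> /or3P[] /eqP vE; first by rewrite vE eqxx in uv.
  by exists j.+1; rewrite /side_edge wu -vE.
by exists j.+3; rewrite /side_edge -vE degree3_walk// wu setUC.
Qed.

Lemma degree3_side_inj p q u v : tag p = tag q -> degree W (tag p) = 3 ->
  on_edge p u v -> on_edge q u v -> p = q.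
Proof.
move=> pq p3 /eqP pe /eqP qe.
have {}qe : side_edge (tag p) (tagged q) = [set u; v] by rewrite pq.
have opposite i : walk W (tag p) i.+2 \notin side_edge (tag p) i.
  by rewrite !inE negb_or eq_sym adj_neq ?walk_adj2// eq_sym adj_neq ?walk_adj.
have := opposite (tagged q); have := mem_walk (tag p) (tagged q).+2.
rewrite (degree3_vertices (tagged p) p3) inE -/(side_edge (tag p) (tagged p)) pe -qe.
move=> /orP[->//|]; rewrite inE => /eqP/(degree3_walk_inj p3)/eqP.
rewrite -(addn2 (tagged p)) -(addn2 (tagged q)) eqn_modDr => /eqP qp _.
exact: eq_side pq (esym qp).
Qed.

Lemma degree_shift3 F j : j = j.+3 %[mod degree W F] -> degree W F = 3.
Proof.
rewrite -{1}[j]addn0 -addn3 => /eqP; rewrite eqn_modDl mod0n eq_sym => /dvdn_leq.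
by move=> /(_ isT) le3; apply/eqP; rewrite eqn_leq le3 degree_gt2.
Qed.

Lemma degree3_of_wrap F1 F2 j : two_sided -> closed_corners -> F1 <> F2 ->
  degree W F1 = 3 ->
  face_vertices F1 = [set walk W F2 j; walk W F2 j.+1; walk W F2 j.+2] ->
  walk W F2 j.+3 = walk W F2 j -> degree W F2 = 3.
Proof.
move=> two corners F12 F1_3; have [k kj] := walk_pred F2 j.
have := kj 0; have := kj 1; have := kj 2; have := kj 3.
rewrite !addnS !addn0 => <- <- <- <- F1E wrap.
have /face_vertices_walk[i wi] : walk W F2 k.+2 \in face_vertices F1.
  by rewrite F1E !inE eqxx orbT.
have linkE : link F2 k.+1 = link F1 i.
  rewrite (degree3_link i F1_3) wi F1E setUAC [_ :|: [set _]]setUC setU1K//.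
  by rewrite !inE negb_or eq_sym !adj_neq ?walk_adj.
have : walk W F2 k \in link F2 k.+1.
  by apply: corners (esym wi) linkE _ _; [exact: nesym|rewrite adjC walk_adj2].
rewrite !inE (negbTE (adj_neq (walk_adj W F2 k)))/= => /eqP wk.
have [l F1l] : exists l, side_edge F1 l = [set walk W F2 k.+3; walk W F2 k.+1].
  apply: degree3_side => //; rewrite ?F1E ?inE ?eqxx ?orbT// eq_sym.
  exact/adj_neq/walk_adj2.
apply: (@degree_shift3 _ k); apply: side_at_inj.
apply: (@third_side (walk W F2 k.+3) (walk W F2 k.+1) (side_at F1 l));
  rewrite ?on_edge_side_at ?F1l//.
- by rewrite /side_edge wk.
- by rewrite /side_edge wrap.
- by move=> /(congr1 tag).
- by move=> /(congr1 tag).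
Qed.

Lemma degree3_beside F1 F2 j u v : two_sided -> closed_corners -> F1 <> F2 ->
  degree W F1 = 3 -> side_edge F2 j = [set u; v] ->
  (forall C, triangle C -> u \in C -> v \in C -> C = face_vertices F1) ->
  degree W F2 = 3.
Proof.
move=> two corners F12 F1_3 jE only; have [k kj] := walk_pred F2 j.
have [kj0 kj1] := (kj 0, kj 1); rewrite !addnS !addn0 in kj0 kj1.
have {}jE : [set walk W F2 k.+1; walk W F2 k.+2] = [set u; v] by rewrite kj0 kj1 -jE.
have only_face (C : {set V}) : triangle C -> walk W F2 k.+1 \in C -> walk W F2 k.+2 \in C ->
    C = face_vertices F1.
  move=> tC k1 k2; have /subsetP uvC : [set u; v] \subset C.
    by rewrite -jE; apply/subsetP => t; rewrite !inE => /orP[] /eqP->.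
  by apply: only => //; apply: uvC; rewrite !inE eqxx ?orbT.
have before := only_face _ (walk_triangle F2 k).
have after := only_face _ (walk_triangle F2 k.+1).
rewrite !inE !eqxx ?orbT/= in before after.
apply: (degree3_of_wrap (j := k) two corners F12 F1_3); first by rewrite before.
by apply: walk_wrap; rewrite before// -after// !inE eqxx orbT.
Qed.

Lemma triangular_side_contractible u v p q : two_sided -> closed_corners ->
  (forall C, triangle C -> u \in C -> v \in C -> facial C) ->
  edge_sides u v p q -> degree W (tag p) = 3 ->
  contractible_edge u v \/ twin_faces (tag p) (tag q).
Proof.
move=> two corners fac pq p3; have [pe qe] := edge_sides_on pq.
have uv := adj_neq (on_edge_adj pe).
have faceE C : triangle C -> u \in C -> v \in C ->
    C = face_vertices (tag p) \/ degree W (tag q) = 3 /\ C = face_vertices (tag q).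
  move=> tC uC vC; have [F F3 CF] := fac C tC uC vC; rewrite CF in uC vC *.
  have [j /eqP jE] := degree3_side F3 uv uC vC.
  have /pq.2[/(congr1 tag)/= FE|/(congr1 tag)/= FE] : on_edge (side_at F j) u v.
    - by rewrite on_edge_side_at.
    - by left; rewrite FE.
  by right; rewrite -FE.
have mem_tri (r : side) : on_edge r u v -> degree W (tag r) = 3 ->
    [/\ triangle (face_vertices (tag r)), u \in face_vertices (tag r) &
        v \in face_vertices (tag r)].
  move=> re r3; have [ur vr] := on_edge_mem re; split=> //.
  by rewrite (degree3_vertices 0 r3); exact: walk_triangle.
have pq_tag : tag p <> tag q.
  by move=> tagE; apply: pq.1; exact: degree3_side_inj tagE p3 pe qe.
have [q3|q3] := pselect (degree W (tag q) = 3); last first.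
  exfalso; apply: (q3); apply: (degree3_beside two corners pq_tag p3 (eqP qe)) => C tC uC vC.
  by have [|[/q3]] := faceE C tC uC vC.
have [verts|verts] := eqVneq (face_vertices (tag p)) (face_vertices (tag q)).
  by right.
left; exists (face_vertices (tag p)), (face_vertices (tag q)); split=> //.
- by exists (tag p).
- by exists (tag q).
- move=> C; split=> [[tC uC vC]|[->|->]]; [|exact: mem_tri|exact: mem_tri].
  by have [->|[_ ->]] := faceE C tC uC vC; [left|right].
Qed.

Lemma facial_edge_contractible_or_twin u v : two_sided -> closed_corners -> adj u v ->
  (forall C, triangle C -> u \in C -> v \in C -> facial C) ->
  contractible_edge u v \/
  exists F1 F2, [/\ twin_faces F1 F2, u \in face_vertices F1 & v \in face_vertices F1].
Proof.
move=> two corners uv fac; have [p [q pq]] := two _ _ uv; have [pe _] := edge_sides_on pq.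
have [F F3 FE] : exists2 F, degree W F = 3 & u \in face_vertices F /\ v \in face_vertices F.
  have pC : [set u; v] \subset
      [set walk W (tag p) (tagged p); walk W (tag p) (tagged p).+1; walk W (tag p) (tagged p).+2].
    by rewrite -(eqP pe); exact: subsetUl.
  have uC := subsetP pC u (set21 _ _); have vC := subsetP pC v (set22 _ _).
  by have [F F3 CF] := fac _ (walk_triangle _ _) uC vC; exists F; rewrite // -CF.
have [j /eqP jE] := degree3_side F3 (adj_neq uv) FE.1 FE.2.
have : on_edge (side_at F j) u v by rewrite on_edge_side_at.
move=> /pq.2[/(congr1 tag)/= Fp|/(congr1 tag)/= Fq].
  rewrite Fp in F3 FE; have [|twin] := triangular_side_contractible two corners fac pq F3.
    by left.
  by right; exists (tag p), (tag q); split=> //; case: FE.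
rewrite Fq in F3 FE.
have [|twin] := triangular_side_contractible two corners fac (edge_sides_sym pq) F3.
  by left.
by right; exists (tag q), (tag p); split=> //; case: FE.
Qed.

Lemma twin_faces_closed F1 F2 u v : closed_corners -> twin_faces F1 F2 ->
  u \in face_vertices F1 -> adj u v -> v \in face_vertices F1.
Proof.
move=> corners [F12 F1_3 F2_3 F12E] u1 uv; have u2 : u \in face_vertices F2 by rewrite -F12E.
have [j ju] := face_vertices_walk u1; have [k ku] := face_vertices_walk u2.
have linkE : link F1 j = link F2 k by rewrite !degree3_link// ju ku F12E.
have : v \in link F1 j by apply: corners F12 _ linkE _ _; rewrite ju ?ku.
by rewrite degree3_link// => /setD1P[].
Qed.

Lemma twin_faces_vertices F1 F2 : closed_corners -> (forall u v, connect adj u v) ->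
  twin_faces F1 F2 -> face_vertices F1 = setT.
Proof.
move=> corners conn twin; apply/setP => v; rewrite inE.
have /connectP[s] := conn (walk W F1 0) v; have := mem_walk F1 0.
elim: s (walk W F1 0) => [|t s ih] u u1 /=; first by move=> _ ->.
by move=> /andP[ut ts]; apply: ih ts; exact: twin_faces_closed twin u1 ut.
Qed.

Lemma twin_faces_only F1 F2 F : two_sided -> closed_corners -> (forall u v, connect adj u v) ->
  twin_faces F1 F2 -> F = F1 \/ F = F2.
Proof.
move=> two corners conn twin; have [F12 F1_3 F2_3 F12E] := twin.
have all1 := twin_faces_vertices corners conn twin.
pose u := walk W F 0; pose v := walk W F 1; have uv : u != v := adj_neq (walk_adj W F 0).
have side_of F' : degree W F' = 3 -> face_vertices F' = setT ->
    exists2 r : side, on_edge r u v & tag r = F'.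
  move=> F'3 F'T; have [||j /eqP jE] := degree3_side F'3 uv; rewrite ?F'T ?inE//.
  by exists (side_at F' j); rewrite ?on_edge_side_at.
have [p pe pF1] := side_of F1 F1_3 all1.
have [q qe qF2] : exists2 q : side, on_edge q u v & tag q = F2 by apply: side_of; rewrite -?F12E.
have re : on_edge (side_at F 0) u v by rewrite on_edge_side_at.
have pq : p <> q by move=> pq; apply: F12; rewrite -pF1 -qF2 pq.
have [pF|pr] := pselect (p = side_at F 0); [by left; rewrite -pF1 pF|right].
by rewrite -qF2 (third_side two pe qe re pq pr).
Qed.

End Walks.

Section Regions.
Variables (FT : finType) (W : face_walks FT).
Implicit Types (X Y Z : {set FT}) (C D I J : {set V}) (u v : V)
  (p q r : side W).
Hypothesis two : two_sided W.

(* The border of a set of faces, as a chain of edges modulo 2. *)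
Definition border X u v := odd #|[set p : side W | on_edge p u v & tag p \in X]|.

Lemma borderC X u v : border X u v = border X v u.
Proof.
by congr odd; apply: eq_card => p; rewrite !inE on_edgeC.
Qed.

Lemma border_adj X u v : border X u v -> adj u v.
Proof.
rewrite /border => /odd_gt0; rewrite card_gt0 => /set0Pn[p].
by rewrite inE => /andP[/on_edge_adj].
Qed.

Lemma borderE X u v p q : edge_sides u v p q ->
  border X u v = (tag p \in X) (+) (tag q \in X).
Proof.
move=> [/eqP pq pqP]; rewrite /border.
have -> : [set r | on_edge r u v & tag r \in X] = [set r in [set p; q] | tag r \in X].
  apply/setP => r; rewrite !inE; congr (_ && _).
  apply/idP/orP => [/pqP[]->|[]/eqP->]; rewrite ?eqxx; auto; apply/pqP; auto.
rewrite cardsE -sum1_card (eq_bigl _ _ (fun=> erefl)) big_mkcondr/=.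
by rewrite big_setU1 ?big_set1 ?inE//=; case: ifP; case: ifP.
Qed.

Lemma border_setU X Y u v : [disjoint X & Y] ->
  border (X :|: Y) u v = border X u v (+) border Y u v.
Proof.
move=> XY; rewrite /border -oddD; congr odd; rewrite -cardsUI.
rewrite [X in _ = _ + X](_ : _ = 0) ?addn0; last first.
  apply/eqP; rewrite cards_eq0; apply/eqP/setP => p; rewrite !inE.
  by apply/negP => /andP[/andP[_ pX] /andP[_]]; apply/negP; rewrite (disjointFr XY).
by apply: eq_card => p; rewrite !inE -andb_orr.
Qed.

Lemma sum_on_edge (p : side W) u :
  \sum_v on_edge p u v = (walk W (tag p) (tagged p) == u) + (walk W (tag p) (tagged p).+1 == u).
Proof.
rewrite /on_edge /side_edge; have := adj_neq (walk_adj W (tag p) (tagged p)).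
move: (walk W _ (tagged p)) (walk W _ _.+1) => a b ab.
rewrite (eq_bigr (fun v => ((a == u) && (b == v)) + ((b == u) && (a == v)))); last first.
  move=> v _; rewrite eq_set2; have [<-|_] /= := eqVneq a u; last by rewrite andbC.
  by rewrite [b == a]eq_sym (negbTE ab) andbF orbF addn0.
rewrite big_split/=; congr addn.
  rewrite (bigD1 b)//= eqxx andbT big1 ?addn0// => v; rewrite eq_sym => /negbTE->.
  by rewrite andbF.
rewrite (bigD1 a)//= eqxx andbT big1 ?addn0// => v; rewrite eq_sym => /negbTE->.
by rewrite andbF.
Qed.

Lemma sum_walkS F u :
  \sum_(j < degree W F) (walk W F j.+1 == u) = \sum_(j < degree W F) (walk W F j == u).
Proof.
have := walk_periodic W F 0; have := degree_gt0 W F; rewrite add0n.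
case: (degree W F) => // d _ wd.
by rewrite big_ord_recr big_ord_recl/= wd addnC.
Qed.

(* Each face of [Y] enters and leaves [u] equally often. *)
Lemma border_even Y u : ~~ odd (\sum_v border Y u v).
Proof.
have oddE (f : V -> nat) : odd (\sum_v f v) = \big[addb/false]_v odd (f v).
  exact: (big_morph odd oddD).
rewrite oddE; under eq_bigr => v _ do rewrite oddb.
rewrite -oddE; under eq_bigr => v _ do rewrite -sum1dep_card big_mkcondr.
rewrite (eq_bigr (fun v => \sum_(p : side W | tag p \in Y) on_edge p u v)); last first.
  move=> v _; rewrite [RHS]big_mkcond [LHS]big_mkcond; apply: eq_bigr => p _.
  by case: (on_edge _ _ _); case: (tag p \in Y).
rewrite exchange_big/=; under eq_bigr => p _ do rewrite sum_on_edge.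
rewrite big_split/= oddD.
have sumE (f : FT -> nat -> nat) : \sum_(p : side W | tag p \in Y) f (tag p) (tagged p) =
    \sum_(F in Y) \sum_(j < degree W F) f F j.
  rewrite (sig_big_dep (mem Y) (fun=> xpredT) (fun F (j : 'I_(degree W F)) => f F j)).
  by apply: eq_bigl => p; rewrite andbT.
rewrite (sumE (fun F j => walk W F j == u : nat)) (sumE (fun F j => walk W F j.+1 == u : nat)).
by under [X in _ (+) odd X]eq_bigr => F _ do rewrite sum_walkS; rewrite addbb.
Qed.

Lemma border_in_triangle Y C : triangle C ->
  (forall u v, border Y u v -> u \in C /\ v \in C) ->
  (forall u v, ~~ border Y u v) \/
  forall u v, border Y u v = [&& adj u v, u \in C & v \in C].
Proof.
move=> tC YC.
have share u v t : u \in C -> v \in C -> t \in C -> u != v -> u != t -> v != t ->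
    border Y u v = border Y u t.
  move=> uC vC tC' uv ut vt.
  have CE : C = [set u; v; t].
    apply/esym/eqP; rewrite eqEcard tC.1 cards3// andbT; apply/subsetP => z.
    by rewrite !inE -orbA => /or3P[] /eqP->.
  have := border_even Y u.
  rewrite (bigD1 v)//= (bigD1 t) 1?eq_sym//= big1 ?addn0 => [|z /andP[zv zt]].
    by rewrite oddD !oddb; case: (border Y u v); case: (border Y u t).
  apply/eqP; rewrite eqb0; apply/negP => uz; have [_] := YC _ _ uz.
  rewrite CE !inE (negbTE zv) (negbTE zt) !orbF => /eqP zu.
  by move: (border_adj uz); rewrite zu adjI.
have {}share u v t : u \in C -> v \in C -> t \in C -> u != v -> u != t ->
    border Y u v = border Y u t.
  by move=> uC vC tC' uv ut; have [->//|] := eqVneq v t; exact: share.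
have [/existsP[a /existsP[b ab]]|/existsPn none] :=
    boolP [exists u, [exists v, border Y u v]]; last first.
  by left=> u v; have /existsPn := none u.
right=> u v; apply/idP/and3P => [uvY|[uv uC vC]].
  by have [uC vC] := YC u v uvY; rewrite (border_adj uvY).
have [aC bC] := YC a b ab; have nuv := adj_neq uv; have nab := adj_neq (border_adj ab).
have [ua|nua] := eqVneq u a; first by rewrite ua in uC nuv *; rewrite (share a v b).
rewrite (share u v a)// borderC (share a u b)// eq_sym//.
Qed.

(* [X] and [I] are the sets of faces and of vertices surrounded by the 3-cycle [C]. *)
Record region C X I : Prop := Region {
  region_triangle : triangle C;
  region_border : forall u v, adj u v -> border X u v = (u \in C) && (v \in C);
  region_neighbours : forall u v, u \in I -> adj u v -> v \in I :|: C;
  region_sides : forall u v p, u \in I -> on_edge p u v -> tag p \in X;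
  region_vertices : forall F, F \in X -> face_vertices W F \subset I :|: C
}.

Lemma empty_region_facial C X : region C X set0 -> facial W C.
Proof.
move=> reg; have tC := region_triangle reg; have [C3 _] := tC.
have [u uC] : exists u, u \in C by apply/card_gt0P; rewrite C3.
have [v [t [uv _ _ CE]]] := triangle_vertex tC uC.
have vC : v \in C by rewrite CE !inE eqxx orbT.
have [p [q pq]] := two uv; have [pe qe] := edge_sides_on pq.
have := region_border reg uv; rewrite (borderE X pq) uC vC /= => pqX.
have [r [re rX rq]] : exists r, [/\ on_edge r u v, tag r \in X &
    forall s, on_edge s u v -> tag s \in X -> s = r].
  have [pX|pX] := boolP (tag p \in X); rewrite ?pX ?(negbTE pX) in pqX.
    by exists p; split=> // s /pq.2[]-> //; rewrite (negbTE pqX).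
  by exists q; split=> // s /pq.2[]-> //; rewrite (negbTE pX).
have /subsetP FC := region_vertices reg rX; rewrite set0U in FC.
have wE j : C = [set walk W (tag r) j; walk W (tag r) j.+1; walk W (tag r) j.+2].
  apply/esym/eqP; rewrite eqEcard C3 (walk_triangle W _ j).1 leqnn andbT.
  by apply/subsetP => z; rewrite !inE -orbA => /or3P[] /eqP->; exact/FC/mem_walk.
have wrap j : walk W (tag r) j.+3 = walk W (tag r) j.
  by apply: walk_wrap; rewrite -wE; exact/FC/mem_walk.
have r3 : degree W (tag r) = 3.
  have side_atE j : side_edge W (tag r) j = [set u; v] -> side_at W (tag r) j = r.
    by move=> jE; apply: rq; rewrite ?on_edge_side_at ?jE.
  apply: (@degree_shift3 _ W _ (tagged r)); apply: side_at_inj.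
  by rewrite !side_atE /side_edge ?wrap//; exact/eqP.
by exists (tag r); rewrite // (degree3_vertices 0 r3) -wE.
Qed.

Definition acyclic X :=
  forall Y, Y \subset X -> (forall u v, ~~ border Y u v) -> Y = set0.

Lemma region_triangle_subset C X I D u : region C X I -> triangle D -> u \in I ->
  u \in D -> D \subset I :|: C.
Proof.
move=> reg tD uI uD; have [v [t [uv ut _ ->]]] := triangle_vertex tD uD.
apply/subsetP => z; rewrite [z \in _]inE in_set2 inE -orbA => /or3P[] /eqP->.
- by rewrite inE uI.
- exact: region_neighbours reg _ _ uI uv.
- exact: region_neighbours reg _ _ uI ut.
Qed.

Lemma region_setD_border C X I D Z J u : region C X I -> region D Z J ->
  u \in I -> u \in D -> forall a b, border (Z :\: X) a b -> a \in C /\ b \in C.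
Proof.
move=> regC regD uI uD a b abY; have ab := border_adj abY.
have [p [q pq]] := two ab; have [pe qe] := edge_sides_on pq.
have /subsetP DIC := region_triangle_subset regC (region_triangle regD) uI uD.
apply/andP/negPn/negP => abC; move: abY.
have := region_border regC ab; rewrite (borderE X pq) (negbTE abC).
have := region_border regD ab; rewrite (borderE Z pq) (borderE _ pq) !inE.
have [/andP[aD bD]|_] := boolP ((a \in D) && (b \in D)); last first.
  by do 4!case: (_ \in _).
have [pX qX] : tag p \in X /\ tag q \in X.
  move: abC; rewrite negb_and => /orP[aC|bC].
    have aI : a \in I by have := DIC a aD; rewrite inE (negbTE aC) orbF.
    by split; [exact: (region_sides regC aI pe)|exact: (region_sides regC aI qe)].
  have bI : b \in I by have := DIC b bD; rewrite inE (negbTE bC) orbF.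
  rewrite on_edgeC in pe; rewrite on_edgeC in qe.
  by split; [exact: (region_sides regC bI pe)|exact: (region_sides regC bI qe)].
by rewrite pX qX.
Qed.

Lemma inner_region_proper X0 C X I D Z J u : acyclic X0 -> region C X I -> region D Z J ->
  X \subset X0 -> Z \subset X0 -> u \in I -> u \in D -> Z \proper X.
Proof.
move=> acyc regC regD XX0 ZX0 uI uD.
have [v [t [uv _ _ DE]]] := triangle_vertex (region_triangle regD) uD.
have vD : v \in D by rewrite DE !inE eqxx orbT.
have [p [q pq]] := two uv; have [pe qe] := edge_sides_on pq.
have pX := region_sides regC uI pe; have qX := region_sides regC uI qe.
have YX0 : Z :\: X \subset X0 by exact: subset_trans (subsetDl _ _) ZX0.
have Y0 : Z :\: X = set0.
  have [|Yborder] := border_in_triangle (region_triangle regC)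
    (region_setD_border regC regD uI uD); first exact: acyc.
  have : X :|: Z :\: X = set0.
    apply: acyc => [|a b]; first by rewrite subUset XX0.
    have [ab|nab] := boolP (adj a b); last by apply: contra nab; exact: border_adj.
    rewrite border_setU ?(region_border regC ab) ?Yborder ?ab ?addbb//.
    by rewrite disjoint_sym disjoints_subset setDE subsetIr.
  by move=> /setP/(_ (tag p)); rewrite !inE pX.
rewrite properE -setD_eq0 Y0 eqxx; apply/subsetPn.
have := region_border regD uv; rewrite (borderE Z pq) uD vD.
by have [pZ|pZ _] := boolP (tag p \in Z); [exists (tag q)|exists (tag p)].
Qed.

Lemma twin_faces_borderless F1 F2 : twin_faces W F1 F2 -> forall u v, ~~ border [set F1; F2] u v.
Proof.
move=> [F12 F1_3 F2_3 F12E] u v; apply/negP => uvB; have uv := border_adj uvB.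
have [p [q pq]] := two uv; have [pe qe] := edge_sides_on pq.
have other F F' (r : side W) : degree W F' = 3 -> face_vertices W F = face_vertices W F' ->
    tag r = F -> on_edge r u v -> exists2 s : side W, on_edge s u v & tag s = F'.
  move=> F'3 FE rF re; have := on_edge_mem re; rewrite rF FE => -[uF vF].
  have [j /eqP jE] := degree3_side F'3 (adj_neq uv) uF vF.
  by exists (side_at W F' j); rewrite ?on_edge_side_at.
have all_in (r t : side W) : on_edge r u v -> tag r \in [set F1; F2] -> on_edge t u v ->
    tag t \in [set F1; F2].
  have fill F F' : F <> F' -> degree W F' = 3 -> face_vertices W F = face_vertices W F' ->
      on_edge r u v -> tag r = F -> on_edge t u v -> tag t = F \/ tag t = F'.
    move=> FF' F'3 FE re rF te; have [s se sF'] := other _ _ _ F'3 FE rF re.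
    have [<-|tr] := pselect (r = t); [by left|right; rewrite -sF'; congr tag].
    by apply/esym/(third_side two re) => // rs; apply: FF'; rewrite -rF rs.
  move=> re; rewrite !inE => /orP[]/eqP rF te.
    by case: (fill _ _ F12 F2_3 F12E re rF te) => ->; rewrite eqxx ?orbT.
  by case: (fill _ _ (nesym F12) F1_3 (esym F12E) re rF te) => ->; rewrite eqxx ?orbT.
move: uvB; rewrite (borderE _ pq); have := all_in _ _ pe; have := all_in _ _ qe.
move=> /(_ p)/[swap] /(_ q).
by case: (tag p \in _) => [/(_ isT qe)->//|_]; case: (tag q \in _) => // /(_ isT pe).
Qed.

Lemma acyclic_region_interior X0 C0 I0 : closed_corners W -> acyclic X0 ->
  region C0 X0 I0 ->
  (forall u C, u \in I0 -> triangle C -> u \in C ->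
    exists X I, [/\ region C X I, X \subset X0 & I \subset I0]) ->
  (forall u, exists v, adj u v) -> (forall u v, adj u v -> ~ contractible_edge W u v) ->
  I0 = set0.
Proof.
move=> corners acyc reg0 inner nbr ncontr.
suff empty n C X I : #|X| <= n -> region C X I -> X \subset X0 -> I \subset I0 -> I = set0.
  exact: (empty #|X0| C0 X0 I0).
elim: n C X I => [|n ih] C X I Xn reg XX0 II0; apply/eqP/negPn/negP => /set0Pn[u uI];
  have [v uv] := nbr u; have [p [q pq]] := two uv; have [pe _] := edge_sides_on pq.
  have := region_sides reg uI pe; move: Xn; rewrite leqn0 cards_eq0 => /eqP->.
  by rewrite inE.
have fac D : triangle D -> u \in D -> facial W D.
  move=> tD uD; have [Z [J [regD ZX0 JI0]]] := inner u D (subsetP II0 u uI) tD uD.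
  have /proper_card ZX := inner_region_proper acyc reg regD XX0 ZX0 uI uD.
  apply: (@empty_region_facial _ Z).
  by rewrite -(ih D Z J)// -ltnS (leq_trans ZX).
have [|/(ncontr _ _ uv)//|] := facial_edge_contractible_or_twin two corners uv.
  by move=> D tD uD _; exact: fac.
move=> [F1 [F2 [twin u1 v1]]]; have [F12 F1_3 F2_3 F12E] := twin.
have inX F : degree W F = 3 -> u \in face_vertices W F -> v \in face_vertices W F -> F \in X.
  move=> F3 uF vF; have [j /eqP jE] := degree3_side F3 (adj_neq uv) uF vF.
  have jon : on_edge (side_at W F j) u v by rewrite on_edge_side_at.
  exact: (region_sides reg uI jon).
have : [set F1; F2] = set0.
  apply: acyc (twin_faces_borderless twin); apply: subset_trans XX0.
  apply/subsetP => F; rewrite !inE => /orP[] /eqP->; first exact: inX.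
  by apply: inX; rewrite -?F12E.
by move=> /setP/(_ F1); rewrite !inE eqxx.
Qed.

End Regions.
End FaceWalks.

Local Open Scope classical_set_scope.
Local Open Scope ring_scope.

Local Notation plane R := (R * R)%type.
Local Notation odisk := (@open_disk _).
Local Notation cdisk := (@closed_disk _).
Local Notation circle := (@unit_circle _).

(** * Continuity on a subset *)

Definition cont_on (T U : topologicalType) (A : set T) (f : T -> U) :=
  {within A, continuous f}.

Section ContOn.
Variables (T U V : topologicalType).
Implicit Types (A B : set T) (f : T -> U).

Lemma cont_onS A B f : A `<=` B -> cont_on B f -> cont_on A f.
Proof. exact: continuous_subspaceW. Qed.

Lemma cont_on_near A f x (N : set U) : cont_on A f -> A x -> nbhs (f x) N ->
  \forall y \near x, A y -> N (f y).
Proof.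
by move=> /subspace_continuousP fA Ax Nfx; have := fA x Ax N Nfx; rewrite /= /within nbhs_simpl.
Qed.

Lemma near_cont_on A f :
  (forall x N, A x -> nbhs (f x) N -> \forall y \near x, A y -> N (f y)) -> cont_on A f.
Proof. by move=> fA; apply/subspace_continuousP => x Ax N /(fA x N Ax). Qed.

Lemma continuous_cont_on A f : continuous f -> cont_on A f.
Proof. exact: continuous_subspaceT. Qed.

Lemma eq_cont_on A f g : (forall x, A x -> f x = g x) -> cont_on A f -> cont_on A g.
Proof.
move=> fg fA; apply: near_cont_on => x N Ax; rewrite -fg// => /(cont_on_near fA Ax).
by apply: filterS => y h Ay; rewrite -fg//; exact: h.
Qed.

Lemma cont_onU A B f : closed A -> closed B -> cont_on A f -> cont_on B f ->
  cont_on (A `|` B) f.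
Proof. exact: withinU_continuous. Qed.

Lemma cont_on_open A f (N : set U) : open A -> cont_on A f -> open N ->
  open (A `&` f @^-1` N).
Proof.
move=> oA fA oN; rewrite openE => x [Ax Nfx].
have := cont_on_near fA Ax (open_nbhs_nbhs (conj oN Nfx)).
by apply: filterS2 (open_nbhs_nbhs (conj oA Ax)) => y Ay /(_ Ay).
Qed.

End ContOn.

Lemma cont_on_comp (T U V : topologicalType) (A : set T) (B : set U) (f : T -> U) (g : U -> V) :
  (forall x, A x -> B (f x)) -> cont_on A f -> cont_on B g ->
  cont_on A (fun x => g (f x)).
Proof.
move=> AB fA gB; apply: near_cont_on => x N Ax Ng.
have /(cont_on_near fA Ax) := cont_on_near gB (AB _ Ax) Ng.
by apply: filterS => y h Ay; apply: h => //; exact: AB.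
Qed.

Section ContOnOperations.
Variables (T U V : topologicalType) (A : set T).

Lemma cont_on_id : cont_on A id.
Proof. by apply: continuous_cont_on => x. Qed.

Lemma cont_on_cst (y : U) : cont_on A (fun=> y).
Proof. by apply: continuous_cont_on => x; exact: cvg_cst. Qed.

Lemma cont_on_pair (f : T -> U) (g : T -> V) :
  cont_on A f -> cont_on A g -> cont_on A (fun x => (f x, g x)).
Proof. by move=> fA gA x; apply: cvg_pair; [exact: fA|exact: gA]. Qed.

Lemma cont_on_fst (f : T -> U * V) : cont_on A f -> cont_on A (fun x => (f x).1).
Proof. by move=> fA x; apply: (cvg_comp f fst (fA x)); exact: cvg_fst. Qed.

Lemma cont_on_snd (f : T -> U * V) : cont_on A f -> cont_on A (fun x => (f x).2).
Proof. by move=> fA x; apply: (cvg_comp f snd (fA x)); exact: cvg_snd. Qed.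

Variables (R : realType) (W : normedModType R).

Lemma cont_onD (f g : T -> W) : cont_on A f -> cont_on A g -> cont_on A (fun x => f x + g x).
Proof. by move=> fA gA x; apply: cvgD; [exact: fA|exact: gA]. Qed.

Lemma cont_onN (f : T -> W) : cont_on A f -> cont_on A (fun x => - f x).
Proof. by move=> fA x; apply: cvgN; exact: fA. Qed.

Lemma cont_onB (f g : T -> W) : cont_on A f -> cont_on A g -> cont_on A (fun x => f x - g x).
Proof. by move=> fA gA; apply: cont_onD => //; exact: cont_onN. Qed.

Lemma cont_onZ (k : T -> R) (f : T -> W) :
  cont_on A k -> cont_on A f -> cont_on A (fun x => k x *: f x).
Proof. by move=> kA fA x; apply: cvgZ; [exact: kA|exact: fA]. Qed.

Lemma cont_onM (f g : T -> R) : cont_on A f -> cont_on A g -> cont_on A (fun x => f x * g x).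
Proof. by move=> fA gA x; apply: cvgM; [exact: fA|exact: gA]. Qed.

Lemma cont_onX (f : T -> R) n : cont_on A f -> cont_on A (fun x => f x ^+ n).
Proof.
move=> fA; apply: (@cont_on_comp _ _ _ A setT f (fun y => y ^+ n)) => //.
by apply: continuous_cont_on; exact: exprn_continuous.
Qed.

Lemma cont_onV (f : T -> R) : (forall x, A x -> f x != 0) -> cont_on A f ->
  cont_on A (fun x => (f x)^-1).
Proof.
move=> f0 fA; apply: (@cont_on_comp _ _ _ A [set y | y != 0] f) => //.
by apply/subspace_continuousP => y y0; apply: cvg_within_filter; exact: inv_continuous.
Qed.

Lemma cont_on_sqrt (f : T -> R) : cont_on A f -> cont_on A (fun x => Num.sqrt (f x)).
Proof.
move=> fA; apply: (@cont_on_comp _ _ _ A setT) => //.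
by apply: continuous_cont_on; exact: sqrt_continuous.
Qed.

End ContOnOperations.

Lemma connected_locally_constant (T : topologicalType) (A : set T) (P : T -> Prop) :
  connected A ->
  (forall x, A x -> \forall y \near x, A y -> (P y <-> P x)) ->
  forall x y, A x -> A y -> P x -> P y.
Proof.
move=> cA locP x y Ax Ay Px.
suff AE : A = A `&` P by move: Ay; rewrite AE => -[].
have Alo : A `&` P = A `&` [set z | A z -> P z]°.
  apply/seteqP; split=> z [Az Pz]; split=> //.
    by have := locP z Az; apply: filterS => t /[swap] At /(_ At) ->.
  by have := nbhs_singleton Pz; exact.
have Alc : A `&` P = A `&` ~` [set z | A z -> ~ P z]°.
  apply/seteqP; split=> z [Az Pz]; split=> //.
    by move=> /nbhs_singleton/(_ Az).
  apply: contrapT => nPz; apply: Pz; have := locP z Az.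
  by apply: filterS => t /[swap] At /(_ At) ->.
apply/esym/cA; first by exists x.
- by exists [set z | A z -> P z]° => //; exact: open_interior.
- by exists (~` [set z | A z -> ~ P z]°) => //; exact/open_closedC/open_interior.
Qed.

Lemma connected_gt0 (R : realType) (T : topologicalType) (A : set T) (f : T -> R) x y :
  connected A -> cont_on A f -> (forall z, A z -> f z != 0) -> A x -> A y ->
  (0 < f x) = (0 < f y).
Proof.
move=> cA fA f0; have pos p q : A p -> A q -> 0 < f p -> 0 < f q.
  move=> Ap Aq fp; rewrite ltNge; apply/negP => fq.
  have /connected_intervalP itv : connected (f @` A) by exact: connected_continuous_connected.
  have [|z Az /eqP] := itv _ _ (imageP f Aq) (imageP f Ap) 0; first by rewrite fq ltW.
  by apply/negP; exact: f0.
by move=> Ax Ay; apply/idP/idP; exact: pos.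
Qed.

Lemma compact_inverse (T U : topologicalType) (x0 : T) (K : set T) (f : T -> U) :
  hausdorff_space U -> compact K -> cont_on K f -> set_inj K f ->
  exists2 g : U -> T, (forall x, K x -> g (f x) = x) & cont_on (f @` K) g.
Proof.
move=> hU cK fK fI.
have [g gf] : exists g : U -> T, forall x, K x -> g (f x) = x.
  have /choice[g gP] y : exists x, (f @` K) y -> K x /\ f x = y.
    have [[x Kx fx]|nKy] := pselect ((f @` K) y); first by exists x.
    by exists x0.
  exists g => x Kx; have [Kg fg] := gP _ (imageP f Kx).
  by apply: fI; rewrite ?inE.
exists g => //; apply: near_cont_on => _ N [x Kx <-]; rewrite gf// nbhsE => -[W [oW Wx] WN].
have cKW : compact (K `&` ~` W) by apply: compact_closedI => //; exact: open_closedC.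
have cl : closed (f @` (K `&` ~` W)).
  apply: compact_closed => //; apply: continuous_compact cKW.
  by apply: cont_onS fK => z [].
have : nbhs (f x) (~` (f @` (K `&` ~` W))).
  apply: open_nbhs_nbhs; split; first exact: closed_openC.
  by move=> [z [Kz nWz] /fI zx]; apply: nWz; rewrite zx ?inE.
apply: filterS => y h [z Kz zy]; rewrite -zy in h *; rewrite gf//; apply: WN.
by apply: contrapT => nWz; apply: h; exists z.
Qed.

Lemma compact_near_preimage (T U : topologicalType) (K : set T) (h : T -> U)
    (p : U) (A : set U) : hausdorff_space U -> compact K -> cont_on K h ->
  (forall z, K z -> h z = p -> \forall z' \near z, K z' -> A (h z')) ->
  \forall y \near p, forall z, K z -> h z = y -> A y.
Proof.
move=> hU cK hcont hp.
pose B := K `&` closure [set z | K z /\ ~ A (h z)].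
have cB : compact B by apply: compact_closedI => //; exact: closed_closure.
have clB : closed (h @` B).
  by apply: compact_closed => //; apply: continuous_compact cB; apply: cont_onS hcont => z [].
have : nbhs p (~` (h @` B)).
  apply: open_nbhs_nbhs; split; first exact: closed_openC.
  move=> [z [Kz clz] hz]; have [y [[Ky nAy] /(_ Ky)]] := clz _ (hp z Kz hz).
  exact: nAy.
apply: filterS => y nB z Kz hz; apply: contrapT => nA; apply: nB; exists z => //.
by split=> //; apply: subset_closure; split=> //; rewrite hz.
Qed.

Lemma near_finite (I : choiceType) (T : topologicalType) (D : set I) (p : T)
    (P : I -> set T) : finite_set D -> (forall i, D i -> nbhs p (P i)) ->
  \forall x \near p, forall i, D i -> P i x.
Proof.
by move=> /finite_fsetP[X ->] XP; apply: (@filter_bigI _ _ X P (nbhs p)).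
Qed.

Section StarShaped.
Variable R : realType.

Definition itv01 : set R := `[0, 1]%classic.

Lemma itv01E t : itv01 t = (0 <= t <= 1).
Proof. by rewrite /itv01 /= in_itv. Qed.

Lemma itv01_0 : itv01 0. Proof. by rewrite itv01E lexx ler01. Qed.

Lemma itv01_1 : itv01 1. Proof. by rewrite itv01E lexx ler01. Qed.

Lemma path_near0 (T : topologicalType) (g : R -> T) (N : set T) :
  cont_on itv01 g -> nbhs (g 0) N -> exists2 t, 0 < t < 1 & N (g t).
Proof.
move=> gc /(cont_on_near gc itv01_0)/nbhs_ballP[r /= r0 rN].
pose t := Num.min r 1 / 2.
have [min_r min_1] : Num.min r 1 <= r /\ Num.min r 1 <= 1 by rewrite !ge_min !lexx orbT.
have t0 : 0 < t by rewrite divr_gt0// lt_min r0 ltr01.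
have [tr t1] : t < r /\ t < 1 by move: t0; rewrite /t; split; lra.
exists t; first by rewrite t0.
by apply: rN; rewrite ?itv01E ?ltW// -ball_normE /ball_/= sub0r normrN gtr0_norm.
Qed.

Definition star_shaped (V : lmodType R) (Z : set V) :=
  forall t z, itv01 t -> Z z -> Z (t *: z).

Lemma star_shaped_connected (V : normedModType R) (Z : set V) :
  star_shaped Z -> connected Z.
Proof.
move=> sZ.
have -> : Z = \bigcup_(z in Z) ((fun t : R => t *: z) @` itv01).
  apply/seteqP; split=> [z Zz|z [y Zy [t t01 <-]]]; last exact: sZ.
  by exists z => //; exists 1; rewrite ?scale1r//; exact: itv01_1.
apply: bigcup_connected.
  by exists 0 => z Zz; exists 0; rewrite ?scale0r//; exact: itv01_0.
move=> z _; apply: connected_continuous_connected; first exact: segment_connected.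
by apply: cont_onZ; [exact: cont_on_id|exact: cont_on_cst].
Qed.

Lemma star_shaped_itv01 : star_shaped (itv01 : set R^o).
Proof.
move=> t z; rewrite !itv01E => /andP[t0 t1] /andP[z0 z1].
by rewrite mulr_ge0//= mulr_ile1.
Qed.

End StarShaped.

Arguments itv01 {R}.

(** * Square roots of plane-valued functions *)

Section Plane.
Variable R : realType.
Implicit Types (a z u w : plane R).

Definition norm2 z : R := z.1 ^+ 2 + z.2 ^+ 2.

Definition dotp z w : R := z.1 * w.1 + z.2 * w.2.

(* The plane is identified with the complex numbers. *)
Definition cmul z w : plane R := (z.1 * w.1 - z.2 * w.2, z.1 * w.2 + z.2 * w.1).

Definition csquare z := cmul z z.

Definition conjp z : plane R := (z.1, - z.2).

(* A positive multiple of a square root of [z], unless [z] is a negative real. *)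
Definition bisector z : plane R := (z.1 + Num.sqrt (norm2 z), z.2).

Lemma eq_plane z w : z.1 = w.1 -> z.2 = w.2 -> z = w.
Proof. by case: z w => [z1 z2] [w1 w2] /= -> ->. Qed.

Lemma norm2_ge0 z : 0 <= norm2 z.
Proof. by rewrite addr_ge0// sqr_ge0. Qed.

Lemma norm2Z k z : norm2 (k *: z) = k ^+ 2 * norm2 z.
Proof. by rewrite /norm2/= !exprMn mulrDr. Qed.

Lemma norm2N z : norm2 (- z) = norm2 z.
Proof. by rewrite /norm2/= !sqrrN. Qed.

Lemma norm2_0 : norm2 0 = 0.
Proof. by rewrite /norm2/= expr0n/= addr0. Qed.

Lemma norm2_eq0 z : norm2 z = 0 -> z = 0.
Proof. by rewrite /norm2 => z0; apply: eq_plane => /=; nra. Qed.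

Lemma norm2_gt0 z : z <> 0 -> 0 < norm2 z.
Proof.
by move=> z0; rewrite lt_neqAle norm2_ge0 andbT eq_sym; apply/eqP => /norm2_eq0.
Qed.

Lemma dotpC z w : dotp z w = dotp w z.
Proof. by rewrite /dotp mulrC [X in _ + X]mulrC. Qed.

Lemma dotpN z w : dotp z (- w) = - dotp z w.
Proof. by rewrite /dotp/= !mulrN -opprD. Qed.

Lemma dotpp z : dotp z z = norm2 z.
Proof. by rewrite /dotp -!expr2. Qed.

Lemma dotp_gt0 z : z <> 0 -> 0 < dotp z z.
Proof. by rewrite dotpp; exact: norm2_gt0. Qed.

Lemma csquareZ k z : csquare (k *: z) = k ^+ 2 *: csquare z.
Proof. by apply: eq_plane; rewrite /csquare /cmul/= /GRing.scale/=; ring. Qed.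

Lemma csquareN z : csquare (- z) = csquare z.
Proof. by apply: eq_plane; rewrite /csquare /cmul/=; ring. Qed.

Lemma csquare0 : csquare 0 = 0.
Proof. by apply: eq_plane; rewrite /csquare /cmul/=; ring. Qed.

Lemma csquareM z w : csquare (cmul z w) = cmul (csquare z) (csquare w).
Proof. by apply: eq_plane; rewrite /csquare /cmul/=; ring. Qed.

Lemma csquare_eq z w : csquare z = csquare w -> z = w \/ z = - w.
Proof.
move=> [e1 e2]; suff : norm2 (z - w) * norm2 (z + w) = 0.
  move=> /eqP; rewrite mulf_eq0 => /orP[] /eqP/norm2_eq0/eqP.
    by rewrite subr_eq0 => /eqP; left.
  by rewrite addr_eq0 => /eqP; right.
transitivity ((z.1 * z.1 - z.2 * z.2 - (w.1 * w.1 - w.2 * w.2)) ^+ 2 +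
    (z.1 * z.2 + z.2 * z.1 - (w.1 * w.2 + w.2 * w.1)) ^+ 2).
  by rewrite /norm2/=; ring.
by rewrite e1 e2 !subrr expr0n/= addr0.
Qed.

Lemma csquare_neq0 z : csquare z <> 0 -> z <> 0.
Proof. by move=> h z0; apply: h; rewrite z0 csquare0. Qed.

Lemma csquare_neqN z : csquare z <> 0 -> z <> - z.
Proof.
move=> /csquare_neq0 z0 /(congr1 (+%R z)); rewrite subrr => zz; apply: z0.
have [z1 z2] : (z + z).1 = 0 /\ (z + z).2 = 0 by rewrite zz.
by apply: eq_plane; move: z1 z2 => /=; lra.
Qed.

Lemma csquare_eq_agree x y z : csquare x = csquare y -> csquare y = csquare z ->
  csquare y <> 0 -> (x == z) = ((x == y) == (y == z)).
Proof.
move=> /csquare_eq xy yz /csquare_neqN/eqP/negbTE yN.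
case: xy => ->; first by rewrite eqxx; case: (y == z).
have [<-|/(congr1 -%R)] := csquare_eq yz; first by rewrite eqxx eq_sym yN.
by rewrite opprK => <-; rewrite [- y == y]eq_sym yN !eqxx.
Qed.

Lemma csquare_bisector z : csquare (bisector z) = (2 * (z.1 + Num.sqrt (norm2 z))) *: z.
Proof.
have r2 : Num.sqrt (norm2 z) ^+ 2 = norm2 z by rewrite sqr_sqrtr// norm2_ge0.
rewrite /csquare /bisector /cmul /=; move: (Num.sqrt _) r2; rewrite /norm2 => r r2.
apply: eq_plane; rewrite /= -[_ *: _]/(_ * _); last by ring.
transitivity (z.1 ^+ 2 + 2 * z.1 * r + r ^+ 2 - z.2 ^+ 2); first by ring.
by rewrite r2; ring.
Qed.

Lemma cmul_conjp z u : cmul u (cmul z (conjp u)) = norm2 u *: z.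
Proof. by apply: eq_plane; rewrite /cmul /norm2/= -[_ *: _]/(_ * _); ring. Qed.

Lemma cmulZ k z w : cmul z (k *: w) = k *: cmul z w.
Proof. by apply: eq_plane; rewrite /cmul/= -![_ *: _]/(_ * _); ring. Qed.

Section Continuity.
Variables (T : topologicalType) (K : set T).
Implicit Types f g : T -> plane R.

Lemma cont_on_norm2 f : cont_on K f -> cont_on K (fun x => norm2 (f x)).
Proof.
by move=> fK; apply: cont_onD; apply: cont_onX; [exact: cont_on_fst|exact: cont_on_snd].
Qed.

Lemma cont_on_dotp f g :
  cont_on K f -> cont_on K g -> cont_on K (fun x => dotp (f x) (g x)).
Proof.
by move=> fK gK; apply: cont_onD; apply: cont_onM; (exact: cont_on_fst || exact: cont_on_snd).
Qed.

Lemma cont_on_cmul f g :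
  cont_on K f -> cont_on K g -> cont_on K (fun x => cmul (f x) (g x)).
Proof.
move=> fK gK; apply: cont_on_pair; [apply: cont_onB|apply: cont_onD]; apply: cont_onM;
  (exact: cont_on_fst || exact: cont_on_snd).
Qed.

Lemma cont_on_bisector f : cont_on K f -> cont_on K (fun x => bisector (f x)).
Proof.
move=> fK; apply: cont_on_pair; last exact: cont_on_snd.
by apply: cont_onD; [exact: cont_on_fst|apply: cont_on_sqrt; exact: cont_on_norm2].
Qed.

Lemma cont_on_conjp f : cont_on K f -> cont_on K (fun x => conjp (f x)).
Proof.
by move=> fK; apply: cont_on_pair; [exact: cont_on_fst|apply: cont_onN; exact: cont_on_snd].
Qed.

End Continuity.

Definition has_sqrt (T : topologicalType) (K : set T) (h : T -> plane R) :=
  exists2 s : T -> plane R, cont_on K s & forall x, K x -> csquare (s x) = h x.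

Section HasSqrt.
Variables (T : topologicalType).
Implicit Types (K A B : set T) (h s : T -> plane R).

Lemma has_sqrtS A B h : A `<=` B -> has_sqrt B h -> has_sqrt A h.
Proof.
by move=> AB [s sB sh]; exists s => [|x /AB]; [exact: cont_onS sB|exact: sh].
Qed.

Lemma eq_has_sqrt A h h' : (forall x, A x -> h x = h' x) -> has_sqrt A h -> has_sqrt A h'.
Proof. by move=> hh' [s sA sh]; exists s => // x Ax; rewrite sh// hh'. Qed.

(* The bisector [b] of [h * conj (s ^ 2)] makes [s * b] a positive multiple of a
   square root of [h]. *)
Lemma has_sqrt_approx K s h : cont_on K s -> cont_on K h ->
  (forall x, K x -> 0 < dotp (csquare (s x)) (h x)) -> has_sqrt K h.
Proof.
move=> sK hK sh; pose u x := csquare (s x); pose w x := cmul (h x) (conjp (u x)).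
have w1 x : (w x).1 = dotp (u x) (h x) by rewrite /w /dotp/=; ring.
pose k x := 2 * (bisector (w x)).1 * norm2 (u x).
have k0 x : K x -> 0 < k x.
  move=> Kx; rewrite !mulr_gt0//.
    by rewrite ltr_wpDr ?sqrtr_ge0// w1; exact: sh.
  by apply: norm2_gt0 => u0; have := sh x Kx; rewrite -/(u x) u0 /dotp/= !mul0r addr0 ltxx.
have uK : cont_on K u by exact: cont_on_cmul.
have bK : cont_on K (fun x => bisector (w x)).
  by apply: cont_on_bisector; apply: cont_on_cmul => //; exact: cont_on_conjp.
exists (fun x => (Num.sqrt (k x))^-1 *: cmul (s x) (bisector (w x))).
  apply: cont_onZ; last exact: cont_on_cmul.
  apply: cont_onV => [x Kx|]; first by rewrite gt_eqF// sqrtr_gt0 k0.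
  apply: cont_on_sqrt; apply: cont_onM; last exact: cont_on_norm2.
  by apply: cont_onM; [exact: cont_on_cst|exact: cont_on_fst].
move=> x Kx; rewrite csquareZ csquareM csquare_bisector -/(u x) cmulZ cmul_conjp !scalerA.
rewrite exprVn sqr_sqrtr ?(ltW (k0 _ Kx))// -mulrA mulVf ?scale1r// gt_eqF//.
exact: k0.
Qed.

Lemma has_sqrt_cst K a : a <> 0 -> has_sqrt K (fun=> a).
Proof.
move=> a0; suff [z za] : exists z, 0 < dotp (csquare z) a.
  by apply: (@has_sqrt_approx _ (fun=> z)) => //; exact: cont_on_cst.
have [a1|a1|a1] := ltrgt0P a.1.
- by exists (1, 0); rewrite /dotp /csquare/=; nra.
- by exists (0, 1); rewrite /dotp /csquare/=; nra.
- have [a2|a2|a2] := ltrgt0P a.2.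
  + by exists (1, 1); rewrite /dotp /csquare/= a1; nra.
  + by exists (1, -1); rewrite /dotp /csquare/= a1; nra.
  + by case: a0; exact: eq_plane.
Qed.

Lemma near_dotp_gt0 a : a <> 0 ->
  exists2 N, nbhs a N & forall z w, N z -> N w -> 0 < dotp z w.
Proof.
move=> a0; have dc : cont_on setT (fun p : plane R * plane R => dotp p.1 p.2).
  by apply: cont_on_dotp; [apply: cont_on_fst|apply: cont_on_snd]; exact: cont_on_id.
have /(@cont_on_near _ _ _ _ (a, a) _ dc I)[[N M] /= [Na Ma] NM] :
    nbhs (dotp a a) [set x | 0 < x].
  by apply: open_nbhs_nbhs; split; [exact: open_gt|exact: dotp_gt0].
exists (N `&` M) => [|z w [Nz _] [_ Mw]]; first exact: filterI.
by have := NM (z, w); apply.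
Qed.

Section SqrtFamily.
Variables (P : topologicalType) (D : set P) (K : set T) (H : P * T -> plane R).
Hypotheses (cK : compact K) (HC : cont_on (D `*` K) H).

Let slice p : D p -> cont_on K (fun x => H (p, x)).
Proof.
move=> Dp; apply: (@cont_on_comp _ _ _ K (D `*` K) _ H) => //.
by apply: cont_on_pair; [exact: cont_on_cst|exact: cont_on_id].
Qed.

Lemma has_sqrt_near p : D p -> (forall x, K x -> H (p, x) <> 0) ->
  \forall q \near p, D q ->
    (has_sqrt K (fun x => H (q, x)) <-> has_sqrt K (fun x => H (p, x))).
Proof.
move=> Dp H0.
have cov : \forall q \near p, K `<=` (fun x => D q -> K x -> 0 < dotp (H (q, x)) (H (p, x))).
  have /compact_near_coveringP/(_ P (nbhs p)
    (fun q x => D q -> K x -> 0 < dotp (H (q, x)) (H (p, x)))) := cK.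
  apply=> x Kx; have [N NH Npos] := near_dotp_gt0 (H0 x Kx).
  have [[A B] /= [Ap Bx] AB] := @cont_on_near _ _ _ _ (p, x) _ HC (conj Dp Kx) NH.
  exists (B, A) => //= -[y q] /= [By Aq] Dq Ky; apply: Npos; first exact: (AB (q, y)).
  by apply: (AB (p, y)) => //; split=> //; exact: nbhs_singleton Ap.
apply: filterS cov => q cov Dq; split=> -[s sK sh].
  by apply: (has_sqrt_approx sK (slice Dp)) => x Kx; rewrite sh//; exact: cov.
by apply: (has_sqrt_approx sK (slice Dq)) => x Kx; rewrite sh// dotpC; exact: cov.
Qed.

Lemma has_sqrt_connected p q : connected D ->
  (forall r x, D r -> K x -> H (r, x) <> 0) -> D p -> D q ->
  has_sqrt K (fun x => H (p, x)) -> has_sqrt K (fun x => H (q, x)).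
Proof.
move=> cD H0.
apply: (@connected_locally_constant _ D (fun r => has_sqrt K (fun x => H (r, x)))) => // r Dr.
by apply: has_sqrt_near => // x Kx; exact: H0.
Qed.

End SqrtFamily.

Lemma has_sqrt_image (U : topologicalType) (x0 : T) (K : set T)
    (f : T -> U) (h : U -> plane R) :
  hausdorff_space U -> compact K -> cont_on K f -> set_inj K f ->
  has_sqrt K (fun x => h (f x)) -> has_sqrt (f @` K) h.
Proof.
move=> hU cK fK fI [s sK sh]; have [g gf gK] := compact_inverse x0 hU cK fK fI.
exists (fun y => s (g y)) => [|_ [x Kx <-]]; last by rewrite gf// sh.
by apply: (@cont_on_comp _ _ _ _ K) => // _ [x Kx <-]; rewrite gf.
Qed.

Lemma has_sqrt_glue (A B : set T) (sA sB h : T -> plane R) :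
  closed A -> closed B -> cont_on A sA -> cont_on B sB ->
  (forall x, A x -> csquare (sA x) = h x) -> (forall x, B x -> csquare (sB x) = h x) ->
  (forall x, A x -> B x -> sA x = sB x) -> has_sqrt (A `|` B) h.
Proof.
move=> clA clB sAc sBc sAh sBh AB.
pose s x := if pselect (A x) is left _ then sA x else sB x.
have sEA x : A x -> sA x = s x by rewrite /s; case: pselect.
have sEB x : B x -> sB x = s x by rewrite /s; case: pselect => // Ax Bx; rewrite AB.
exists s; last by move=> x [Ax|Bx]; [rewrite -sEA// sAh|rewrite -sEB// sBh].
by apply: cont_onU => //; [exact: eq_cont_on sAc|exact: eq_cont_on sBc].
Qed.

Lemma sqrt_agreement_const (A : set T) (s t : T -> plane R) x y :
  connected A -> cont_on A s -> cont_on A t ->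
  (forall x, A x -> csquare (s x) = csquare (t x)) ->
  (forall x, A x -> csquare (s x) <> 0) -> A x -> A y -> (s x == t x) = (s y == t y).
Proof.
move=> cA sA tA st s0.
have dotE p : A p -> (0 < dotp (s p) (t p)) = (s p == t p) /\ dotp (s p) (t p) != 0.
  move=> Ap; have sp0 := csquare_neq0 (s0 p Ap); have spN := csquare_neqN (s0 p Ap).
  have [<-|/(congr1 -%R)] := csquare_eq (st p Ap).
    by rewrite eqxx dotp_gt0// gt_eqF// dotp_gt0.
  rewrite opprK => <-; rewrite dotpN oppr_gt0 oppr_eq0 (lt_gtF (dotp_gt0 sp0)).
  by rewrite gt_eqF ?dotp_gt0//; split=> //; apply/esym/eqP.
have dA := cont_on_dotp sA tA.
move=> Ax Ay; rewrite -(dotE x Ax).1 -(dotE y Ay).1.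
by apply: (connected_gt0 cA dA) => // p /dotE[].
Qed.

End HasSqrt.

Lemma has_sqrt_star_shaped (V : normedModType R) (Z : set V) (h : V -> plane R) :
  star_shaped Z -> compact Z -> cont_on Z h -> (forall x, Z x -> h x <> 0) -> has_sqrt Z h.
Proof.
move=> sZ cZ hZ h0; have [->|/set0P[z Zz]] := eqVneq Z set0.
  by exists (fun=> 0) => [|x //]; exact: continuous_subspace0.
have Z0 : Z 0 by rewrite -(scale0r z); exact: sZ _ _ (itv01_0 R) Zz.
apply: (@eq_has_sqrt _ _ (fun x => h (1%R *: x))) => [x _|]; first by rewrite scale1r.
apply: (@has_sqrt_connected _ R itv01 Z (fun p => h (p.1 *: p.2)) cZ _ 0 1).
- apply: (@cont_on_comp _ _ _ _ Z) => //; first by move=> p [/= tp xp]; exact: sZ.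
  by apply: cont_onZ; [apply: cont_on_fst|apply: cont_on_snd]; exact: cont_on_id.
- exact: segment_connected.
- by move=> t x t01 Zx; apply: h0; exact: sZ.
- exact: itv01_0.
- exact: itv01_1.
- apply: (@eq_has_sqrt _ _ (fun=> h 0)) => [x _|]; first by rewrite /= scale0r.
  by apply: has_sqrt_cst; exact: h0.
Qed.

End Plane.

(** * Parity of winding numbers in the plane *)

Section Disks.
Variable R : realType.
Implicit Types (z w : plane R).

Lemma odiskE z : odisk z = (norm2 z < 1) :> Prop.
Proof. by []. Qed.

Lemma cdiskE z : cdisk z = (norm2 z <= 1) :> Prop.
Proof. by []. Qed.

Lemma circleE z : circle z = (norm2 z = 1).
Proof. by []. Qed.

Lemma cdisk_bound z : cdisk z -> -1 <= z.1 <= 1 /\ -1 <= z.2 <= 1.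
Proof. by rewrite cdiskE /norm2 => z1; split; apply/andP; split; nra. Qed.

Lemma circle_cdisk : @unit_circle R `<=` cdisk.
Proof. by move=> z; rewrite circleE cdiskE => ->. Qed.

Lemma odisk_cdisk : @open_disk R `<=` cdisk.
Proof. by move=> z; rewrite odiskE cdiskE => /ltW. Qed.

Lemma circle_odisk z : circle z -> ~ odisk z.
Proof. by rewrite circleE odiskE => ->; rewrite ltxx. Qed.

Lemma cdisk_split z : cdisk z -> odisk z \/ circle z.
Proof.
by rewrite cdiskE odiskE circleE le_eqVlt => /orP[/eqP|]; [right|left].
Qed.

Lemma odisk0 : odisk (0 : plane R).
Proof. by rewrite odiskE norm2_0 ltr01. Qed.

Lemma cdisk0 : cdisk (0 : plane R).
Proof. exact/odisk_cdisk/odisk0. Qed.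

Lemma circle_neq0 z : circle z -> z <> 0.
Proof. by move=> cz z0; apply: (circle_odisk cz); rewrite z0; exact: odisk0. Qed.

Lemma circleN z : circle z -> circle (- z).
Proof. by rewrite !circleE norm2N. Qed.

Lemma norm2_scale_le t z : itv01 t -> norm2 (t *: z) <= norm2 z.
Proof.
by rewrite itv01E => /andP[t0 t1]; rewrite norm2Z ler_piMl ?norm2_ge0// exprn_ile1.
Qed.

Lemma star_shaped_cdisk : star_shaped (@closed_disk R).
Proof. by move=> t z t01; rewrite !cdiskE; exact/le_trans/norm2_scale_le. Qed.

Lemma star_shaped_odisk : star_shaped (@open_disk R).
Proof. by move=> t z t01; rewrite !odiskE; exact/le_lt_trans/norm2_scale_le. Qed.

Lemma open_preimage_cont_on (T : topologicalType) (f : T -> R) (A : set R) :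
  cont_on setT f -> open A -> open (f @^-1` A).
Proof. by move=> fc oA; have := cont_on_open openT fc oA; rewrite setTI. Qed.

Lemma closed_preimage_cont_on (T : topologicalType) (f : T -> R) (A : set R) :
  cont_on setT f -> closed A -> closed (f @^-1` A).
Proof.
move=> fc cA; rewrite -[X in closed X]setCK; apply: open_closedC.
by rewrite preimage_setC; apply: open_preimage_cont_on => //; exact: closed_openC.
Qed.

Lemma open_odisk : open (@open_disk R).
Proof.
exact: (open_preimage_cont_on (cont_on_norm2 (@cont_on_id _ setT)) (@open_lt R 1)).
Qed.

Lemma closed_cdisk : closed (@closed_disk R).
Proof.
exact: (closed_preimage_cont_on (cont_on_norm2 (@cont_on_id _ setT)) (@closed_le R 1)).
Qed.

Lemma closed_circle : closed (@unit_circle R).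
Proof.
exact: (closed_preimage_cont_on (cont_on_norm2 (@cont_on_id _ setT)) (@closed_eq R 1)).
Qed.

Lemma compact_cdisk : compact (@closed_disk R).
Proof.
apply: (@subclosed_compact _ _ ([set` `[-1 : R, 1]] `*` [set` `[-1 : R, 1]])).
- exact: closed_cdisk.
- by apply: compact_setX; exact: segment_compact.
- by move=> z /cdisk_bound[z1 z2]; split; rewrite /= in_itv.
Qed.

Lemma compact_circle : compact (@unit_circle R).
Proof. by apply: (subclosed_compact closed_circle compact_cdisk); exact: circle_cdisk. Qed.

Lemma connected_odisk : connected (@open_disk R).
Proof. exact/star_shaped_connected/star_shaped_odisk. Qed.

Lemma hausdorff_plane : hausdorff_space (plane R).
Proof. exact: norm_hausdorff. Qed.

End Disks.

Section Parity.
Variable R : realType.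
Implicit Types (K A : set (plane R)) (p q : plane R) (f h : plane R -> plane R).

(* If [K] is a simple closed curve avoiding [q], this says that its winding number
   around [q] is even. *)
Definition even_around K q := has_sqrt K (fun z => z - q).

Lemma even_aroundS K L q : K `<=` L -> even_around L q -> even_around K q.
Proof. exact: has_sqrtS. Qed.

Lemma subp_neq0 K z q : ~ K q -> K z -> z - q <> 0.
Proof. by move=> Kq Kz /eqP; rewrite subr_eq0 => /eqP zq; apply: Kq; rewrite -zq. Qed.

Let cont_on_sub (D : set (plane R * plane R)) : cont_on D (fun p : plane R * plane R => p.2 - p.1).
Proof. by apply: cont_onB; [apply: cont_on_snd|apply: cont_on_fst]; exact: cont_on_id. Qed.

Lemma even_around_near K q : compact K -> ~ K q ->
  \forall p \near q, even_around K p <-> even_around K q.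
Proof.
move=> cK Kq; have := @has_sqrt_near _ _ _ setT K _ cK (@cont_on_sub _) q I.
move=> /(_ (fun z => subp_neq0 Kq)).
by apply: filterS => p; apply.
Qed.

Lemma even_around_connected K A p q : compact K -> connected A ->
  (forall z, A z -> ~ K z) -> A p -> A q -> even_around K p -> even_around K q.
Proof.
move=> cK cA AK; apply: (has_sqrt_connected cK (@cont_on_sub _) cA) => z x Az.
exact: subp_neq0 (AK z Az).
Qed.

Lemma even_around_outside K q : compact K -> K `<=` cdisk -> ~ K q -> 1 <= norm2 q ->
  even_around K q.
Proof.
move=> cK Kd Kq q1; rewrite /even_around.
apply: (@eq_has_sqrt _ _ _ (fun z : plane R => 1%R *: z - q)) => [z _|]; first by rewrite scale1r.
apply: (@has_sqrt_connected _ _ _ itv01 K (fun p : R * plane R => p.1 *: p.2 - q) cK _ 0 1) => //=.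
- apply: cont_onB; last exact: cont_on_cst.
  by apply: cont_onZ; [apply: cont_on_fst|apply: cont_on_snd]; exact: cont_on_id.
- exact: segment_connected.
- move=> t z; rewrite itv01E => /andP[t0 t1] Kz /= /eqP; rewrite subr_eq0 => /eqP zq.
  have z1 : norm2 z <= 1 := Kd z Kz.
  move: q1; rewrite -zq norm2Z => q1.
  have t2 : t = 1 by have := norm2_ge0 z; nra.
  by apply: Kq; rewrite -zq t2 scale1r.
- exact: itv01_0.
- exact: itv01_1.
- apply: (@eq_has_sqrt _ _ _ (fun=> - q)) => [z _|]; first by rewrite scale0r sub0r.
  apply: has_sqrt_cst => /eqP; rewrite oppr_eq0 => /eqP q0.
  by move: q1; rewrite q0 norm2_0 lt_geF// ltr01.
Qed.

Lemma even_around_star_image (V : normedModType R) (Z : set V) (f : V -> plane R) q :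
  star_shaped Z -> compact Z -> cont_on Z f -> set_inj Z f -> ~ (f @` Z) q ->
  even_around (f @` Z) q.
Proof.
move=> sZ cZ fZ fI fq; apply: (has_sqrt_image 0) => //.
apply: has_sqrt_star_shaped => //; first by apply: cont_onB => //; exact: cont_on_cst.
by move=> x Zx; apply: (subp_neq0 fq); exists x.
Qed.

Lemma csquare_opp_det a b : csquare b = - csquare a -> a <> 0 ->
  a.1 * b.2 - a.2 * b.1 != 0 :> R.
Proof.
move=> [e1 e2] /norm2_gt0 a0; apply/eqP => det0.
have : dotp a b ^+ 2 + norm2 a ^+ 2 = (a.1 * b.2 - a.2 * b.1) ^+ 2.
  transitivity ((a.1 * b.2 - a.2 * b.1) ^+ 2 +
    ((b.1 * b.1 - b.2 * b.2) * (a.1 * a.1 - a.2 * a.2) +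
     (b.1 * b.2 + b.2 * b.1) * (a.1 * a.2 + a.2 * a.1)) + norm2 a ^+ 2).
    by rewrite /dotp; ring.
  by rewrite e1 e2 /norm2; ring.
by rewrite det0 expr0n/=; have := sqr_ge0 (dotp a b); nra.
Qed.

(* An odd map of the circle has no square root g: g (- c) would be i * g c or
   - i * g c, with a constant sign, and applying this twice gives g c = - g c. *)
Lemma odd_no_sqrt h : (forall c, circle c -> h c <> 0) ->
  (forall c, circle c -> h (- c) = - h c) -> ~ has_sqrt (@unit_circle R) h.
Proof.
move=> h0 hodd [g gK gh].
pose e (t : R) : plane R := (cos t, sin t).
have eC t : circle (e t) by rewrite /unit_circle/= cos2Dsin2.
have ec : cont_on setT e.
  apply: cont_on_pair; apply: continuous_cont_on; [exact: continuous_cos|exact: continuous_sin].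
have ac : cont_on setT (fun t => g (e t)).
  by apply: (@cont_on_comp _ _ _ _ circle) => // t _; exact: eC.
have bc : cont_on setT (fun t => g (- e t)).
  apply: (@cont_on_comp _ _ _ _ circle) => //; first by move=> t _; exact/circleN/eC.
  exact: cont_onN.
pose k t := (g (e t)).1 * (g (- e t)).2 - (g (e t)).2 * (g (- e t)).1.
have kc : cont_on setT k.
  by apply: cont_onB; apply: cont_onM; (exact: cont_on_fst || exact: cont_on_snd).
have k0 t : k t != 0.
  apply: csquare_opp_det; first by rewrite !gh ?hodd//; exact/circleN/eC.
  by apply: csquare_neq0; rewrite gh//; exact: h0.
have kpi : k pi = - k 0.
  have epi : e pi = - e 0 by apply: eq_plane; rewrite /= ?cospi ?cos0 ?sinpi ?sin0 ?oppr0.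
  by rewrite /k epi opprK; ring.
have : (0 < k 0) = (0 < k pi).
  have kc01 : cont_on `[0, pi]%classic k by exact: cont_onS kc.
  apply: (connected_gt0 _ kc01) => //; first exact: segment_connected.
    by rewrite /= in_itv/= lexx pi_ge0.
  by rewrite /= in_itv/= lexx pi_ge0.
by rewrite kpi oppr_gt0; have := k0 0; case: ltgtP.
Qed.

(* Borsuk's homotopy f (c / (1 + t)) - f (- t c / (1 + t)) joins f c - f 0 to an odd
   map, and it does not vanish since f is injective. *)
Lemma odd_around_center f : cont_on cdisk f -> set_inj cdisk f ->
  ~ even_around (f @` circle) (f 0).
Proof.
move=> fc fI [s sK sh].
pose H (p : R * plane R) := f ((1 + p.1)^-1 *: p.2) - f (- (p.1 / (1 + p.1)) *: p.2).
have t1 (t : R) : itv01 t -> 0 < 1 + t by rewrite itv01E => /andP[t0 _]; rewrite ltr_pwDl.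
have near_end (t : R) c : itv01 t -> circle c -> cdisk ((1 + t)^-1 *: c).
  move=> t01 /circle_cdisk; apply: star_shaped_cdisk; have t0 := t1 t t01.
  rewrite itv01E invr_ge0 ltW//= invf_le1// lerDl.
  by move: t01; rewrite itv01E => /andP[].
have far_end (t : R) c : itv01 t -> circle c -> cdisk (- (t / (1 + t)) *: c).
  move=> t01 /circleN/circle_cdisk; rewrite scaleNr -scalerN; apply: star_shaped_cdisk.
  have t0 := t1 t t01; move: t01; rewrite !itv01E => /andP[t00 t11].
  by rewrite divr_ge0 ?(ltW t0)//= ler_pdivrMr// mul1r lerDr.
have H0 (t : R) c : itv01 t -> circle c -> H (t, c) <> 0.
  move=> t01 cc /eqP; rewrite subr_eq0 => /eqP/fI.
  rewrite !inE => /(_ (near_end _ _ t01 cc) (far_end _ _ t01 cc))/eqP.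
  rewrite -subr_eq0 -scalerBl opprK -[X in X + _]mul1r -mulrDl divff ?gt_eqF ?t1//.
  by rewrite scale1r => /eqP; exact: circle_neq0.
have Hc : cont_on (itv01 `*` circle) H.
  have p1 : cont_on (itv01 `*` @unit_circle R) (fun p : R * plane R => p.1)
    by apply: cont_on_fst; exact: cont_on_id.
  have p2 : cont_on (itv01 `*` @unit_circle R) (fun p : R * plane R => p.2)
    by apply: cont_on_snd; exact: cont_on_id.
  have pv : cont_on (itv01 `*` @unit_circle R) (fun p : R * plane R => (1 + p.1)^-1).
    apply: cont_onV => [p [/t1/gt_eqF->]//|]; apply: cont_onD => //; exact: cont_on_cst.
  apply: cont_onB; apply: (@cont_on_comp _ _ _ _ cdisk) => //.
  - by move=> p [tp cp]; exact: near_end.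
  - exact: cont_onZ.
  - by move=> p [tp cp]; exact: far_end.
  - by apply: cont_onZ => //; apply: cont_onN; exact: cont_onM.
apply: (@odd_no_sqrt (fun c => H (1, c))).
- by move=> c; apply: H0; exact: itv01_1.
- by move=> c cc; rewrite /H/= opprB div1r !scaleNr !scalerN opprK.
apply: (has_sqrt_connected (@compact_circle R) Hc (@segment_connected _ 0 1) H0 (itv01_0 R)).
  exact: itv01_1.
exists (fun c => s (f c)) => [|c cc].
  apply: (@cont_on_comp _ _ _ _ (f @` circle)) => //.
  by apply: cont_onS fc; exact: circle_cdisk.
by rewrite sh; [rewrite /H/= addr0 invr1 scale1r mul0r oppr0 scale0r|exists c].
Qed.

Lemma compact_circle_image f : cont_on cdisk f -> compact (f @` circle).
Proof.
move=> fc; apply: continuous_compact; last exact: compact_circle.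
by apply: cont_onS fc; exact: circle_cdisk.
Qed.

Lemma odisk_image_circle (T : Type) (f : plane R -> T) z : set_inj cdisk f -> odisk z ->
  ~ (f @` circle) (f z).
Proof.
move=> fI oz [c cc cz]; apply: (circle_odisk cc); suff -> : c = z by [].
by apply: fI cz; rewrite inE; [exact: circle_cdisk|exact: odisk_cdisk].
Qed.

Lemma odd_around_interior f z : cont_on cdisk f -> set_inj cdisk f -> odisk z ->
  ~ even_around (f @` circle) (f z).
Proof.
move=> fc fI oz ev; apply: (odd_around_center fc fI).
have fo : connected (f @` odisk).
  apply: connected_continuous_connected; first exact: connected_odisk.
  by apply: cont_onS fc; exact: odisk_cdisk.
apply: (even_around_connected (compact_circle_image fc) fo _ _ _ ev).
- by move=> _ [y oy <-]; exact: odisk_image_circle.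
- by exists z.
- by exists 0 => //; exact: odisk0.
Qed.

Lemma disk_image_nbhs f : cont_on cdisk f -> set_inj cdisk f -> nbhs (f 0) (f @` cdisk).
Proof.
move=> fc fI; have nf0 := odisk_image_circle fI (@odisk0 R).
apply: filterS (even_around_near (compact_circle_image fc) nf0) => q evq.
apply: contrapT => nq; apply: (odd_around_center fc fI); apply/evq.
apply: (@even_aroundS _ (f @` cdisk)); first exact/image_subset/circle_cdisk.
by apply: even_around_star_image => //; [exact: star_shaped_cdisk|exact: compact_cdisk].
Qed.

End Parity.

(** * Invariance of domain and theta curves *)

Section InvarianceOfDomain.
Variable R : realType.
Implicit Types (f : plane R -> plane R) (z : plane R).

Definition locally_disk (S : topologicalType) := forall x : S, exists U : set S,
  [/\ open U, U x & homeomorphic U (@open_disk R)].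

Lemma invariance_of_domain (S : topologicalType) (W : set (plane R)) (f : plane R -> S) :
  locally_disk S -> open W -> cont_on W f -> set_inj W f -> open (f @` W).
Proof.
move=> lS oW fW fI; rewrite openE => _ [a Wa <-].
have [U [oU Ufa [k [k' [kc _ kk' _]]]]] := lS (f a).
have oWU := cont_on_open oW fW oU.
have /nbhs_ballP[r /= r0 rW] : nbhs a (W `&` f @^-1` U) by exact: open_nbhs_nbhs.
pose e z := a + (r / 2) *: z.
have eW z : cdisk z -> (W `&` f @^-1` U) (e z).
  move=> /cdisk_bound[/andP[z1 z2] /andP[z3 z4]]; apply: rW; split => /=;
    rewrite -ball_normE /ball_/= ltr_distlC -[_ *: _]/(_ * _); apply/andP; split; nra.
have fec : cont_on cdisk (fun z => f (e z)).
  apply: (@cont_on_comp _ _ _ _ W) => //; first by move=> z /eW[].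
  apply: cont_onD; first exact: cont_on_cst.
  by apply: cont_onZ; [exact: cont_on_cst|exact: cont_on_id].
have gc : cont_on cdisk (fun z => k (f (e z))).
  by apply: (@cont_on_comp _ _ _ _ U) => // z /eW[].
have gI : set_inj cdisk (fun z => k (f (e z))).
  move=> x y /set_mem/eW[Wx Ux] /set_mem/eW[Wy Uy] /(congr1 k').
  rewrite !(kk' _ _).2// => /fI; rewrite !inE => /(_ Wx Wy)/addrI/scalerI; apply.
  by rewrite gt_eqF// divr_gt0.
have := disk_image_nbhs gc gI; rewrite {1}/e scaler0 addr0.
move=> /(cont_on_near kc Ufa); apply: filterS2 (open_nbhs_nbhs (conj oU Ufa)).
move=> y Uy /(_ Uy)[z zd zy]; have [Wz Uz] := eW z zd; exists (e z) => //.
by have := congr1 k' zy; rewrite !(kk' _ _).2.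
Qed.

Lemma plane_locally_disk : locally_disk (plane R).
Proof.
move=> x; have subc A : cont_on A (fun z => z - x).
  by apply: cont_onB; [exact: cont_on_id|exact: cont_on_cst].
exists ((fun z => z - x) @^-1` odisk); split.
- by have := cont_on_open openT (subc setT) (@open_odisk R); rewrite setTI.
- by rewrite /= subrr; exact: odisk0.
- exists (fun z => z - x), (fun z => z + x); split; first exact: subc.
  + by apply: cont_onD; [exact: cont_on_id|exact: cont_on_cst].
  + by move=> z fz; split => //; rewrite subrK.
  + by move=> z fz; split; rewrite /= addrK.
Qed.

Lemma invariance_of_domain_inverse (S : topologicalType) (K : set (plane R))
    (k : plane R -> S) (N : set S) : hausdorff_space S -> locally_disk S ->
  compact K -> cont_on K k -> set_inj K k -> open N -> N `<=` k @` K ->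
  open (K `&` k @^-1` N).
Proof.
move=> hS lS cK kc kI oN NK.
have [g gk gc] := compact_inverse (0 : plane R) hS cK kc kI.
have kg y : (k @` K) y -> k (g y) = y by move=> [z Kz <-]; rewrite gk.
rewrite openE => z [Kz Nkz].
have [U [oU Ukz [u [u' [_ u'c uu' u'u]]]]] := lS (k z).
have oW := cont_on_open (@open_odisk R) u'c oN.
have WI : set_inj (odisk `&` u' @^-1` N) (fun v => g (u' v)).
  move=> v w /set_mem[ov Nv] /set_mem[ow Nw] /(congr1 k).
  by rewrite !kg; [|exact: NK|exact: NK] => /(congr1 u); rewrite !(u'u _ _).2.
have Wc : cont_on (odisk `&` u' @^-1` N) (fun v => g (u' v)).
  apply: (@cont_on_comp _ _ _ _ (k @` K)) => //; first by move=> v [_ /NK].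
  by apply: cont_onS u'c => v [].
have := invariance_of_domain plane_locally_disk oW Wc WI; rewrite openE => /(_ z).
have zW : ((fun v => g (u' v)) @` (odisk `&` u' @^-1` N)) z.
  exists (u (k z)); last by rewrite (uu' _ Ukz).2 gk.
  by split; [exact: (uu' _ Ukz).1|rewrite /= (uu' _ Ukz).2].
move=> /(_ zW); apply: filterS => _ [v [ov Nv] <-].
by have [y Ky yv] := NK _ Nv; split; rewrite /= -yv gk// yv.
Qed.

End InvarianceOfDomain.

Section ThetaCurves.
Variable R : realType.
Implicit Types (A B C K : set (plane R)) (a b q x : plane R).

(* The properties of arcs that theta curves require: a compact connected set around
   whose complement points no winding occurs. *)
Definition arclike K := [/\ compact K, connected K & forall q, ~ K q -> even_around K q].

Lemma arclike_path (f : R -> plane R) : cont_on itv01 f -> set_inj itv01 f ->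
  arclike (f @` itv01).
Proof.
move=> fc fI; have c01 : compact (itv01 : set R) by exact: segment_compact.
split.
- exact: continuous_compact.
- by apply: connected_continuous_connected => //; exact: segment_connected.
- by move=> q; apply: (@even_around_star_image _ R^o) => //; exact: star_shaped_itv01.
Qed.

Lemma arclike_closed K : arclike K -> closed K.
Proof. by case=> cK _ _; apply: compact_closed cK; exact: hausdorff_plane. Qed.

Lemma arclikeU A B a : arclike A -> arclike B -> A `&` B = [set a] -> arclike (A `|` B).
Proof.
move=> aA aB AB; have [cA nA eA] := aA; have [cB nB eB] := aB.
have [Aa Ba] : (A `&` B) a by rewrite AB.
split; first exact: compactU.
  by apply: connectedU => //; exists a; rewrite AB.
move=> q /not_orP[Aq Bq]; have [sA sAc sAh] := eA q Aq; have [sB sBc sBh] := eB q Bq.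
have onlya x : A x -> B x -> x = a by move=> Ax Bx; have : (A `&` B) x by []; rewrite AB.
have [ab|ab] : sA a = sB a \/ sA a = - sB a by apply: csquare_eq; rewrite sAh// sBh.
  apply: (has_sqrt_glue (arclike_closed aA) (arclike_closed aB) sAc sBc) => // x Ax Bx.
  by rewrite (onlya x).
apply: (has_sqrt_glue (arclike_closed aA) (arclike_closed aB) sAc (cont_onN sBc)) => //.
  by move=> x Bx; rewrite csquareN sBh.
by move=> x Ax Bx; rewrite (onlya x).
Qed.

Lemma even_around_union A B a b q (sA sB : plane R -> plane R) :
  arclike A -> arclike B -> A `&` B = [set a; b] -> ~ A q -> ~ B q ->
  cont_on A sA -> cont_on B sB ->
  (forall x, A x -> csquare (sA x) = x - q) -> (forall x, B x -> csquare (sB x) = x - q) ->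
  even_around (A `|` B) q <-> (sA a == sB a) = (sA b == sB b).
Proof.
move=> aA aB AB Aq Bq sAc sBc sAh sBh.
have [_ nA _] := aA; have [_ nB _] := aB.
have [Aa Ba] : (A `&` B) a by rewrite AB; left.
have [Ab Bb] : (A `&` B) b by rewrite AB; right.
have ABx x : A x -> B x -> x = a \/ x = b.
  by move=> Ax Bx; have : (A `&` B) x by []; rewrite AB.
split=> [[s sc sh]|agree].
  have shA x : A x -> csquare (s x) = csquare (sA x) by move=> Ax; rewrite sh ?sAh//; left.
  have shB x : B x -> csquare (s x) = csquare (sB x) by move=> Bx; rewrite sh ?sBh//; right.
  have s0 x : A x \/ B x -> csquare (s x) <> 0.
    by move=> ABx'; rewrite sh//; case: ABx' => ?; [exact: (subp_neq0 Aq)|exact: (subp_neq0 Bq)].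
  have E x : A x -> B x -> (sA x == sB x) = ((s x == sA x) == (s x == sB x)).
    move=> Ax Bx; rewrite [s x == sA x]eq_sym.
    by apply: csquare_eq_agree; [exact/esym/shA|exact: shB|apply: s0; left].
  rewrite !E//; congr (_ == _).
    apply: (sqrt_agreement_const nA) => //; first by apply: cont_onS sc => x; left.
    by move=> x Ax; apply: s0; left.
  apply: (sqrt_agreement_const nB) => //; first by apply: cont_onS sc => x; right.
  by move=> x Bx; apply: s0; right.
have glue := has_sqrt_glue (arclike_closed aA) (arclike_closed aB) sAc.
have [ab|ab] := eqVneq (sA a) (sB a).
  apply: (glue _ _ sBc) => // x /ABx/[apply] -[->//|->].
  by apply/eqP; rewrite -agree ab.
apply: (glue _ _ (cont_onN sBc)) => // [x Bx|x Ax Bx]; first by rewrite csquareN sBh.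
have : sA x != sB x by case: (ABx x Ax Bx) => ->; rewrite // -agree.
by have [->|//] : sA x = sB x \/ sA x = - sB x; [apply: csquare_eq; rewrite sAh ?sBh|rewrite eqxx].
Qed.

Lemma theta_parity A B C a b q :
  arclike A -> arclike B -> arclike C ->
  A `&` B = [set a; b] -> B `&` C = [set a; b] -> A `&` C = [set a; b] ->
  ~ A q -> ~ B q -> ~ C q ->
  even_around (A `|` B) q <-> (even_around (B `|` C) q <-> even_around (A `|` C) q).
Proof.
move=> aA aB aC AB BC AC Aq Bq Cq.
have [_ _ /(_ q Aq)[sA sAc sAh]] := aA.
have [_ _ /(_ q Bq)[sB sBc sBh]] := aB.
have [_ _ /(_ q Cq)[sC sCc sCh]] := aC.
rewrite (even_around_union aA aB AB Aq Bq sAc sBc sAh sBh).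
rewrite (even_around_union aB aC BC Bq Cq sBc sCc sBh sCh).
rewrite (even_around_union aA aC AC Aq Cq sAc sCc sAh sCh).
have E x : [set a; b] x -> (sA x == sC x) = ((sA x == sB x) == (sB x == sC x)).
  move=> abx; have [Ax Bx] : (A `&` B) x by rewrite AB.
  have [_ Cx] : (B `&` C) x by rewrite BC.
  by apply: csquare_eq_agree; rewrite ?sAh ?sBh ?sCh//; exact: (subp_neq0 Aq).
rewrite (E a)//; last by left.
rewrite (E b)//; last by right.
by case: (sA a == sB a); case: (sA b == sB b); case: (sB a == sC a); case: (sB b == sC b);
  intuition.
Qed.

End ThetaCurves.

(** * Crossing an arc of a closed curve *)

Section HalfDisks.
Variable R : realType.
Implicit Types (e : R) (z w : plane R).

(* The upper half for [e = 1], and the lower half for [e = -1]. *)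
Definition half_disk e : set (plane R) := [set z | cdisk z /\ 0 <= e * z.2].

Lemma half_disk_cdisk e : half_disk e `<=` cdisk.
Proof. by move=> z []. Qed.

Lemma upper_half_disk z : cdisk z -> 0 <= z.2 -> half_disk 1 z.
Proof. by split=> //; rewrite mul1r. Qed.

Lemma lower_half_disk z : cdisk z -> z.2 <= 0 -> half_disk (-1) z.
Proof. by split=> //; rewrite mulN1r oppr_ge0. Qed.

Lemma half_disk_ge0 z : half_disk 1 z -> 0 <= z.2.
Proof. by case=> _; rewrite mul1r. Qed.

Lemma half_disk_le0 z : half_disk (-1) z -> z.2 <= 0.
Proof. by case=> _; rewrite mulN1r oppr_ge0. Qed.

Lemma closed_half_disk e : closed (half_disk e).
Proof.
apply: closedI; first exact: closed_cdisk.
apply: (closed_preimage_cont_on (f := fun z : plane R => e * z.2) _ (@closed_ge R 0)).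
by apply: cont_onM; [exact: cont_on_cst|apply: cont_on_snd; exact: cont_on_id].
Qed.

Lemma compact_half_disk e : compact (half_disk e).
Proof.
apply: (subclosed_compact (@closed_half_disk e) (@compact_cdisk R)).
exact: half_disk_cdisk.
Qed.

Lemma star_shaped_half_disk e : star_shaped (half_disk e).
Proof.
move=> t z t01 [zd z0]; split; first exact: star_shaped_cdisk.
by move: t01; rewrite itv01E => /andP[t0 _] /=; rewrite mulrCA mulr_ge0.
Qed.

Lemma cdisk_real (x : R) : cdisk (x, 0) <-> -1 <= x <= 1.
Proof.
split=> [/cdisk_bound[]//|/andP[x0 x1]]; rewrite cdiskE /norm2/= expr0n/= addr0; nra.
Qed.

Lemma glue_half_disks (T : topologicalType) (h1 h2 : plane R -> T) :
  cont_on (half_disk 1) h1 -> cont_on (half_disk (-1)) h2 ->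
  set_inj (half_disk 1) h1 -> set_inj (half_disk (-1)) h2 ->
  (forall x, cdisk (x, 0) -> h1 (x, 0) = h2 (x, 0)) ->
  (forall z w, cdisk z -> cdisk w -> 0 < z.2 -> w.2 < 0 -> h1 z <> h2 w) ->
  exists f : plane R -> T, [/\ cont_on cdisk f, set_inj cdisk f,
    (forall z, cdisk z -> 0 <= z.2 -> f z = h1 z) &
    (forall z, cdisk z -> z.2 <= 0 -> f z = h2 z)].
Proof.
move=> h1c h2c h1I h2I h12 h1n2.
pose f z := if 0 <= z.2 then h1 z else h2 z.
have f1 z : cdisk z -> 0 <= z.2 -> f z = h1 z by rewrite /f => _ ->.
have f2 z : cdisk z -> z.2 <= 0 -> f z = h2 z.
  rewrite /f => zd z0; case: ifPn => // z0'.
  have z2 : z.2 = 0 by apply/eqP; rewrite eq_le z0 z0'.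
  by rewrite [z]surjective_pairing z2 in zd *; exact: h12.
exists f; split=> //.
- have -> : @closed_disk R = half_disk 1 `|` half_disk (-1).
    apply/seteqP; split=> [z zd|z [[]//|[]//]].
    by have [z0|/ltW z0] := leP 0 z.2; [left; exact: upper_half_disk|right; exact: lower_half_disk].
  apply: cont_onU; [exact: closed_half_disk|exact: closed_half_disk| |].
    by apply: eq_cont_on h1c => z zh; rewrite f1 ?half_disk_ge0//; case: zh.
  by apply: eq_cont_on h2c => z zh; rewrite f2 ?half_disk_le0//; case: zh.
- have apart z w : cdisk z -> cdisk w -> 0 <= z.2 -> w.2 < 0 -> f z = f w -> z = w.
    move=> zd wd z0 w0; have [z2|z2] := eqVneq z.2 0; last first.
      by rewrite f1// (f2 w)// ?(ltW w0)// => /h1n2; case=> //; rewrite lt_neqAle eq_sym z2.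
    rewrite f2 ?z2// f2 ?(ltW w0)//; apply: h2I; rewrite inE; apply: lower_half_disk => //.
      by rewrite z2.
    exact: ltW.
  move=> z w /set_mem zd /set_mem wd.
  have [z0|z0] := leP 0 z.2; have [w0|w0] := leP 0 w.2.
  + by rewrite f1// f1//; apply: h1I; rewrite inE; exact: upper_half_disk.
  + exact: apart.
  + by move=> /esym e; apply/esym/apart.
  + rewrite f2 ?(ltW z0)// f2 ?(ltW w0)//.
    by apply: h2I; rewrite inE; apply: lower_half_disk => //; exact: ltW.
Qed.

Definition lens_arc e (t : R) : plane R :=
  (2 * t - 1, e * Num.sqrt (1 - (2 * t - 1) ^+ 2)).

Lemma lens_height_ge0 (t : R) : itv01 t -> 0 <= 1 - (2 * t - 1) ^+ 2.
Proof. by rewrite itv01E => /andP[t0 t1]; nra. Qed.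

Lemma norm2_lens_arc e t : itv01 t ->
  norm2 (lens_arc e t) = (2 * t - 1) ^+ 2 + e ^+ 2 * (1 - (2 * t - 1) ^+ 2).
Proof. by move=> t01; rewrite /norm2/= exprMn sqr_sqrtr// lens_height_ge0. Qed.

Lemma lens_arc_cdisk e t : -1 <= e <= 1 -> itv01 t -> cdisk (lens_arc e t).
Proof.
move=> /andP[e0 e1] t01; rewrite cdiskE norm2_lens_arc//.
have e2 : e ^+ 2 <= 1 by nra.
by rewrite -[leRHS](subrKC ((2 * t - 1) ^+ 2)) lerD2l ler_piMl// lens_height_ge0.
Qed.

Lemma cont_on_lens_arc e A : cont_on A (lens_arc e).
Proof.
have affine : cont_on A (fun t : R => 2 * t - 1).
  by apply: cont_onB; [apply: cont_onM; [exact: cont_on_cst|exact: cont_on_id]|exact: cont_on_cst].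
apply: cont_on_pair => //; apply: cont_onM; first exact: cont_on_cst.
by apply: cont_on_sqrt; apply: cont_onB; [exact: cont_on_cst|exact: cont_onX].
Qed.

Lemma lens_arc_inj e : injective (lens_arc e).
Proof. by move=> s t /(congr1 fst)/=; lra. Qed.

Lemma lens_arc0 e : lens_arc e 0 = (-1, 0).
Proof. by rewrite /lens_arc mulr0 add0r sqrrN expr1n subrr sqrtr0 mulr0. Qed.

Lemma lens_arc1 e : lens_arc e 1 = (1, 0).
Proof.
by rewrite /lens_arc mulr1 (_ : 2 - 1 = 1) ?expr1n ?subrr ?sqrtr0 ?mulr0//; lra.
Qed.

Lemma lens_arc_meet e e' s t : itv01 s -> e != e' -> lens_arc e s = lens_arc e' t ->
  s = 0 \/ s = 1.
Proof.
move=> s01 ee' est; have st : s = t by move: est => /(congr1 fst)/=; lra.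
move: est => /(congr1 snd)/=; rewrite -st => /eqP.
rewrite -subr_eq0 -mulrBl mulf_eq0 subr_eq0 (negbTE ee')/= sqrtr_eq0 => s1.
have /eqP : s * (1 - s) = 0 by have := lens_height_ge0 s01; nra.
by rewrite mulf_eq0 subr_eq0 => /orP[/eqP|/eqP]; [left|right].
Qed.

Lemma circle_lens_arc z : circle z -> exists2 t, itv01 t & lens_arc 1 t = z \/ lens_arc (-1) t = z.
Proof.
move=> zc; have [/andP[z1 z2] _] := cdisk_bound (circle_cdisk zc).
exists ((z.1 + 1) / 2); first by rewrite itv01E; apply/andP; split; lra.
rewrite /lens_arc (_ : 2 * ((z.1 + 1) / 2) - 1 = z.1); last by field.
rewrite (_ : 1 - z.1 ^+ 2 = z.2 ^+ 2); last by rewrite -zc; ring.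
have [z0|/ltW z0] := leP 0 z.2; [left|right].
  by rewrite mul1r sqrtr_sqr ger0_norm// -surjective_pairing.
by rewrite mulN1r sqrtr_sqr ler0_norm// opprK -surjective_pairing.
Qed.

End HalfDisks.

Section ParityJump.
Variables (R : realType) (f : plane R -> plane R).
Hypotheses (fc : cont_on cdisk f) (fI : set_inj cdisk f).
Implicit Types (e : R) (z w : plane R).

Definition lens e : set (plane R) := (fun t => f (lens_arc e t)) @` itv01.

Let ends : set (plane R) := [set f (-1, 0); f (1, 0)].

Let fE z w : cdisk z -> cdisk w -> f z = f w -> z = w.
Proof. by move=> zd wd; apply: fI; rewrite inE. Qed.

Lemma arclike_lens e : -1 <= e <= 1 -> arclike (lens e).
Proof.
move=> e1; apply: arclike_path.
  apply: (@cont_on_comp _ _ _ _ cdisk) => //; last exact: cont_on_lens_arc.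
  by move=> t t01; exact: lens_arc_cdisk.
move=> s t /set_mem s01 /set_mem t01.
by move=> /(fE (lens_arc_cdisk e1 s01) (lens_arc_cdisk e1 t01))/lens_arc_inj.
Qed.

Lemma lens_ends e : ends `<=` lens e.
Proof.
move=> _ [->|->]; [exists 0; first exact: itv01_0|exists 1; first exact: itv01_1];
  by rewrite ?lens_arc0 ?lens_arc1.
Qed.

Lemma lensI e e' : -1 <= e <= 1 -> -1 <= e' <= 1 -> e != e' -> lens e `&` lens e' = ends.
Proof.
move=> e1 e'1 ee'; apply/seteqP; split=> [_ [[s s01 <-] [t t01 st]]|z zE]; last first.
  by split; exact: lens_ends.
have {}st := fE (lens_arc_cdisk e'1 t01) (lens_arc_cdisk e1 s01) st.
by have [->|->] := lens_arc_meet s01 ee' (esym st); rewrite ?lens_arc0 ?lens_arc1; [left|right].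
Qed.

Lemma lens_half_disk e e' : 0 <= e' * e -> -1 <= e <= 1 -> lens e `<=` f @` half_disk e'.
Proof.
move=> ee' e1 _ [t t01 <-]; exists (lens_arc e t) => //; split; first exact: lens_arc_cdisk.
by rewrite /= mulrA mulr_ge0// sqrtr_ge0.
Qed.

Lemma circle_lens : f @` circle `<=` lens 1 `|` lens (-1).
Proof.
by move=> _ [z /circle_lens_arc[t t01 [<-|<-]] <-]; [left|right]; exists t.
Qed.

Lemma lens_boundary_odisk e z : odisk z -> e ^+ 2 = 1 -> ~ lens e (f z).
Proof.
move=> oz e2 [t t01 tz].
have e1 : -1 <= e <= 1.
  by move: e2 => /eqP; rewrite sqrf_eq1 => /orP[]/eqP->; apply/andP; split; lra.
move: (oz); rewrite -(fE (lens_arc_cdisk e1 t01) (odisk_cdisk oz) tz) odiskE norm2_lens_arc//.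
by rewrite e2 mul1r subrKC ltxx.
Qed.

Lemma lens0_odisk z : odisk z -> z.2 != 0 -> ~ lens 0 (f z).
Proof.
move=> oz z2 [t t01 tz]; have e1 : -1 <= (0 : R) <= 1 by apply/andP; split; lra.
by move: z2; rewrite -(fE (lens_arc_cdisk e1 t01) (odisk_cdisk oz) tz)/= mul0r eqxx.
Qed.

Lemma even_around_half_disk z e : odisk z -> e * z.2 < 0 ->
  even_around (f @` half_disk e) (f z).
Proof.
move=> oz z2; apply: even_around_star_image.
- exact: star_shaped_half_disk.
- exact: compact_half_disk.
- by apply: cont_onS fc; exact: half_disk_cdisk.
- by apply: sub_in2 fI => y; rewrite !inE; exact: half_disk_cdisk.
- move=> [w [wd w2] /(fE wd (odisk_cdisk oz)) wz].
  by move: w2; rewrite wz leNgt z2.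
Qed.

Variable K : set (plane R).
Hypotheses (aK : arclike K) (KI : K `&` (f @` cdisk) = ends).

Let ends_odisk z : odisk z -> ~ ends (f z).
Proof.
move=> oz; have zd := odisk_cdisk oz.
have endE (x : R) : x ^+ 2 = 1 -> f z <> f (x, 0).
  move=> x2; have x0 : circle (x, 0) by rewrite circleE /norm2/= x2 expr0n/= addr0.
  by move=> /(fE zd (circle_cdisk x0)) zx; apply: (circle_odisk x0); rewrite -zx.
by case; apply: endE; rewrite ?sqrrN expr1n.
Qed.

Let K_odisk z : odisk z -> ~ K (f z).
Proof.
move=> oz Kz; apply: (ends_odisk oz); rewrite -KI; split=> //.
by exists z => //; exact: odisk_cdisk.
Qed.

Let lensK e : -1 <= e <= 1 -> lens e `&` K = ends.
Proof.
move=> e1; apply/seteqP; split=> [x [[t t01 <-] Kx]|x xE].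
  by rewrite -KI; split=> //; exists (lens_arc e t) => //; exact: lens_arc_cdisk.
by split; [exact: lens_ends|move: xE; rewrite -KI => -[]].
Qed.

Let itvN : -1 <= (-1 : R) <= 1. Proof. by apply/andP; split; lra. Qed.
Let itv0 : -1 <= (0 : R) <= 1. Proof. by apply/andP; split; lra. Qed.
Let itv1 : -1 <= (1 : R) <= 1. Proof. by apply/andP; split; lra. Qed.

Let parity_above z w : odisk z -> odisk w ->
  even_around (lens 1 `|` K) (f z) <-> even_around (lens 1 `|` K) (f w).
Proof.
have cLK : compact (lens 1 `|` K).
  by apply: compactU; [case: (arclike_lens itv1)|case: aK].
have co : connected (f @` odisk).
  apply: connected_continuous_connected; first exact: connected_odisk.
  by apply: cont_onS fc; exact: odisk_cdisk.
have no x : (f @` odisk) x -> ~ (lens 1 `|` K) x.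
  by move=> [y oy <-] [|]; [apply: lens_boundary_odisk; rewrite ?expr1n|exact: K_odisk].
by move=> oz ow; split; apply: (even_around_connected cLK co no); (by exists z) || (by exists w).
Qed.

(* Pushing the arc [lens 0] of the theta curve off to [lens 1] changes the parity on
   one side of [lens 0] only. *)
Lemma parity_jump z w : odisk z -> odisk w -> 0 < z.2 -> w.2 < 0 ->
  (even_around (lens 0 `|` K) (f z) <-> ~ even_around (lens 0 `|` K) (f w)).
Proof.
move=> oz ow z2 w2.
have n10 : (1 : R) != 0 by rewrite oner_eq0.
have n1N : (1 : R) != -1 by apply/eqP; lra.
have nN0 : (-1 : R) != 0 by rewrite oppr_eq0 oner_eq0.
have n1 y : odisk y -> ~ lens 1 (f y) by move=> oy; apply: lens_boundary_odisk; rewrite ?expr1n.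
have nN y : odisk y -> ~ lens (-1) (f y).
  by move=> oy; apply: lens_boundary_odisk; rewrite ?sqrrN ?expr1n.
have nz0 := lens0_odisk oz (lt0r_neq0 z2); have nw0 := lens0_odisk ow (ltr0_neq0 w2).
have theta_disk := theta_parity (arclike_lens itv1) (arclike_lens itvN) (arclike_lens itv0)
  (lensI itv1 itvN n1N) (lensI itvN itv0 nN0) (lensI itv1 itv0 n10) (n1 z oz) (nN z oz) nz0.
have theta_K y (oy : odisk y) := theta_parity (arclike_lens itv1) (arclike_lens itv0) aK
  (lensI itv1 itv0 n10) (lensK itv0) (lensK itv1) (n1 y oy) ^~ (K_odisk oy).
have odd_disk : ~ even_around (lens 1 `|` lens (-1)) (f z).
  by move=> /(even_aroundS circle_lens); exact: odd_around_interior.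
have even_below : even_around (lens (-1) `|` lens 0) (f z).
  apply: (@even_aroundS _ _ (f @` half_disk (-1))).
    by move=> x [|]; apply: lens_half_disk; rewrite ?mulr0// mulrNN mulr1.
  by apply: even_around_half_disk; rewrite // mulN1r oppr_lt0.
have even_above : even_around (lens 1 `|` lens 0) (f w).
  apply: (@even_aroundS _ _ (f @` half_disk 1)).
    by move=> x [|]; apply: lens_half_disk; rewrite ?mulr0// mulr1.
  by apply: even_around_half_disk; rewrite // mul1r.
have := theta_K z oz nz0; have := theta_K w ow nw0; have := parity_above oz ow.
have := pselect (even_around (lens 1 `|` lens 0) (f z)).
have := pselect (even_around (lens 0 `|` K) (f z)).
have := pselect (even_around (lens 0 `|` K) (f w)).
have := pselect (even_around (lens 1 `|` K) (f w)).
tauto.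
Qed.

End ParityJump.

(** * Polygons and charts around edges *)

Section CirclePoint.
Variable R : realType.
Implicit Types (s d : R) (z : plane R).

Lemma circle_pointP s : circle (circle_point s).
Proof. by rewrite /unit_circle/= cos2Dsin2. Qed.

Lemma norm2_circle_point s : norm2 (circle_point s) = 1.
Proof. exact: circle_pointP. Qed.

Lemma cont_on_circle_point (T : topologicalType) (A : set T) (f : T -> R) :
  cont_on A f -> cont_on A (fun x => circle_point (f x)).
Proof.
move=> fA; have angle : cont_on A (fun x => 2 * pi * f x).
  by apply: cont_onM => //; exact: cont_on_cst.
apply: cont_on_pair; apply: (@cont_on_comp _ _ _ _ setT _ _ _ angle) => //;
  apply: continuous_cont_on; [exact: continuous_cos|exact: continuous_sin].
Qed.

Lemma circle_pointDn s n : circle_point (s + n%:R) = circle_point s.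
Proof.
elim: n => [|n ih]; first by rewrite addr0.
rewrite -ih -[n.+1%:R]natr1 addrA.
by rewrite /circle_point mulrDr mulr1 [X in _ + X]mulr_natl cosD2pi sinD2pi.
Qed.

Lemma circle_point_inj s s' : `|s - s'| < 1 -> circle_point s = circle_point s' -> s = s'.
Proof.
wlog ss' : s s' / s' <= s.
  by move=> wlg; have [/wlg//|/ltW /wlg wlg' ss' e] := leP s' s; apply/esym/wlg'; rewrite // distrC.
rewrite ger0_norm ?subr_ge0// => ss1 [ec es].
have pi0 : 0 < pi :> R := pi_gt0 R.
have c1 : cos (2 * pi * (s - s')) = 1 by rewrite mulrBr cosB ec es -!expr2 cos2Dsin2.
have [h|h] := leP (s - s') (1 / 2).
  have : 2 * pi * (s - s') = 0.
    apply: cos_inj; rewrite ?cos0//; rewrite in_itv/=; apply/andP; split; nra.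
  by move=> /eqP; rewrite mulf_eq0 subr_eq0 gt_eqF/= ?mulr_gt0// => /eqP.
have : 2 * pi - 2 * pi * (s - s') = 0.
  apply: cos_inj; rewrite ?in_itv/=; [apply/andP; split; nra|apply/andP; split; nra|].
  rewrite cos0 -cosN opprB -[RHS]c1 [2 * pi in X in _ - X]mulr_natl.
  by rewrite -[in RHS](subrK (pi *+ 2) (2 * pi * _)) cosD2pi.
by nra.
Qed.

Lemma circle_point_surj z : circle z -> exists2 s, 0 <= s < 1 & circle_point s = z.
Proof.
move=> zc; have [z1 _] := cdisk_bound (circle_cdisk zc).
have pi0 : 0 < pi :> R by exact: pi_gt0.
have p2 : 2 * pi != 0 :> R by rewrite gt_eqF// mulr_gt0.
have [/andP[a0 a1] ca] := acos_def z1.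
have sa : sin (acos z.1) = `|z.2|.
  by rewrite sin_acos// -sqrtr_sqr; congr Num.sqrt; rewrite -zc; ring.
have [h|h] := leP 0 z.2.
  exists (acos z.1 / (2 * pi)).
    by rewrite divr_ge0 ?mulr_ge0 ?(ltW pi0)//= ltr_pdivrMr ?mulr_gt0// mul1r; nra.
  by rewrite /circle_point mulrC divfK// ca sa ger0_norm// -surjective_pairing.
have a00 : 0 < acos z.1.
  rewrite lt_neqAle a0 andbT eq_sym; apply/eqP => ac; move: sa; rewrite ac sin0.
  by move=> /esym/eqP; rewrite normr_eq0 lt_eqF.
exists (1 - acos z.1 / (2 * pi)).
  have : 0 < acos z.1 / (2 * pi) <= 1 / 2.
    by rewrite divr_gt0 ?mulr_gt0//= ler_pdivrMr ?mulr_gt0//; lra.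
  by move=> /andP[h1 h2]; apply/andP; split; lra.
rewrite /circle_point mulrBr mulr1 (mulrC (2 * pi) (_ / _)) divfK//.
rewrite [2 * pi]mulr_natl [pi *+ 2 - _]addrC cosD2pi sinD2pi cosN sinN ca sa.
by rewrite ltr0_norm// opprK -surjective_pairing.
Qed.

Lemma circle_arcs m z : (0 < m)%N -> circle z ->
  exists j t, [/\ (j < m)%N, 0 <= t < 1 & z = circle_point ((j%:R + t) / m%:R)].
Proof.
move=> m0 /circle_point_surj[s /andP[s0 s1] <-].
have mR : 0 < m%:R :> R by rewrite ltr0n.
have sm : 0 <= s * m%:R by rewrite mulr_ge0// ltW.
have /andP[h1 h2] := truncn_itv sm.
exists (Num.truncn (s * m%:R)), (s * m%:R - (Num.truncn (s * m%:R))%:R); split.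
- by rewrite -(ltr_nat R) (le_lt_trans h1)// gtr_pMl.
- by rewrite subr_ge0 h1/= ltrBlDl natr1.
- by rewrite subrKC mulfK// gt_eqF.
Qed.

(* Near the boundary circle: the first coordinate runs along an arc of length [2 * d]
   around [s], the second one towards the centre. *)
Definition polar s d z : plane R := (1 - z.2 / 2) *: circle_point (s + d * z.1).

Lemma norm2_polar s d z : norm2 (polar s d z) = (1 - z.2 / 2) ^+ 2.
Proof. by rewrite norm2Z norm2_circle_point mulr1. Qed.

Lemma polar_cdisk s d z : 0 <= z.2 <= 1 -> cdisk (polar s d z).
Proof. by move=> /andP[z0 z1]; rewrite cdiskE norm2_polar; nra. Qed.

Lemma polar_odisk s d z : 0 < z.2 <= 1 -> odisk (polar s d z).
Proof. by move=> /andP[z0 z1]; rewrite odiskE norm2_polar; nra. Qed.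

Lemma polar_real s d x : polar s d (x, 0) = circle_point (s + d * x).
Proof. by rewrite /polar/= mul0r subr0 scale1r. Qed.

Lemma polar0 s d : polar s d 0 = circle_point s.
Proof. by rewrite (polar_real s d 0) mulr0 addr0. Qed.

Lemma cont_on_polar A s d : cont_on A (polar s d).
Proof.
apply: cont_onZ.
  apply: cont_onB; [exact: cont_on_cst|apply: cont_onM; last exact: cont_on_cst].
  by apply: cont_on_snd; exact: cont_on_id.
apply: cont_on_circle_point; apply: cont_onD; first exact: cont_on_cst.
by apply: cont_onM; [exact: cont_on_cst|apply: cont_on_fst; exact: cont_on_id].
Qed.

Lemma polar_eq s d s' d' z z' : -1 <= z.2 <= 1 -> -1 <= z'.2 <= 1 ->
  polar s d z = polar s' d' z' ->
  z.2 = z'.2 /\ circle_point (s + d * z.1) = circle_point (s' + d' * z'.1).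
Proof.
move=> /andP[z0 z1] /andP[z0' z1'] e.
have : (1 - z.2 / 2) ^+ 2 = (1 - z'.2 / 2) ^+ 2.
  by rewrite -(norm2_polar s d) -(norm2_polar s' d') e.
move=> /eqP; rewrite eqrXn2//; [move=> /eqP zz|lra|lra].
split; first by lra.
by move: e; rewrite /polar zz => /scalerI; apply; rewrite gt_eqF//; lra.
Qed.

Lemma polar_inj s d : 0 < d < 1 / 2 -> set_inj cdisk (polar s d).
Proof.
move=> /andP[d0 d1] z z' /set_mem/cdisk_bound[/andP[a1 a2] za].
move=> /set_mem/cdisk_bound[/andP[b1 b2] zb] /(polar_eq za zb)[z2 e].
apply: eq_plane => //; suff /addrI/mulfI : s + d * z.1 = s + d * z'.1.
  by apply; rewrite gt_eqF.
apply: circle_point_inj e; rewrite opprD addrACA subrr add0r -mulrBr normrM gtr0_norm//.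
have : `|z.1 - z'.1| <= 2 by rewrite ler_norml; apply/andP; split; lra.
nra.
Qed.

End CirclePoint.

Section EmbeddedGraph.
Variables (R : realType) (S : topologicalType) (G : embedded_graph R S).
Implicit Types (u v a b : G) (s t : R) (x : S).

Lemma adj_neqG u v : adj u v -> u <> v.
Proof. by move=> uv e; move: uv; rewrite e adj_irr. Qed.

Lemma adjG_sym u v : adj u v -> adj v u.
Proof. by rewrite adj_sym. Qed.

Lemma cont_on_earc u v : adj u v -> cont_on itv01 (earc u v).
Proof. exact: earc_continuous. Qed.

Lemma earcC u v t : adj u v -> itv01 t -> earc v u t = earc u v (1 - t).
Proof. by move=> uv t01; exact: earc_rev. Qed.

Lemma itv01_onem t : itv01 t -> itv01 (1 - t).
Proof. by rewrite !itv01E => /andP[t0 t1]; apply/andP; split; lra. Qed.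

Lemma earc_graph u v t : adj u v -> itv01 t -> graph_set G (earc u v t).
Proof. by move=> uv t01; right; exists u, v; split=> //; exists t. Qed.

Lemma earc_vpoint u v a t : adj u v -> itv01 t -> earc u v t = vpoint a ->
  (t = 0 /\ a = u) \/ (t = 1 /\ a = v).
Proof.
move=> uv t01 e; have [t0|t0] := eqVneq t 0.
  by left; split=> //; apply: (@vpoint_inj _ _ G); rewrite -e t0 earc0.
have [t1|t1] := eqVneq t 1.
  by right; split=> //; apply: (@vpoint_inj _ _ G); rewrite -e t1 earc1.
case: (@earc_vertex _ _ G u v a t) => //.
by move: t01; rewrite itv01E in_itv/= !lt_neqAle eq_sym t0 t1.
Qed.

Lemma edgeC u v : adj u v -> edge u v = edge v u.
Proof.
have sub a b : adj a b -> edge a b `<=` edge b a.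
  move=> ab _ [t t01 <-]; exists (1 - t); first exact: itv01_onem.
  by rewrite earcC ?subKr//; exact: itv01_onem.
by move=> uv; apply/seteqP; split; apply: sub; rewrite // adj_sym.
Qed.

Lemma edge_compact u v : adj u v -> compact (edge u v).
Proof. by move=> /cont_on_earc ec; apply: continuous_compact ec _; exact: segment_compact. Qed.

Lemma edge_connected u v : adj u v -> connected (edge u v).
Proof.
by move=> /cont_on_earc; apply: connected_continuous_connected; exact: segment_connected.
Qed.

Lemma edge_vertex u v : adj u v -> edge u v (vpoint u) /\ edge u v (vpoint v).
Proof.
move=> uv; split; first by exists 0; [exact: itv01_0|exact: earc0].
by exists 1; [exact: itv01_1|exact: earc1].
Qed.

Definition interior_edge u v : set S := earc u v @` [set t | 0 < t < 1].

Lemma edge_split u v x : edge u v x -> adj u v ->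
  interior_edge u v x \/ x = vpoint u \/ x = vpoint v.
Proof.
move=> [t t01 <-] uv; have [t0|t0] := eqVneq t 0; first by right; left; rewrite t0 earc0.
have [t1|t1] := eqVneq t 1; first by right; right; rewrite t1 earc1.
left; exists t => //; move: t01; rewrite /= in_itv/= !lt_neqAle => /andP[h1 h2].
by rewrite eq_sym t0 t1 h1.
Qed.

Lemma interior_edge_edge u v : interior_edge u v `<=` edge u v.
Proof. by move=> _ [t /andP[t0 t1] <-]; exists t; rewrite //= in_itv/= !ltW. Qed.

Lemma interior_edge_graph u v : adj u v -> interior_edge u v `<=` graph_set G.
Proof. by move=> uv x /interior_edge_edge; right; exists u, v. Qed.

Lemma interior_edge_disjoint u v a b x : adj u v -> adj a b ->
  interior_edge u v x -> edge a b x -> (a = u /\ b = v) \/ (a = v /\ b = u).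
Proof.
move=> uv ab [s s01 <-] /edge_split/(_ ab)[[t t01 e]|[|]].
- by apply: (@earc_disjoint _ _ G u v a b s t); rewrite ?in_itv.
- by move=> e; case: (@earc_vertex _ _ G u v a s) => //; rewrite in_itv.
- by move=> e; case: (@earc_vertex _ _ G u v b s) => //; rewrite in_itv.
Qed.

Definition axis : set R := [set x | -1 <= x <= 1].

Lemma axis0 : axis 0.
Proof. by apply/andP; split; lra. Qed.

Lemma axisN (x : R) : axis x -> axis (- x).
Proof. by move=> /andP[x0 x1]; apply/andP; split; lra. Qed.

(* The edge uv reparametrized by [-1, 1]. *)
Definition centred_arc u v (x : R) : S := earc u v ((1 + x) / 2).

Lemma axis_itv01 (x : R) : axis x -> itv01 ((1 + x) / 2).
Proof. by move=> /andP[x0 x1]; rewrite itv01E; apply/andP; split; lra. Qed.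

Lemma centred_arc_earc u v t : centred_arc u v (2 * t - 1) = earc u v t.
Proof. by rewrite /centred_arc; congr earc; field. Qed.

Lemma itv01_axis t : itv01 t -> axis (2 * t - 1).
Proof. by rewrite itv01E => /andP[t0 t1]; apply/andP; split; lra. Qed.

Lemma centred_arcN1 u v : adj u v -> centred_arc u v (-1) = vpoint u.
Proof. by move=> uv; rewrite /centred_arc subrr mul0r earc0. Qed.

Lemma centred_arc1 u v : adj u v -> centred_arc u v 1 = vpoint v.
Proof. by move=> uv; rewrite /centred_arc (_ : (1 + 1) / 2 = 1) ?earc1//; field. Qed.

Lemma cont_on_centred_arc u v : adj u v -> cont_on axis (centred_arc u v).
Proof.
move=> uv; apply: (@cont_on_comp _ _ _ _ itv01 (fun x : R => (1 + x) / 2)).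
- by move=> x; exact: axis_itv01.
- apply: cont_onM; last exact: cont_on_cst.
  by apply: cont_onD; [exact: cont_on_cst|exact: cont_on_id].
- exact: cont_on_earc.
Qed.

Lemma centred_arc_inj u v : adj u v -> set_inj axis (centred_arc u v).
Proof.
move=> uv x y /set_mem/axis_itv01 x1 /set_mem/axis_itv01 y1 /(earc_inj uv).
by rewrite !in_itv/= -!itv01E => /(_ x1 y1); lra.
Qed.

Lemma centred_arc_edge u v (x : R) : axis x -> edge u v (centred_arc u v x).
Proof. by move=> /axis_itv01; exists ((1 + x) / 2). Qed.

Lemma centred_arc_graph u v (x : R) : adj u v -> axis x -> graph_set G (centred_arc u v x).
Proof. by move=> uv /axis_itv01; exact: earc_graph. Qed.

Lemma centred_arc_interior u v (x : R) : -1 < x < 1 -> interior_edge u v (centred_arc u v x).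
Proof. by move=> /andP[x0 x1]; exists ((1 + x) / 2) => //=; apply/andP; split; lra. Qed.

Definition midpoint u v : S := centred_arc u v 0.

Lemma midpoint_interior u v : interior_edge u v (midpoint u v).
Proof. by apply: centred_arc_interior; apply/andP; split; lra. Qed.

Lemma midpoint_edge u v : edge u v (midpoint u v).
Proof. exact/interior_edge_edge/midpoint_interior. Qed.

Lemma midpoint_neq_vertex u v a : adj u v -> midpoint u v <> vpoint a.
Proof.
by move=> uv; apply: (earc_vertex uv); rewrite in_itv/=; apply/andP; split; lra.
Qed.

Lemma earc_midpoint u v a b t : adj u v -> adj a b -> itv01 t ->
  earc a b t = midpoint u v -> ((a = u /\ b = v) \/ (a = v /\ b = u)) /\ t = 1 / 2.
Proof.
move=> uv ab t01 e.
have abuv := interior_edge_disjoint uv ab (midpoint_interior u v).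
have {}abuv : (a = u /\ b = v) \/ (a = v /\ b = u) by apply: abuv; rewrite -e; exists t.
split=> //; move: e; rewrite -centred_arc_earc /midpoint => e.
have ax := itv01_axis t01; have axN := axisN ax.
case: abuv e => -[-> ->] e.
  suff : 2 * t - 1 = 0 by lra.
  by apply: (centred_arc_inj uv); rewrite ?inE//; exact: axis0.
suff : - (2 * t - 1) = 0 by lra.
apply: (centred_arc_inj uv); rewrite ?inE//; first exact: axis0.
rewrite -e centred_arc_earc earcC// /centred_arc; congr earc; lra.
Qed.

End EmbeddedGraph.

Arguments axis {R}.

Section Charts.
Variables (R : realType) (S : topologicalType).
Implicit Types (f h : plane R -> S) (g : R -> S) (A B : set S) (z : plane R).

Definition upper : set (plane R) := [set z | cdisk z /\ 0 < z.2].

Record half_chart h g A : Prop := HalfChart {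
  half_chart_cont : cont_on (half_disk 1) h;
  half_chart_inj : set_inj (half_disk 1) h;
  half_chart_axis : forall x, axis x -> h (x, 0) = g x;
  half_chart_upper : forall z, upper z -> A (h z)
}.

Record chart f g A B : Prop := Chart {
  chart_cont : cont_on cdisk f;
  chart_inj : set_inj cdisk f;
  chart_axis : forall x, axis x -> f (x, 0) = g x;
  chart_upper : forall z, cdisk z -> 0 < z.2 -> A (f z);
  chart_lower : forall z, cdisk z -> z.2 < 0 -> B (f z)
}.

Definition flip z : plane R := (z.1, - z.2).

Lemma flip_cdisk z : cdisk z -> cdisk (flip z).
Proof. by rewrite !cdiskE /norm2/= sqrrN. Qed.

Lemma cont_on_flip D : cont_on D flip.
Proof. by apply: cont_on_conjp; exact: cont_on_id. Qed.

Lemma flip_half_disk z : half_disk (-1) z -> half_disk 1 (flip z).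
Proof. by move=> [zd z0]; split; [exact: flip_cdisk|rewrite /= mul1r -mulN1r]. Qed.

Lemma glue_half_charts h1 h2 g A B : half_chart h1 g A -> half_chart h2 g B ->
  (forall x, A x -> ~ B x) -> exists f, chart f g A B /\ forall z, half_disk 1 z -> f z = h1 z.
Proof.
move=> hc1 hc2 AB; pose h2' z := h2 (flip z).
have h2c : cont_on (half_disk (-1)) h2'.
  apply: (@cont_on_comp _ _ _ _ (half_disk 1) _ h2); first exact: flip_half_disk.
    exact: cont_on_flip.
  exact: half_chart_cont hc2.
have h2I : set_inj (half_disk (-1)) h2'.
  move=> z w /set_mem/flip_half_disk zh /set_mem/flip_half_disk wh.
  move=> /(half_chart_inj hc2); rewrite !inE => /(_ zh wh)[z1 /oppr_inj z2].
  exact: eq_plane.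
have h12 (x : R) : cdisk (x, 0) -> h1 (x, 0) = h2' (x, 0).
  move=> /cdisk_real x1; rewrite /h2' /flip/= oppr0.
  by rewrite (half_chart_axis hc1)// (half_chart_axis hc2).
have upper_flip z : cdisk z -> z.2 < 0 -> upper (flip z).
  by move=> zd z0; split; [exact: flip_cdisk|rewrite /= oppr_gt0].
have h1n2 z w : cdisk z -> cdisk w -> 0 < z.2 -> w.2 < 0 -> h1 z <> h2' w.
  move=> zd wd z0 w0 e; apply: (AB (h1 z)); first exact: half_chart_upper hc1 _ _.
  by rewrite e; exact: half_chart_upper hc2 _ (upper_flip w wd w0).
have [f [fc fI fu fl]] :=
  glue_half_disks (half_chart_cont hc1) h2c (half_chart_inj hc1) h2I h12 h1n2.
exists f; split; last by move=> z zh; rewrite fu ?half_disk_ge0//; case: zh.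
split=> //.
- by move=> x x1; rewrite fu//; [exact: half_chart_axis hc1 _ x1|exact/cdisk_real].
- by move=> z zd z0; rewrite fu ?ltW//; exact: half_chart_upper hc1 _ _.
- by move=> z zd z0; rewrite fl ?ltW//; exact: half_chart_upper hc2 _ (upper_flip z zd z0).
Qed.

Lemma half_chart_sub h g A A' : A `<=` A' -> half_chart h g A -> half_chart h g A'.
Proof. by move=> AA' []; split=> // z zu; apply: AA'; auto. Qed.

Lemma chart_sub f g A B A' B' : A `<=` A' -> B `<=` B' -> chart f g A B -> chart f g A' B'.
Proof.
by move=> AA' BB' []; split=> // z zd z0; [apply: AA'|apply: BB']; auto.
Qed.

Lemma chart0 f g A B : chart f g A B -> f 0 = g 0.
Proof. by move=> fC; rewrite -(chart_axis fC)//; exact: axis0. Qed.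

Lemma chart_real f g A B z : chart f g A B -> cdisk z -> z.2 = 0 -> axis z.1 /\ f z = g z.1.
Proof.
move=> fC zd z0; have z1 : axis z.1 by case: (cdisk_bound zd).
by split=> //; rewrite -(chart_axis fC)// -z0 -surjective_pairing.
Qed.

Lemma chartP f g A B z : chart f g A B -> cdisk z ->
  [\/ A (f z), B (f z) | axis z.1 /\ f z = g z.1].
Proof.
move=> fC zd; have [z0|z0|z0] := ltrgt0P z.2.
- by apply: Or31; exact: chart_upper fC _ zd z0.
- by apply: Or32; exact: chart_lower fC _ zd z0.
- by apply: Or33; exact: chart_real fC zd z0.
Qed.

Lemma chart_open f g A B : locally_disk R S -> chart f g A B -> open (f @` odisk).
Proof.
move=> lS fC; apply: invariance_of_domain => //; first exact: open_odisk.
  by apply: cont_onS (chart_cont fC); exact: odisk_cdisk.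
by apply: sub_in2 (chart_inj fC) => z; rewrite !inE; exact: odisk_cdisk.
Qed.

Lemma chart_nbhs f g A B : locally_disk R S -> chart f g A B -> nbhs (g 0) (f @` odisk).
Proof.
move=> lS fC; apply: open_nbhs_nbhs; split; first exact: chart_open fC.
by rewrite -(chart0 fC); exists 0 => //; exact: odisk0.
Qed.

End Charts.

(** * Maps with polygonal faces *)

Section PolygonalMap.
Variables (R : realType) (S : topologicalType) (G : embedded_graph R S).
Local Notation adjG := (@adj R S G).

Record cell_param (F : set S) m (w : nat -> G) (phi : plane R -> S) : Prop := CellParam {
  param_cont : cont_on cdisk phi;
  param_inj : set_inj odisk phi;
  param_image : phi @` odisk = F;
  param_side : forall j t, itv01 t ->
    phi (circle_point ((j%:R + t) / m%:R)) = earc (w j) (w j.+1) t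
}.

Record polygonal_map (I : Type) := PolygonalMap {
  map_walks :> face_walks adjG I;
  cell : I -> set S;
  cell_map : I -> plane R -> S;
  cell_inj : injective cell;
  cellP : forall F, face G F <-> exists i, cell i = F;
  cell_mapP : forall i, cell_param (cell i) (degree map_walks i) (walk map_walks i) (cell_map i)
}.

Lemma boundary_walk_param F m (w0 : 'I_m -> G) : (2 < m)%N -> boundary_walk F w0 ->
  (forall i, adj (w0 i) (w0 (ordS (ordS i)))) -> exists w phi,
  [/\ forall j, w (j + m)%N = w j, forall j, adjG (w j) (w j.+1),
      forall j, adjG (w j) (w j.+2) & cell_param F m w phi].
Proof.
case: m w0 => // m w0 m2 [cw [phi [pc pI pF pw]]] w2.
pose o j : 'I_m.+1 := inord (j %% m.+1).
have oE j : val (o j) = (j %% m.+1)%N by rewrite /= inordK// ltn_mod.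
have oS j : ordS (o j) = o j.+1.
  by apply: val_inj; rewrite /= !inordK ?ltn_mod// -addn1 modnDml addn1.
exists (fun j => w0 (o j)), phi; split=> [j|j|j|].
- by congr w0; apply: val_inj; rewrite !oE modnDr.
- by rewrite -oS; exact: cw.
- by rewrite -!oS; exact: w2.
split=> // j t t01; rewrite -oS -pw; last by rewrite in_itv/= -itv01E.
have := oE j; rewrite /= => ->; congr phi.
rewrite -[RHS](circle_pointDn _ (j %/ m.+1)); congr circle_point.
have m0 : m.+1%:R != 0 :> R by rewrite pnatr_eq0.
rewrite {1}(divn_eq j m.+1) natrD natrM.
by move: (m.+1%:R : R) m0 => n n0; field.
Qed.

Lemma ordS3 (i : 'I_3) : ordS (ordS (ordS i)) = i.
Proof. by apply: val_inj; case: i => [[|[|[|]]]]. Qed.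

Lemma face_param F : irreducible_face G F \/ three_face G F -> exists m w phi,
  [/\ (2 < m)%N, forall j, w (j + m)%N = w j, forall j, adjG (w j) (w j.+1),
      forall j, adjG (w j) (w j.+2) & cell_param F m w phi].
Proof.
case=> [[_ [m [w0 [m4 bw w2]]]]|[_ [w0 bw]]].
  have [w [phi []]] := boundary_walk_param (ltnW m4) bw w2.
  by exists m, w, phi; split=> //; exact: ltnW.
have w2 i : adj (w0 i) (w0 (ordS (ordS i))).
  by have [cw _] := bw; rewrite adj_sym -{2}(ordS3 i); exact: cw.
by have [w [phi []]] := boundary_walk_param (isT : 2 < 3)%N bw w2; exists 3%N, w, phi.
Qed.

Lemma face_irreducible_polygonal : face_irreducible G ->
  exists I : choiceType, inhabited (polygonal_map I).
Proof.
move=> irr; pose I : choiceType := {F : set S | `[< face G F >]}.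
have fI (i : I) : face G (val i) by apply/asboolP; exact: valP i.
pose data := (nat * (nat -> G) * (plane R -> S))%type.
have /choice[d dP] (i : I) : exists d : data,
    [/\ (2 < d.1.1)%N, forall j, d.1.2 (j + d.1.1)%N = d.1.2 j,
        forall j, adjG (d.1.2 j) (d.1.2 j.+1), forall j, adjG (d.1.2 j) (d.1.2 j.+2) &
        cell_param (val i) d.1.1 d.1.2 d.2].
  by have [m [w [phi h]]] := face_param (irr _ (fI i)); exists (m, w, phi).
pose W : face_walks adjG I := FaceWalks
  (fun i => let: And5 h _ _ _ _ := dP i in h) (fun i => let: And5 _ h _ _ _ := dP i in h)
  (fun i => let: And5 _ _ h _ _ := dP i in h) (fun i => let: And5 _ _ _ h _ := dP i in h).
exists I; split; apply: (@PolygonalMap I W val (fun i => (d i).2)).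
- exact: val_inj.
- move=> F; split=> [fF|[i <-]]; last exact: fI.
  have Fi : `[< face G F >] by exact/asboolP.
  by exists (Sub F Fi : I); rewrite SubK.
- by move=> i; case: (dP i).
Qed.

Definition reindex_walks (I J : Type) (W : face_walks adjG I) (e : J -> I) : face_walks adjG J :=
  FaceWalks (fun j => degree_gt2 W (e j)) (fun j => walk_periodic W (e j))
    (fun j => walk_adj W (e j)) (fun j => walk_adj2 W (e j)).

Lemma reindex_polygonal_map (I J : Type) (M : polygonal_map I) (e : J -> I) :
  injective e -> (forall i, exists j, e j = i) -> inhabited (polygonal_map J).
Proof.
move=> eI eS; split; apply: (@PolygonalMap J (reindex_walks M e) (fun j => cell M (e j))
  (fun j => cell_map M (e j))).
- by move=> j k /(@cell_inj _ M)/eI.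
- move=> F; split=> [/(cellP M)[i <-]|[j <-]]; last by apply/(cellP M); exists (e j).
  by have [j <-] := eS i; exists j.
- by move=> j; exact: cell_mapP.
Qed.

Section Cells.
Variables (I : Type) (M : polygonal_map I).
Hypothesis S_disk : locally_disk R S.
Implicit Types (i j : I) (x : S) (z : plane R) (s d : R).

Lemma cell_face i : face G (cell M i).
Proof. by apply/(cellP M); exists i. Qed.

Lemma cell_map_cont i : cont_on cdisk (cell_map M i).
Proof. exact: param_cont (cell_mapP M i). Qed.

Lemma cell_map_inj i : set_inj odisk (cell_map M i).
Proof. exact: param_inj (cell_mapP M i). Qed.

Lemma cell_map_side i n t : itv01 t ->
  cell_map M i (circle_point ((n%:R + t) / (degree M i)%:R)) = earc (walk M i n) (walk M i n.+1) t.
Proof. exact: param_side (cell_mapP M i) n t. Qed.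

Lemma cell_mapE i x : cell M i x <-> exists2 z, odisk z & cell_map M i z = x.
Proof. by rewrite -(param_image (cell_mapP M i)). Qed.

Lemma mem_cell i z : odisk z -> cell M i (cell_map M i z).
Proof. by move=> oz; apply/cell_mapE; exists z. Qed.

Lemma cell_sub_image i : cell M i `<=` cell_map M i @` cdisk.
Proof. by move=> x /cell_mapE[z oz <-]; exists z => //; exact: odisk_cdisk. Qed.

Lemma cell_notin_graph i x : cell M i x -> ~ graph_set G x.
Proof. by have [y _ ->] := cell_face i; exact: connected_component_sub. Qed.

Lemma cell_connected i : connected (cell M i).
Proof. by have [y _ ->] := cell_face i; exact: component_connected. Qed.

Lemma cell_disjoint i j x : cell M i x -> cell M j x -> i = j.
Proof.
have [y _ iE] := cell_face i; have [y' _ jE] := cell_face j; move=> xi xj.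
apply: (@cell_inj _ M); rewrite iE jE in xi xj *.
by rewrite (same_connected_component xi) (same_connected_component xj).
Qed.

Lemma cell_cover x : ~ graph_set G x -> exists i, cell M i x.
Proof.
move=> nx; have /(cellP M)[i iE] : face G (connected_component (~` graph_set G) x) by exists x.
by exists i; rewrite iE; exact: connected_component_refl.
Qed.

Lemma cell_open i : open (cell M i).
Proof.
rewrite -(param_image (cell_mapP M i)); apply: invariance_of_domain => //.
- exact: open_odisk.
- by apply: cont_onS (@cell_map_cont i); exact: odisk_cdisk.
- exact: cell_map_inj.
Qed.

Lemma degree_gt0R i : 0 < (degree M i)%:R :> R.
Proof. by rewrite ltr0n degree_gt0. Qed.

Lemma cell_map_circle i z : circle z -> exists n t,
  [/\ (n < degree M i)%N, 0 <= t < 1, z = circle_point ((n%:R + t) / (degree M i)%:R) &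
      cell_map M i z = earc (walk M i n) (walk M i n.+1) t].
Proof.
move=> /(circle_arcs (degree_gt0 M i))[n [t [ni t01 zE]]]; exists n, t; split=> //.
by rewrite zE cell_map_side// itv01E; case/andP: t01 => -> /ltW ->.
Qed.

Lemma cell_map_graph i z : circle z -> graph_set G (cell_map M i z).
Proof.
move=> /(@cell_map_circle i)[n [t [_ /andP[t0 t1] _ ->]]]; apply: earc_graph; first exact: walk_adj.
by rewrite itv01E t0 ltW.
Qed.

Definition strip i s d : set S := (fun z => cell_map M i (polar s d z)) @` @upper R.

Lemma upper_bound z : upper z -> -1 < z.1 < 1 /\ 0 < z.2 <= 1.
Proof.
move=> [zd z0]; have [_ /andP[_ z1]] := cdisk_bound zd; rewrite z0 z1.
by move: zd; rewrite cdiskE /norm2 => zd; split=> //; apply/andP; split; nra.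
Qed.

Lemma strip_cell i s d : strip i s d `<=` cell M i.
Proof. by move=> _ [z /upper_bound[_ z0] <-]; apply: mem_cell; exact: polar_odisk. Qed.

Section CellHalfChart.
Variables (i : I) (s d e : R) (g : R -> S).
Hypotheses (d_bound : 0 < d < 1 / 2) (e2 : e ^+ 2 = 1).
Hypotheses (gI : set_inj (@axis R) g) (g_graph : forall x : R, axis x -> graph_set G (g x)).
Hypothesis g_cell : forall x : R, axis x -> cell_map M i (circle_point (s + d * (e * x))) = g x.

Let h z := cell_map M i (polar s d (e * z.1, z.2)).

Let turn_cdisk z : cdisk z -> cdisk (e * z.1, z.2).
Proof. by rewrite !cdiskE /norm2/= exprMn e2 mul1r. Qed.

Let h_upper z : upper z -> strip i s d (h z).
Proof. by move=> [zd z0]; exists (e * z.1, z.2) => //; split=> //; exact: turn_cdisk. Qed.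

Let h_real z : cdisk z -> z.2 = 0 -> h z = g z.1.
Proof. by move=> /cdisk_bound[z1 _] z0; rewrite /h z0 polar_real g_cell. Qed.

Let h_inj : set_inj (half_disk 1) h.
Proof.
have h_upper_real z w : upper z -> cdisk w -> w.2 = 0 -> h z <> h w.
  move=> uz wd w0 zw; apply: (cell_notin_graph (strip_cell (h_upper uz))).
  by rewrite zw h_real//; apply: g_graph; case: (cdisk_bound wd).
have half z : half_disk 1 z -> z.2 = 0 \/ upper z.
  move=> zh; have [zd _] := zh; have := half_disk_ge0 zh; rewrite le_eqVlt => /orP[/eqP|].
    by left.
  by right.
move=> z w /set_mem zh /set_mem wh zw; have [zd _] := zh; have [wd _] := wh.
have [z0|uz] := half z zh; have [w0|uw] := half w wh.
- move: zw; rewrite !h_real// => /gI; rewrite !inE => zw.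
  apply: eq_plane; last by rewrite z0 w0.
  by apply: zw; [case: (cdisk_bound zd)|case: (cdisk_bound wd)].
- by case: (h_upper_real _ _ uw zd z0).
- by case: (h_upper_real _ _ uz wd w0).
have turn_odisk y : upper y -> odisk (polar s d (e * y.1, y.2)).
  by move=> /upper_bound[_ y0]; exact: polar_odisk.
have := cell_map_inj (mem_set (turn_odisk z uz)) (mem_set (turn_odisk w uw)) zw.
move=> /(polar_inj d_bound (mem_set (turn_cdisk zd)) (mem_set (turn_cdisk wd)))[e1 e3].
apply: eq_plane => //; apply: (@mulfI _ e) => //.
by rewrite -sqrf_eq0 e2 oner_eq0.
Qed.

Lemma cell_half_chart : half_chart h g (strip i s d).
Proof.
split=> //; last by move=> x x1; rewrite h_real//; exact/cdisk_real.
apply: (@cont_on_comp _ _ _ _ cdisk (fun z => polar s d (e * z.1, z.2))).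
- move=> z zh; have [/cdisk_bound[_ /andP[_ z1]] _] := zh.
  by apply: polar_cdisk => /=; rewrite z1 half_disk_ge0.
- apply: (@cont_on_comp _ _ _ _ setT (fun z => (e * z.1, z.2))) => //; last exact: cont_on_polar.
  apply: cont_on_pair; last by apply: cont_on_snd; exact: cont_on_id.
  by apply: cont_onM; [exact: cont_on_cst|apply: cont_on_fst; exact: cont_on_id].
- exact: cell_map_cont.
Qed.

End CellHalfChart.
End Cells.
End PolygonalMap.

(** * The two sides of an edge *)

Section HalfPlaneImage.
Variables (R : realType) (S : topologicalType).
Hypotheses (S_hausdorff : hausdorff_space S) (S_disk : locally_disk R S).

Lemma half_plane_image_not_nbhs (K : set (plane R)) (k : plane R -> S) :
  compact K -> (forall z, K z -> 0 <= z.2) -> K 0 -> cont_on K k -> set_inj K k ->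
  ~ nbhs (k 0) (k @` K).
Proof.
move=> cK K_ge0 K0 kc kI; rewrite nbhsE => -[N [oN N0] NK].
have := invariance_of_domain_inverse S_hausdorff S_disk cK kc kI oN NK.
rewrite openE => /(_ 0 (conj K0 N0))/nbhs_ballP[r /= r0 rK].
have [] := rK (0, - (r / 2)); last by move=> /K_ge0/=; lra.
split; rewrite /= -ball_normE /ball_/= sub0r normrN ?normr0//.
by rewrite normrN gtr0_norm; lra.
Qed.

End HalfPlaneImage.

Section Sides.
Variables (R : realType) (S : topologicalType) (G : embedded_graph R S).
Local Notation adjG := (@adj R S G).
Hypotheses (S_hausdorff : hausdorff_space S) (S_disk : locally_disk R S).
Variables (I : choiceType) (M : polygonal_map G I).
Implicit Types (i : I) (p q r : side M) (u v a b : G).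

Definition side_mid i n : R := (n%:R + 1 / 2) / (degree M i)%:R.

Definition side_len i : R := 1 / 2 / (degree M i)%:R.

Definition side_strip p : set S :=
  strip M (tag p) (side_mid (tag p) (tagged p)) (side_len (tag p)).

Lemma side_strip_cell p : side_strip p `<=` cell M (tag p).
Proof. exact: strip_cell. Qed.

Lemma side_len_bound i : 0 < side_len i < 1 / 2.
Proof.
have d0 := degree_gt0R M i.
rewrite /side_len divr_gt0//= ltr_pdivrMr// ltr_pMr// ltr1n.
exact: leq_trans (degree_gt2 M i).
Qed.

Lemma side_pointE i n (x : R) :
  side_mid i n + side_len i * x = (n%:R + (1 + x) / 2) / (degree M i)%:R.
Proof.
have d0 := degree_gt0R M i; rewrite /side_mid /side_len.
by field; rewrite gt_eqF.
Qed.

Lemma on_edgeP p u v : on_edge p u v <->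
  walk M (tag p) (tagged p) = u /\ walk M (tag p) (tagged p).+1 = v \/
  walk M (tag p) (tagged p) = v /\ walk M (tag p) (tagged p).+1 = u.
Proof. by rewrite -(rwP eqP); exact: eq_set2P. Qed.

Lemma side_adj p u v : on_edge p u v -> adj u v.
Proof. exact/on_edge_adj/adj_sym. Qed.

Lemma side_arc p u v : on_edge p u v -> exists2 e : R, e ^+ 2 = 1 &
  forall x : R, axis x -> cell_map M (tag p)
    (circle_point (side_mid (tag p) (tagged p) + side_len (tag p) * (e * x))) = centred_arc u v x.
Proof.
move=> pe; have uv := side_adj pe; case/on_edgeP: pe => -[wu wv].
  exists 1; first by rewrite expr1n.
  by move=> x x1; rewrite mul1r side_pointE cell_map_side ?wu ?wv//; exact: axis_itv01.
exists (-1); first by rewrite sqrrN expr1n.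
move=> x x1; have x1' := axisN x1.
rewrite mulN1r side_pointE cell_map_side ?wu ?wv; last exact: axis_itv01.
by rewrite earcC//; [rewrite /centred_arc; congr earc; lra|exact: axis_itv01].
Qed.

Lemma side_midpoint p u v : on_edge p u v ->
  cell_map M (tag p) (circle_point (side_mid (tag p) (tagged p))) = midpoint u v.
Proof.
by move=> /side_arc[e _ h]; rewrite /midpoint -h ?mulr0 ?addr0//; exact: axis0.
Qed.

Lemma side_half_chart p u v : on_edge p u v -> exists2 e : R, e ^+ 2 = 1 &
  half_chart (fun z => cell_map M (tag p)
      (polar (side_mid (tag p) (tagged p)) (side_len (tag p)) (e * z.1, z.2)))
    (centred_arc u v) (side_strip p).
Proof.
move=> pe; have uv := side_adj pe; have [e e2 h] := side_arc pe; exists e => //.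
apply: cell_half_chart => //; first exact: side_len_bound.
  exact: centred_arc_inj.
by move=> x; exact: centred_arc_graph.
Qed.

Lemma strip_inj i n n' x : (n < degree M i)%N -> (n' < degree M i)%N ->
  strip M i (side_mid i n) (side_len i) x -> strip M i (side_mid i n') (side_len i) x -> n = n'.
Proof.
move=> ni n'i [z zu <-] [z' z'u].
have [z_itv zh] := upper_bound zu; have [z'_itv z'h] := upper_bound z'u.
move=> /(cell_map_inj (mem_set (polar_odisk _ _ z'h)) (mem_set (polar_odisk _ _ zh))).
move=> /polar_eq[||_]; [by case: z'u => /cdisk_bound[]|by case: zu => /cdisk_bound[]|].
rewrite !side_pointE; have d0 := degree_gt0R M i.
have bound (k : nat) (t : R) : (k < degree M i)%N -> -1 < t < 1 ->
    0 < (k%:R + (1 + t) / 2) / (degree M i)%:R < 1.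
  move=> ki /andP[t0 t1]; have k0 := ler0n R k; apply/andP; split.
    by rewrite divr_gt0//; lra.
  have : k.+1%:R <= (degree M i)%:R :> R by rewrite ler_nat.
  by rewrite ltr_pdivrMr// mul1r -natr1; lra.
have /andP[p0 p1] := bound _ _ ni z_itv; have /andP[q0 q1] := bound _ _ n'i z'_itv.
move=> /circle_point_inj.
set a := _ / _ in p0 p1 *; set b := _ / _ in q0 q1 *.
have -> : `|b - a| < 1 by rewrite ltr_norml; apply/andP; split; lra.
move=> /(_ isT)/(mulIf (invr_neq0 (lt0r_neq0 d0))) nn'.
move: z_itv z'_itv => /andP[z0 z1] /andP[z'0 z'1].
by apply/eqP; rewrite eqn_leq; apply/andP; split; rewrite -ltnS -(ltr_nat R) -natr1; lra.
Qed.

Lemma side_strip_disjoint p q x : p <> q -> side_strip p x -> ~ side_strip q x.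
Proof.
case: p q => i n [i' n'] pq xp xq.
have /= ii' := cell_disjoint (side_strip_cell xp) (side_strip_cell xq).
rewrite -{i'}ii' in n' pq xp xq; apply: pq; congr Tagged; apply: val_inj.
exact: strip_inj (ltn_ord n) (ltn_ord n') xp xq.
Qed.

Lemma edge_chart p q u v : on_edge p u v -> on_edge q u v -> p <> q ->
  exists f, chart f (centred_arc u v) (side_strip p) (side_strip q).
Proof.
move=> /side_half_chart[e _ hp] /side_half_chart[e' _ hq] pq.
have [f [fC _]] := glue_half_charts hp hq (fun x => side_strip_disjoint pq (x := x)).
by exists f.
Qed.

Lemma edge_cell_chart p q u v : on_edge p u v -> on_edge q u v -> p <> q ->
  exists f, chart f (centred_arc u v) (cell M (tag p)) (cell M (tag q)).
Proof.
move=> pe qe pq; have [f fC] := edge_chart pe qe pq; exists f.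
by apply: chart_sub fC; exact: side_strip_cell.
Qed.

Lemma at_most_two_sides p q r u v : on_edge p u v -> on_edge q u v -> on_edge r u v ->
  p <> q -> r = p \/ r = q.
Proof.
move=> pe qe re pq; have [f fC] := edge_chart pe qe pq; have uv := side_adj pe.
pose s := side_mid (tag r) (tagged r); pose d := side_len (tag r).
have path_cont : cont_on itv01 (fun y : R => cell_map M (tag r) (polar s d (0, y))).
  apply: (@cont_on_comp _ _ _ _ cdisk); last exact: cell_map_cont.
    by move=> y; rewrite itv01E => y01; apply: polar_cdisk.
  apply: (@cont_on_comp _ _ _ _ setT (fun y : R => (0, y))) => //; last exact: cont_on_polar.
  by apply: cont_on_pair; [exact: cont_on_cst|exact: cont_on_id].
have := chart_nbhs S_disk fC; rewrite -/(midpoint u v) -(side_midpoint re) -(polar0 _ d).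
move=> /(path_near0 path_cont)[y /andP[y0 y1] [z oz fz]].
have yr : side_strip r (f z).
  rewrite fz; exists (0, y) => //; split=> //.
  by rewrite cdiskE /norm2/= expr0n/= add0r exprn_ile1// ltW.
have [zp|zq|[z1 zg]] := chartP fC (odisk_cdisk oz).
- by left; apply: contrapT => rp; exact: side_strip_disjoint rp yr zp.
- by right; apply: contrapT => rq; exact: side_strip_disjoint rq yr zq.
- by case: (cell_notin_graph (side_strip_cell yr)); rewrite zg; exact: centred_arc_graph.
Qed.

Lemma cells_finite : finite_set [set: I].
Proof.
pose first_edge (e : G * G) := [set i | side_edge M i 0 = [set e.1; e.2]%SET].
apply: (@sub_finite_set _ _ (\bigcup_(e in [set: (G * G)%type]) first_edge e)).
  by move=> i _; exists (walk M i 0, walk M i 1).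
apply: bigcup_finite; first exact: finite_finset.
move=> [u v] _; have on_first i : first_edge (u, v) i -> on_edge (side_at M i 0) u v.
  by move=> iE; rewrite on_edge_side_at; exact/eqP.
have [[i iE]|none] := pselect (exists i, first_edge (u, v) i); last first.
  by apply: (@sub_finite_set _ _ set0) => // i iE; apply: none; exists i.
have [[j [jE ij]]|none] := pselect (exists j, first_edge (u, v) j /\ j <> i); last first.
  by apply: (@sub_finite_set _ _ [set i]) => // j jE; apply: contrapT => ij; apply: none; exists j.
apply: (@sub_finite_set _ _ [set i; j]) => // k kE.
have [|/(congr1 tag)/= ki|/(congr1 tag)/= kj] :=
  at_most_two_sides (on_first i iE) (on_first j jE) (on_first k kE); [|by left|by right].
by move=> /(congr1 tag)/= /esym.
Qed.

Lemma cell_map_midpoint i z u v : adj u v -> cdisk z -> cell_map M i z = midpoint u v ->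
  exists p, [/\ tag p = i, on_edge p u v & z = circle_point (side_mid (tag p) (tagged p))].
Proof.
move=> uv /cdisk_split[oz|cz] zm.
  case: (cell_notin_graph (mem_cell M i oz)); rewrite zm; apply: centred_arc_graph => //.
  exact: axis0.
have [n [t [ni /andP[t0 t1] zE zw]]] := cell_map_circle M i cz.
have t01 : itv01 t by rewrite itv01E t0 ltW.
have [wuv t2] := earc_midpoint uv (walk_adj M i n) t01 (etrans (esym zw) zm).
exists (side_at M i n); split=> //; first by rewrite on_edge_side_at; apply/eqP/eq_set2P.
by rewrite zE t2 /side_mid /= modn_small.
Qed.

Lemma near_cells (x : S) (A : set S) :
  (forall i z, cdisk z -> cell_map M i z = x ->
    \forall z' \near z, cdisk z' -> A (cell_map M i z')) ->
  \forall y \near x, forall i z, cdisk z -> cell_map M i z = y -> A y.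
Proof.
move=> nearA; suff : \forall y \near x, forall i, [set: I] i ->
    forall z, cdisk z -> cell_map M i z = y -> A y.
  by apply: filterS => y h i; exact: h.
apply: near_finite; first exact: cells_finite.
move=> i _; apply: compact_near_preimage => //; [exact: compact_cdisk|exact: cell_map_cont|].
by move=> z zd zx; exact: nearA.
Qed.

Lemma near_midpoint_edge u v (A : set S) : adj u v ->
  (forall t : R, 0 < t < 1 -> A (earc u v t)) ->
  \forall y \near midpoint u v, graph_set G y -> A y.
Proof.
move=> uv uvA.
have near_edges : \forall y \near midpoint u v, forall e, [set: (G * G)%type] e ->
    adj e.1 e.2 -> forall t, itv01 t -> earc e.1 e.2 t = y -> A y.
  apply: near_finite; first exact: finite_finset.
  move=> [a b] _ /=; have [ab|nab] := boolP (adj a b); last by apply: nearW.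
  suff : \forall y \near midpoint u v, forall t, itv01 t -> earc a b t = y -> A y.
    by apply: filterS => y h _.
  apply: compact_near_preimage => //; [exact: segment_compact|exact: cont_on_earc|].
  move=> t t01 /(earc_midpoint uv ab t01)[abuv t2].
  have : nbhs t `]0, 1[%classic.
    apply: open_nbhs_nbhs; split; first exact: itv_open.
    by rewrite t2 /= in_itv/=; apply/andP; split; lra.
  apply: filterS => s; rewrite /= in_itv/= => s01 s_itv.
  case: abuv => -[-> ->]; first exact: uvA.
  rewrite earcC//; apply: uvA; case/andP: s01 => s0 s1; apply/andP; split; lra.
have near_vertices : \forall y \near midpoint u v, forall a, [set: G] a -> vpoint a <> y.
  apply: near_finite; first exact: finite_finset.
  move=> a _; have : nbhs (midpoint u v) (~` [set vpoint a]).
    apply: open_nbhs_nbhs; split; last exact: midpoint_neq_vertex.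
    by apply: closed_openC; apply: compact_closed => //; exact: compact_set1.
  by apply: filterS => y ny e; apply: ny.
apply: filterS2 near_edges near_vertices => y yE yV.
move=> [[a _ ay]|[a [b [ab [t t01 ty]]]]]; first by case: (yV a).
exact: (yE (a, b) _ ab t t01 ty).
Qed.

Lemma midpoint_nbhs u v (A : set S) : adj u v -> (forall t : R, 0 < t < 1 -> A (earc u v t)) ->
  (forall i z, cdisk z -> cell_map M i z = midpoint u v ->
    \forall z' \near z, cdisk z' -> A (cell_map M i z')) -> nbhs (midpoint u v) A.
Proof.
move=> uv uvA cellsA.
apply: filterS2 (near_midpoint_edge uv uvA) (near_cells cellsA) => y yE yC.
have [/yE//|/(cell_cover M)[i iy]] := pselect (graph_set G y).
by have [z zd zy] := cell_sub_image iy; exact: yC zd zy.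
Qed.

Lemma edge_has_side u v : adj u v -> exists p, on_edge p u v.
Proof.
move=> uv; apply: contrapT => none.
pose K : set (plane R) := half_disk 1 `&` half_disk (-1).
have K_real z : K z -> axis z.1 /\ z.2 = 0.
  move=> [z1 zN]; split; first by case: (z1) => /cdisk_bound[].
  by apply/eqP; rewrite eq_le (half_disk_ge0 z1) (half_disk_le0 zN).
have real_K (x : R) : axis x -> K (x, 0).
  by move=> /cdisk_real xd; split; [apply: upper_half_disk|apply: lower_half_disk].
apply: (@half_plane_image_not_nbhs _ _ S_hausdorff S_disk K (fun z => centred_arc u v z.1)).
- by apply: compact_closedI; [exact: compact_half_disk|exact: closed_half_disk].
- by move=> z /K_real[_ ->].
- exact: real_K (@axis0 R).
- apply: (@cont_on_comp _ _ _ _ (@axis R)); [by move=> z /K_real[]| |exact: cont_on_centred_arc].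
  by apply: cont_on_fst; exact: cont_on_id.
- move=> z w /set_mem/K_real[z1 z2] /set_mem/K_real[w1 w2] /(centred_arc_inj uv).
  by rewrite !inE => /(_ z1 w1) zw; apply: eq_plane; rewrite ?z2.
apply: midpoint_nbhs => // [t /andP[t0 t1]|i z zd zm].
  exists (2 * t - 1, 0); last by rewrite centred_arc_earc.
  by apply/real_K/itv01_axis; rewrite itv01E !ltW.
by case: none; have [p [_ pe _]] := cell_map_midpoint uv zd zm; exists p.
Qed.

Lemma map_two_sided : two_sided M.
Proof.
move=> u v uv; have [p pe] := edge_has_side uv.
suff [q [qe pq]] : exists q, on_edge q u v /\ p <> q.
  exists p, q; split=> // r; split=> [re|[->|->]//]; exact: at_most_two_sides pe qe re pq.
apply: contrapT => none.
have only q : on_edge q u v -> q = p.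
  by move=> qe; apply: contrapT => pq; apply: none; exists q; split=> //; exact: nesym.
pose s := side_mid (tag p) (tagged p); pose d := side_len (tag p).
have [e e2 hC] := side_half_chart pe; set h := (fun z => _) in hC.
apply: (@half_plane_image_not_nbhs _ _ S_hausdorff S_disk (half_disk 1) h).
- exact: compact_half_disk.
- exact: half_disk_ge0.
- by apply: upper_half_disk => //; exact: cdisk0.
- exact: half_chart_cont hC.
- exact: half_chart_inj hC.
have -> : h 0 = midpoint u v by rewrite /midpoint -(half_chart_axis hC (@axis0 R)).
apply: midpoint_nbhs => // [t /andP[t0 t1]|i z zd zm].
  have t_axis : axis (2 * t - 1) by apply: itv01_axis; rewrite itv01E !ltW.
  exists (2 * t - 1, 0); last by rewrite (half_chart_axis hC) ?centred_arc_earc.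
  by apply: upper_half_disk => //; exact/cdisk_real.
have [q [qi /only qp zE]] := cell_map_midpoint uv zd zm; rewrite -{i}qi {q}qp in zm zE *.
have : nbhs z (polar s d @` odisk).
  apply: open_nbhs_nbhs; split; last by exists 0; [exact: odisk0|rewrite polar0].
  apply: invariance_of_domain; [exact: plane_locally_disk|exact: open_odisk|exact: cont_on_polar|].
  apply: sub_in2 (polar_inj (side_len_bound (tag p))) => y; rewrite !inE; exact: odisk_cdisk.
apply: filterS => _ [y oy <-] yd; exists (e * y.1, y.2).
  apply: upper_half_disk; first by rewrite cdiskE /norm2/= exprMn e2 mul1r; exact: odisk_cdisk oy.
  have [_ /andP[y0 y1]] := cdisk_bound (odisk_cdisk oy).
  by move: yd; rewrite cdiskE norm2_polar /=; nra.
by rewrite /h /= mulrA -expr2 e2 mul1r -surjective_pairing.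
Qed.

End Sides.

Lemma face_irreducible_finite_polygonal (R : realType) (S : topologicalType)
    (G : embedded_graph R S) : locally_disk R S -> face_irreducible G ->
  exists FT : finType, inhabited (polygonal_map G FT).
Proof.
move=> S_disk /face_irreducible_polygonal[I [M]].
have /finite_seqP[s sE] := cells_finite S_disk M.
exists (seq_sub s); apply: (reindex_polygonal_map M (e := val)); first exact: val_inj.
move=> i; have is_ : i \in s by have : [set: I] i by []; rewrite sE.
by exists (SeqSub is_).
Qed.

(** * Corners shared by two faces *)

Section Corners.
Variables (R : realType) (S : topologicalType) (G : embedded_graph R S).
Hypothesis S_disk : locally_disk R S.
Implicit Types (a b p v : G) (x y t : R).

(* The path from the midpoint of ap through p to the midpoint of pb. *)
Definition bent_arc a p b x : S := if 0 <= x then earc p b (x / 2) else earc a p (1 + x / 2).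

Lemma bent_arc_apex a p b : adj p b -> bent_arc a p b 0 = vpoint p.
Proof. by move=> pb; rewrite /bent_arc lexx mul0r earc0. Qed.

Lemma bent_arc_edge a p b x : axis x ->
  edge p b (bent_arc a p b x) \/ edge a p (bent_arc a p b x).
Proof.
move=> /andP[x0 x1]; rewrite /bent_arc; case: leP => x_sign; [left|right].
  by exists (x / 2) => //=; rewrite in_itv/=; apply/andP; split; lra.
by exists (1 + x / 2) => //=; rewrite in_itv/=; apply/andP; split; lra.
Qed.

Lemma bent_arc_graph a p b x : adj a p -> adj p b -> axis x -> graph_set G (bent_arc a p b x).
Proof.
by move=> ap pb /(bent_arc_edge a p b)[]; right; [exists p, b|exists a, p].
Qed.

Lemma bent_arcN a p b x : adj a p -> adj p b -> axis x -> bent_arc b p a (- x) = bent_arc a p b x.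
Proof.
move=> ap pb /andP[x0 x1]; rewrite /bent_arc oppr_ge0.
case: (ltrgt0P x) => [x_pos|x_neg|->]; last by rewrite mul0r oppr0 mul0r !earc0// adj_sym.
  rewrite earcC//; last by rewrite itv01E; apply/andP; split; lra.
  by congr earc; lra.
rewrite (@earcC _ _ _ a)//; last by rewrite itv01E; apply/andP; split; lra.
by congr earc; lra.
Qed.

Lemma bent_arc_inj a p b : adj a p -> adj p b -> a <> b -> set_inj (@axis R) (bent_arc a p b).
Proof.
move=> ap pb ab.
have branches_disjoint x y : 0 <= x <= 1 -> -1 <= y < 0 -> earc p b (x / 2) <> earc a p (1 + y / 2).
  move=> /andP[x0 x1] /andP[y0 y1] xy.
  have y_int : interior_edge a p (earc a p (1 + y / 2)).
    by exists (1 + y / 2) => //=; apply/andP; split; lra.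
  have : edge p b (earc a p (1 + y / 2)).
    by rewrite -xy; exists (x / 2) => //=; rewrite in_itv/=; apply/andP; split; lra.
  move=> /(interior_edge_disjoint ap pb y_int)[[pa _]|[_ ba]]; first exact: (adj_neqG ap).
  exact: ab.
move=> x y /set_mem/andP[x0 x1] /set_mem/andP[y0 y1]; rewrite /bent_arc.
case: (leP 0 x) => x_sign; case: (leP 0 y) => y_sign xy.
- suff : x / 2 = y / 2 by lra.
  by apply: earc_inj xy; rewrite // in_itv/=; apply/andP; split; lra.
- by case: (branches_disjoint x y) => //; apply/andP; split; lra.
- by case: (branches_disjoint y x) => //; apply/andP; split; lra.
- suff : 1 + x / 2 = 1 + y / 2 by lra.
  by apply: earc_inj xy; rewrite // in_itv/=; apply/andP; split; lra.
Qed.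

Lemma bent_arc_chart_neighbours f A B a p b v : chart f (bent_arc a p b) A B ->
  (forall s, A s -> ~ graph_set G s) -> (forall s, B s -> ~ graph_set G s) ->
  adj a p -> adj p b -> adj p v -> v = a \/ v = b.
Proof.
move=> fC nA nB ap pb pv.
have := chart_nbhs S_disk fC; rewrite bent_arc_apex// -(earc0 pv).
move=> /(path_near0 (cont_on_earc pv))[t t01 [z oz zt]].
have t_int : interior_edge p v (earc p v t) by exists t.
have t_graph := interior_edge_graph pv t_int.
have [zA|zB|[z1 zE]] := chartP fC (odisk_cdisk oz); rewrite -zt in t_int t_graph.
- by case: (nA _ zA).
- by case: (nB _ zB).
have := bent_arc_edge a p b z1; rewrite -zE.
move=> [/(interior_edge_disjoint pv pb t_int)|/(interior_edge_disjoint pv ap t_int)].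
  by case=> [[_ ->]|[pv' _]]; [right|case: (adj_neqG pv)].
by case=> [[_ pv']|[-> _]]; [case: (adj_neqG pv)|left].
Qed.

Variables (I : choiceType) (M : polygonal_map G I).
Implicit Types i j : I.

Lemma cell_map_corner i n x : axis x ->
  cell_map M i (circle_point (n.+1%:R / (degree M i)%:R + side_len M i * x)) =
  bent_arc (walk M i n) (walk M i n.+1) (walk M i n.+2) x.
Proof.
move=> /andP[x0 x1]; have d0 := degree_gt0R M i; rewrite /bent_arc /side_len.
case: leP => x_sign.
  rewrite -cell_map_side; last by rewrite itv01E; apply/andP; split; lra.
  by congr (cell_map M i (circle_point _)); field; rewrite gt_eqF.
rewrite -cell_map_side; last by rewrite itv01E; apply/andP; split; lra.
by congr (cell_map M i (circle_point _)); rewrite -natr1; field; rewrite gt_eqF.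
Qed.

Lemma corner_half_chart i n a p b : walk M i n.+1 = p -> link M i n = [set a; b]%SET ->
  exists h, half_chart h (bent_arc a p b) (cell M i).
Proof.
move=> wp /eq_set2P wab.
have [ap pb nab] : [/\ adj (walk M i n) p, adj p (walk M i n.+2) & walk M i n <> walk M i n.+2].
  by rewrite -wp; split; [exact: walk_adj|exact: walk_adj|exact/adj_neqG/walk_adj2].
have [e e2 cornerE] : exists2 e : R, e ^+ 2 = 1 & forall x, axis x ->
    cell_map M i (circle_point (n.+1%:R / (degree M i)%:R + side_len M i * (e * x))) =
    bent_arc a p b x.
  case: wab => -[<- <-].
    by exists 1; [rewrite expr1n|move=> x x1; rewrite mul1r cell_map_corner ?wp].
  exists (-1); first by rewrite sqrrN expr1n.
  move=> x x1; rewrite mulN1r cell_map_corner ?wp; last exact: axisN.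
  by rewrite bent_arcN// adj_sym.
have [ap' pb' nab'] : [/\ adj a p, adj p b & a <> b].
  case: wab => -[<- <-]; first by split.
  by split; [rewrite adj_sym|rewrite adj_sym|exact: nesym].
have := cell_half_chart (side_len_bound M i) e2 (bent_arc_inj ap' pb' nab')
  (fun x => bent_arc_graph ap' pb' (x := x)) cornerE.
by move=> /(half_chart_sub (@strip_cell _ _ _ _ M i _ _)); set h := (fun z => _); exists h.
Qed.

Lemma map_closed_corners : closed_corners M.
Proof.
move=> i n j k ij apex /esym links v pv.
have [h hC] := corner_half_chart erefl (erefl (link M i n)).
have [h' hC'] := corner_half_chart (esym apex) links.
have [|f [fC _]] := glue_half_charts hC hC'.
  by move=> x xi xj; apply: ij; exact: cell_disjoint xi xj.
have := bent_arc_chart_neighbours fC (cell_notin_graph (i := i)) (cell_notin_graph (i := j))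
  (walk_adj M i n) (walk_adj M i n.+1) pv.
by rewrite !inE => -[]->; rewrite eqxx ?orbT.
Qed.

End Corners.

(** * Disks bounded by triangles *)

Section Circle.
Variable R : realType.
Implicit Types (c : plane R) (N : set (plane R)).

Lemma circle_near_odisk c N : circle c -> nbhs c N -> exists2 z, odisk z & N z.
Proof.
move=> cc cN; have : cont_on (@itv01 R) (fun t => (1 - t) *: c).
  apply: cont_onZ; last exact: cont_on_cst.
  by apply: cont_onB; [exact: cont_on_cst|exact: cont_on_id].
move=> /path_near0; rewrite subr0 scale1r => /(_ _ cN)[t /andP[t0 t1] Nt].
by exists ((1 - t) *: c); rewrite // odiskE norm2Z (cc : norm2 c = 1); nra.
Qed.

Lemma circle_not_interior c N : circle c -> nbhs c N -> ~ N `<=` cdisk.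
Proof.
move=> cc cN Nd; have : cont_on (@itv01 R) (fun t => (1 + t) *: c).
  apply: cont_onZ; last exact: cont_on_cst.
  by apply: cont_onD; [exact: cont_on_cst|exact: cont_on_id].
move=> /path_near0; rewrite addr0 scale1r => /(_ _ cN)[t /andP[t0 t1] /Nd].
by rewrite cdiskE norm2Z (cc : norm2 c = 1); nra.
Qed.

End Circle.

Section MappedHalfCharts.
Variable R : realType.

Lemma set_inj_imageI (T U : Type) (D A B : set T) (f : T -> U) : set_inj D f ->
  A `<=` D -> B `<=` D -> f @` A `&` f @` B = f @` (A `&` B).
Proof.
move=> fI AD BD; apply/seteqP; split; last exact: sub_image_setI.
move=> _ [[x Ax <-] [y By /fI]]; rewrite !inE => /(_ (BD y By) (AD x Ax)) yx.
by rewrite yx in By; exists x.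
Qed.

Lemma half_chart_comp (S U : topologicalType) (D A : set S) (k : S -> U) (h : plane R -> S) g :
  cont_on D k -> set_inj D k -> half_chart h g A -> A `<=` D -> (forall x, axis x -> D (g x)) ->
  half_chart (k \o h) (k \o g) (k @` A).
Proof.
move=> kc kI [hc hI hg hA] AD gD.
have hD z : half_disk 1 z -> D (h z).
  move=> zh; have [zd _] := zh; have := half_disk_ge0 zh.
  rewrite le_eqVlt => /orP[/eqP z0|z0]; last exact/AD/hA.
  have z1 : axis z.1 by case: (cdisk_bound zd).
  by rewrite (surjective_pairing z) -z0 hg//; exact: gD.
split=> [|z w zh wh|x x1|z /hA]; [exact: cont_on_comp hc kc| |by rewrite /= hg|by exists (h z)].
by move=> /kI/hI; apply=> //; apply/mem_set/hD/set_mem.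
Qed.

Lemma radial_half_chart (g : R -> plane R) : cont_on axis g -> set_inj axis g ->
  (forall x, axis x -> norm2 (g x) = 1) ->
  half_chart (fun z => (1 + z.2) *: g z.1) g [set z | 1 < norm2 z].
Proof.
move=> gc gI g1; have half_axis z : half_disk 1 z -> axis z.1 by move=> [/cdisk_bound[]].
have norm2_radial z : half_disk 1 z -> norm2 ((1 + z.2) *: g z.1) = (1 + z.2) ^+ 2.
  by move=> /half_axis z1; rewrite norm2Z g1// mulr1.
split=> [|z w /set_mem zh /set_mem wh zw|x x1|z [zd z0]].
- apply: cont_onZ; last by apply: cont_on_comp gc; [exact: half_axis|
    apply: cont_on_fst; exact: cont_on_id].
  by apply: cont_onD; [exact: cont_on_cst|apply: cont_on_snd; exact: cont_on_id].
- have z2 := half_disk_ge0 zh; have w2 := half_disk_ge0 wh.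
  have zw2 : z.2 = w.2.
    have := congr1 (@norm2 R) zw; rewrite !norm2_radial// => /eqP.
    by rewrite eqrXn2 ?addr_ge0// => /eqP/addrI.
  apply: eq_plane => //; move: zw; rewrite zw2 => /scalerI zw.
  by apply: gI; [exact/mem_set/half_axis|exact/mem_set/half_axis|apply: zw; rewrite gt_eqF//; lra].
- by rewrite addr0 scale1r.
- rewrite /= norm2_radial; last exact: upper_half_disk (ltW z0).
  by nra.
Qed.

Lemma chart_lens (f : plane R -> plane R) g A B : chart f g A B -> lens f 0 = g @` axis.
Proof.
move=> fC; apply/seteqP; split=> _ [s s1 <-].
  exists (2 * s - 1); first exact: itv01_axis.
  by rewrite /lens_arc mul0r (chart_axis fC)//; exact: itv01_axis.
exists ((1 + s) / 2); first exact: axis_itv01.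
by rewrite /lens_arc mul0r -(chart_axis fC)//; congr (f (_, _)); field.
Qed.

End MappedHalfCharts.

Section Cycles.
Variables (R : realType) (S : topologicalType) (G : embedded_graph R S).
Local Notation adjG := (@adj R S G).
Implicit Types (u v t a : G) (C : {set G}) (x : S).

Definition cycle_set C : set S :=
  [set x | exists u v, [/\ u \in C, v \in C, adj u v & edge u v x]].

Definition half_open_edge u v : set S := earc u v @` [set t | 0 <= t < 1].

Lemma cycle_set_edge C u v : u \in C -> v \in C -> adj u v -> edge u v `<=` cycle_set C.
Proof. by move=> uC vC uv x xe; exists u, v. Qed.

Lemma cycle_set_graph C : cycle_set C `<=` graph_set G.
Proof. by move=> x [u [v [_ _ uv xe]]]; right; exists u, v. Qed.

Lemma cycle_set_interior C u v x : adj u v -> interior_edge u v x -> cycle_set C x ->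
  (u \in C) && (v \in C).
Proof.
move=> uv xi [a [b [aC bC ab xe]]].
by have [[<- <-]|[<- <-]] := interior_edge_disjoint uv ab xi xe; rewrite aC bC.
Qed.

Lemma cycle_set_vertex C a : cycle_set C (vpoint a) -> a \in C.
Proof.
move=> [u [v [uC vC uv [t t01 e]]]].
by have [[_ ->]|[_ ->]] := earc_vpoint uv t01 e.
Qed.

Lemma vertex_cycle_set C a : triangle adjG C -> a \in C -> cycle_set C (vpoint a).
Proof.
move=> tC aC; have [b [c [ab _ _ CE]]] := triangle_vertex tC aC.
have bC : b \in C by rewrite CE !inE eqxx orbT.
exact: (cycle_set_edge aC bC ab (edge_vertex ab).1).
Qed.

Lemma cycle_set_triangle u v t : adj u v -> adj u t -> adj v t ->
  cycle_set [set u; v; t]%SET = edge u v `|` (edge u t `|` edge v t).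
Proof.
move=> uv ut vt; apply/seteqP; split=> x.
  move=> [a [b []]]; rewrite !inE -!orbA => /or3P[]/eqP-> /or3P[]/eqP->;
    by rewrite ?adj_irr// => ab xe; do ?[by left; rewrite // edgeC|right];
      rewrite // edgeC.
by move=> [|[|]]; apply: cycle_set_edge; rewrite // !inE eqxx ?orbT.
Qed.

Lemma cycle_set_compact C : triangle adjG C -> compact (cycle_set C).
Proof.
move=> tC; have [u uC] : exists u, u \in C by apply/card_gt0P; case: tC => ->.
have [v [t [uv ut vt ->]]] := triangle_vertex tC uC; rewrite cycle_set_triangle//.
by apply: compactU; [|apply: compactU]; exact: edge_compact.
Qed.

Lemma half_open_edge_edge u v : half_open_edge u v `<=` edge u v.
Proof. by move=> _ [t /andP[t0 t1] <-]; exists t; rewrite //= in_itv/= t0 ltW. Qed.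

Lemma half_open_edge_connected u v : adj u v -> connected (half_open_edge u v).
Proof.
move=> uv; apply: connected_continuous_connected; last first.
  apply: cont_onS (cont_on_earc uv) => t /andP[t0 t1]; by rewrite itv01E t0 ltW.
apply/connected_intervalP => s t /= /andP[s0 s1] /andP[t0 t1] z /andP[sz zt].
by rewrite (le_trans s0 sz) (le_lt_trans zt t1).
Qed.

Lemma half_open_edge_vertex u v : adj u v -> half_open_edge u v (vpoint u).
Proof. by move=> uv; exists 0; [rewrite /= lexx ltr01|rewrite earc0]. Qed.

Lemma interior_half_open_edge u v : interior_edge u v `<=` half_open_edge u v.
Proof. by move=> _ [t /andP[t0 t1] <-]; exists t; rewrite //= ltW. Qed.

Lemma half_open_edge_notin_cycle C u v x : adj u v -> u \notin C -> half_open_edge u v x ->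
  ~ cycle_set C x.
Proof.
move=> uv uC [t /andP[t0 t1] <-]; have [->|t_neq0] := eqVneq t 0.
  by rewrite earc0// => /cycle_set_vertex; exact/negP.
have t_int : interior_edge u v (earc u v t) by exists t; rewrite //= lt_neqAle eq_sym t_neq0 t0.
by move=> /(cycle_set_interior uv t_int); rewrite (negbTE uC).
Qed.

Lemma edge_notin_cycle C u v x : adj u v -> u \notin C -> v \notin C -> edge u v x ->
  ~ cycle_set C x.
Proof.
move=> uv uC vC /edge_split/(_ uv)[/interior_half_open_edge/(half_open_edge_notin_cycle uv uC)//|].
by move=> [->|->] /cycle_set_vertex; exact/negP.
Qed.

Lemma midpoint_notin_cycle C u v : adj u v -> ~~ ((u \in C) && (v \in C)) ->
  ~ cycle_set C (midpoint u v).
Proof. by move=> uv uvC /(cycle_set_interior uv (midpoint_interior u v)); exact/negP. Qed.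

Lemma edge_meet u v t : adj u t -> adj v t -> u <> v -> edge u t `&` edge v t = [set vpoint t].
Proof.
move=> ut vt uv; apply/seteqP; split=> [x [xu xv]|_ ->]; last first.
  by split; [case: (edge_vertex ut)|case: (edge_vertex vt)].
have [xi|[xE|//]] := edge_split xu ut; last first.
  rewrite xE in xv *; have [s s01 se] := xv.
  have [[_ vu]|[_ ->//]] := earc_vpoint vt s01 se; by case: uv.
have [[vu _]|[tu _]] := interior_edge_disjoint ut vt xi xv; first by case: uv.
by case: (adj_neqG vt).
Qed.

Lemma edge_meet_triangle u v t : adj u v -> adj u t -> adj v t ->
  edge u v `&` (edge u t `|` edge v t) = [set vpoint u; vpoint v].
Proof.
move=> uv ut vt; rewrite setIUr; congr (_ `|` _).
  rewrite (edgeC uv) (edgeC ut); apply: edge_meet; rewrite ?[adj _ u]adj_sym//.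
  exact: adj_neqG.
rewrite (edgeC vt); apply: edge_meet; rewrite ?[adj t _]adj_sym//; exact: adj_neqG.
Qed.

Lemma centred_arc_image u v : centred_arc u v @` @axis R = edge u v.
Proof.
apply/seteqP; split=> [_ [x x1 <-]|_ [t t01 <-]]; first exact: centred_arc_edge.
by exists (2 * t - 1); [exact: itv01_axis|rewrite centred_arc_earc].
Qed.

End Cycles.

(* Otherwise a ray from a point of [K] that avoids [E] would never leave [K]. *)
Lemma compact_finite_frontier (R : realType) (K E : set (plane R)) : compact K -> finite_set E ->
  (forall z, K z -> ~ E z -> nbhs z K) -> K `<=` E.
Proof.
move=> cK /finite_seqP[e eE] nbhsK q Kq; apply: contrapT => Eq.
pose slope (y : plane R) := (y.2 - q.2) / (y.1 - q.1).
pose s := 1 + \sum_(y <- e) `|slope y|.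
have slope_lt y : E y -> slope y < s.
  rewrite eE /= => ye; rewrite /s (le_lt_trans (ler_norm _))// -ltrBlDr.
  rewrite (big_rem y)//= opprD addrA subrr sub0r.
  by rewrite (le_lt_trans _ ltr01)// oppr_le0 sumr_ge0.
pose ray (t : R) : plane R := q + t *: ((1, s) : plane R).
have ray_cont : cont_on setT ray.
  by apply: cont_onD; [exact: cont_on_cst|apply: cont_onZ; [exact: cont_on_id|exact: cont_on_cst]].
have ray0 : ray 0 = q by rewrite /ray scale0r addr0.
have ray_avoids t : ~ E (ray t).
  have [->|t0] := eqVneq t 0; first by rewrite ray0.
  move=> /slope_lt; rewrite /slope /ray/= -[t *: s]/(t * s) -[t *: 1]/(t * 1) mulr1.
  by rewrite [_ + t]addrC addrK [_ + t * s]addrC addrK mulrAC divff// mul1r ltxx.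
have ray_K t : K (ray t).
  apply: (@connected_locally_constant _ setT (K \o ray) _ _ 0) => //=; last by rewrite ray0.
    by apply/connected_intervalP.
  move=> r _; have [Kr|Kr] := pselect (K (ray r)).
    have := cont_on_near ray_cont I (nbhsK _ Kr (@ray_avoids r)).
    by apply: filterS => y /(_ I) Ky _.
  have cl : closed K by apply: compact_closed cK; exact: hausdorff_plane.
  have := cont_on_near ray_cont I (open_nbhs_nbhs (conj (closed_openC cl) Kr)).
  by apply: filterS => y /(_ I) Ky _.
have [b [_ Kb]] := compact_bounded cK.
have b1 : b < b + 1 by rewrite ltrDl.
have := Kb _ b1 _ (ray_K (b + 2 - q.1)); rewrite /= prod_normE ge_max => /andP[+ _].
rewrite ler_norml /ray /= -[_ *: 1]/(_ * 1) => /andP[_]; lra.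
Qed.

Section ClosedCells.
Variables (R : realType) (S : topologicalType) (G : embedded_graph R S) (FT : finType).
Hypotheses (S_hausdorff : hausdorff_space S) (S_disk : locally_disk R S).
Variable M : polygonal_map G FT.
Implicit Types (Y : {set FT}) (i : FT) (p q : side M).

Definition closed_cells Y : set S := \bigcup_(i in [set` Y]) (cell_map M i @` cdisk).

Lemma compact_closed_cells Y : compact (closed_cells Y).
Proof.
rewrite /closed_cells; have -> : [set` Y] = [set` enum Y].
  by apply/seteqP; split=> i; rewrite /= mem_enum.
rewrite bigcup_seq; apply: bigsetU_compact => i _; apply: continuous_compact.
  exact: cell_map_cont.
exact: compact_cdisk.
Qed.

Lemma closed_cells_cell Y i : i \in Y -> cell M i `<=` closed_cells Y.
Proof. by move=> iY x xi; exists i => //; exact: cell_sub_image. Qed.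

Lemma border_free_sides Y u v p q : (forall a b, ~~ border M Y a b) -> edge_sides u v p q ->
  tag p \in Y -> tag q \in Y.
Proof. by move=> Yb pq pY; have := Yb u v; rewrite (borderE _ pq) pY negbK. Qed.

Lemma closed_cells_nbhs Y x : (forall u v, ~~ border M Y u v) -> closed_cells Y x ->
  (forall u : G, x <> vpoint u) -> nbhs x (closed_cells Y).
Proof.
move=> Yb [i iY [z /cdisk_split[oz|cz] <-]] x_vertex.
  apply: (filterS (closed_cells_cell iY)); apply: open_nbhs_nbhs.
  by split; [exact: cell_open|exact: mem_cell].
have [n [t [_ /andP[t0 t1] _ zE]]] := cell_map_circle M i cz; rewrite zE in x_vertex *.
set u := walk M i n in zE x_vertex *; set v := walk M i n.+1 in zE x_vertex *.
have uv : adj u v := walk_adj M i n.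
have {}t0 : 0 < t.
  by rewrite lt_neqAle t0 andbT; apply/eqP => t_eq0; apply: (x_vertex u); rewrite -t_eq0 earc0.
have [p [q pq]] := map_two_sided S_hausdorff S_disk M uv; have [pe qe] := edge_sides_on pq.
have [pY qY] : tag p \in Y /\ tag q \in Y.
  have : on_edge (side_at M i n) u v by rewrite on_edge_side_at.
  move=> /pq.2[/(congr1 tag)/= ip|/(congr1 tag)/= iq].
    by rewrite -ip; split=> //; rewrite ip in iY; exact: border_free_sides pq iY.
  by rewrite -iq; split=> //; rewrite iq in iY; exact: border_free_sides (edge_sides_sym pq) iY.
have [f fC] := edge_cell_chart pe qe pq.1.
apply: (@filterS _ _ _ (f @` odisk)); last first.
  apply: open_nbhs_nbhs; split; first exact: chart_open fC.
  exists (2 * t - 1, 0); first by rewrite odiskE /norm2/= expr0n/= addr0; nra.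
  by rewrite (chart_axis fC) ?centred_arc_earc//; apply: itv01_axis; rewrite itv01E !ltW.
move=> _ [y oy <-]; have [yp|yq|[y1 ->]] := chartP fC (odisk_cdisk oy).
- exact: closed_cells_cell yp.
- exact: closed_cells_cell yq.
- have [e _ <-//] := side_arc pe; exists (tag p) => //; eexists; last by [].
  exact/circle_cdisk/circle_pointP.
Qed.

End ClosedCells.

Section Disk.
Variables (R : realType) (S : topologicalType) (G : embedded_graph R S).
Local Notation adjG := (@adj R S G).
Local Notation symG := (@adj_sym R S G).
Local Notation irrG := (@adj_irr R S G).
Hypotheses (S_hausdorff : hausdorff_space S) (S_disk : locally_disk R S).
Variables (delta : plane R -> S) (C0 : {set G}).
Hypotheses (delta_cont : cont_on cdisk delta) (delta_inj : set_inj cdisk delta).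
Hypotheses (C0_triangle : triangle adjG C0) (delta_circle : delta @` circle = cycle_set C0).
Implicit Types (A B : set S) (x : S) (u v : G).

Let disk := delta @` cdisk.
Let inside := delta @` odisk.

Lemma inside_open : open inside.
Proof.
apply: invariance_of_domain => //; first exact: open_odisk.
  by apply: cont_onS delta_cont; exact: odisk_cdisk.
by apply: sub_in2 delta_inj => z; rewrite !inE; exact: odisk_cdisk.
Qed.

Lemma disk_closed : closed disk.
Proof. by apply: compact_closed => //; apply: continuous_compact => //; exact: compact_cdisk. Qed.

Lemma inside_disk : inside `<=` disk.
Proof. by move=> _ [z oz <-]; exists z => //; exact: odisk_cdisk. Qed.

Lemma disk_split x : disk x -> inside x \/ cycle_set C0 x.
Proof.
by move=> [z /cdisk_split[oz|cz] <-]; [left; exists z|right; rewrite -delta_circle; exists z].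
Qed.

Lemma cycle_disk : cycle_set C0 `<=` disk.
Proof. by rewrite -delta_circle => _ [z cz <-]; exists z => //; exact: circle_cdisk. Qed.

Lemma inside_notin_cycle x : inside x -> ~ cycle_set C0 x.
Proof. by move=> [z oz <-]; rewrite -delta_circle; exact: odisk_image_circle. Qed.

Lemma inside_vertex_notin u : inside (vpoint u) -> u \notin C0.
Proof. by move=> /inside_notin_cycle nu; apply/negP => uC; apply/nu/vertex_cycle_set. Qed.

Lemma connected_disk_dichotomy A : connected A -> (forall x, A x -> ~ cycle_set C0 x) ->
  A `<=` inside \/ forall x, A x -> ~ disk x.
Proof.
move=> cA nA; have [[a Aa Da]|none] := pselect (exists2 a, A a & inside a); last first.
  right=> x Ax /disk_split[xi|]; last exact: nA.
  by apply: none; exists x.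
left=> x Ax; apply: (connected_locally_constant cA _ Aa Ax Da) => y Ay.
have [yi|nyi] := pselect (inside y).
  by apply: filterS (open_nbhs_nbhs (conj inside_open yi)) => z zi _.
have ny : ~ disk y by move=> /disk_split[//|]; exact: nA.
apply: filterS (open_nbhs_nbhs (conj (closed_openC disk_closed) ny)) => z nz _.
by split=> // /inside_disk.
Qed.

Lemma connected_inside A x : connected A -> (forall y, A y -> ~ cycle_set C0 y) -> A x ->
  A `<=` inside <-> inside x.
Proof.
move=> cA nA Ax; have [AD|AD] := connected_disk_dichotomy cA nA.
  by split=> // _; exact: AD.
by split=> [|/inside_disk/AD//]; exact.
Qed.

Lemma boundary_chart (f : plane R -> S) g A B : chart f g A B ->
  (forall r, axis r -> cycle_set C0 (g r)) ->
  connected A -> connected B -> (forall x, A x -> ~ cycle_set C0 x) ->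
  (forall x, B x -> ~ cycle_set C0 x) -> A `<=` inside <-> ~ B `<=` inside.
Proof.
move=> fC gC cA cB nA nB.
have [c cc c0] : (delta @` circle) (g 0) by rewrite delta_circle; apply/gC/axis0.
have f_nbhs := chart_nbhs S_disk fC; rewrite -c0 in f_nbhs.
split=> [AD BD|nBD].
  move: f_nbhs; rewrite nbhsE => -[N [oN Nc] Nf].
  have ND : N `<=` delta @` cdisk.
    move=> y /Nf[z oz <-]; have [zA|zB|[z1 ->]] := chartP fC (odisk_cdisk oz).
    - exact/inside_disk/AD.
    - exact/inside_disk/BD.
    - exact/cycle_disk/gC.
  have oW := invariance_of_domain_inverse S_hausdorff S_disk (@compact_cdisk R)
    delta_cont delta_inj oN ND.
  apply: (circle_not_interior cc (open_nbhs_nbhs (conj oW _))); last by move=> z [].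
  by split=> //; exact: circle_cdisk.
have := cont_on_near delta_cont (circle_cdisk cc) f_nbhs.
move=> /(circle_near_odisk cc)[y oy /(_ (odisk_cdisk oy))[z oz fz]].
have zi : inside (f z) by rewrite fz; exists y.
have [zA|zB|[z1 zg]] := chartP fC (odisk_cdisk oz).
- by rewrite (connected_inside cA nA zA).
- by case: nBD; rewrite (connected_inside cB nB zB).
- by case: (inside_notin_cycle zi); rewrite zg; exact: gC.
Qed.

Lemma edge_in_disk u v : inside (vpoint u) -> adj u v ->
  edge u v `<=` disk /\ interior_edge u v `<=` inside.
Proof.
move=> ui uv; have uC := inside_vertex_notin ui.
have : half_open_edge u v `<=` inside.
  rewrite (connected_inside (half_open_edge_connected uv) _ (half_open_edge_vertex uv))// => x.
  exact: half_open_edge_notin_cycle.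
move=> /(subset_trans (@interior_half_open_edge _ _ _ u v)) int; split=> // x.
move=> /edge_split/(_ uv)[/int/inside_disk//|[->|->]]; first exact: inside_disk.
apply: contrapT => nv; have vu : adj v u by rewrite adj_sym.
have : nbhs (earc v u 0) (~` disk).
  by rewrite earc0//; apply: open_nbhs_nbhs; split=> //; exact/closed_openC/disk_closed.
move=> /(path_near0 (cont_on_earc vu))[t /andP[t0 t1]]; apply.
rewrite earcC//; last by rewrite itv01E !ltW.
by apply/inside_disk/int; exists (1 - t) => //=; apply/andP; split; lra.
Qed.

Variables (FT : finType) (M : polygonal_map G FT).
Implicit Types (i : FT) (p q r : side M).

Lemma cell_notin_cycle C i x : cell M i x -> ~ @cycle_set R S G C x.
Proof. by move=> xi /cycle_set_graph; exact: cell_notin_graph xi. Qed.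

Lemma cell_boundary_connected i c : circle c -> connected (cell M i `|` [set cell_map M i c]).
Proof.
move=> cc; have -> : cell M i `|` [set cell_map M i c] = cell_map M i @` (odisk `|` [set c]).
  by rewrite image_setU image_set1 (param_image (cell_mapP M i)).
apply: connected_continuous_connected; last first.
  by apply: cont_onS (@cell_map_cont _ _ _ _ M i) => z [|->];
    [exact: odisk_cdisk|exact: circle_cdisk].
apply: star_shaped_connected => t z t01 [oz|->]; first by left; exact: star_shaped_odisk.
have [->|t1] := eqVneq t 1; first by right; rewrite scale1r.
left; move: t01; rewrite itv01E odiskE norm2Z (cc : norm2 c = 1) => /andP[t0 t_le1].
have : t < 1 by rewrite lt_neqAle t1.
nra.
Qed.

Lemma cell_map_disk i z : cell M i `<=` inside -> cdisk z -> disk (cell_map M i z).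
Proof.
move=> iD /cdisk_split[oz|cz]; first exact/inside_disk/iD/mem_cell.
apply: contrapT => nz.
have := cont_on_near (@cell_map_cont _ _ _ _ M i) (circle_cdisk cz)
  (open_nbhs_nbhs (conj (closed_openC disk_closed) nz)).
move=> /(circle_near_odisk cz)[y oy /(_ (odisk_cdisk oy))]; apply.
exact/inside_disk/iD/mem_cell.
Qed.

Lemma cell_map_inside i c : circle c -> ~ cycle_set C0 (cell_map M i c) ->
  cell M i `<=` inside <-> inside (cell_map M i c).
Proof.
move=> cc nc; rewrite -(connected_inside (@cell_boundary_connected i c cc)).
- split=> [iD x [/iD//|->]|iD x ix]; last by apply: iD; left.
  have [//|/nc//] := disk_split (cell_map_disk iD (circle_cdisk cc)).
- by move=> x [/cell_notin_cycle|->].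
- by right.
Qed.

Lemma side_inside p u v : on_edge p u v -> ~~ ((u \in C0) && (v \in C0)) ->
  cell M (tag p) `<=` inside <-> inside (midpoint u v).
Proof.
move=> pe uvC; have uv := side_adj pe; rewrite -(side_midpoint pe).
apply: cell_map_inside; first exact: circle_pointP.
by rewrite (side_midpoint pe); exact: midpoint_notin_cycle.
Qed.

Lemma boundary_side_inside p q u v : edge_sides u v p q -> u \in C0 -> v \in C0 ->
  cell M (tag p) `<=` inside <-> ~ cell M (tag q) `<=` inside.
Proof.
move=> pq uC vC; have [pe qe] := edge_sides_on pq; have uv := side_adj pe.
have [f fC] := edge_cell_chart pe qe pq.1.
apply: (boundary_chart fC); [|exact: cell_connected|exact: cell_connected| |].
- by move=> x x1; apply: (cycle_set_edge uC vC uv); exact: centred_arc_edge.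
- by move=> x; exact: cell_notin_cycle.
- by move=> x; exact: cell_notin_cycle.
Qed.

Lemma cell_map_vertex i n :
  cell_map M i (circle_point (n%:R / (degree M i)%:R)) = vpoint (walk M i n).
Proof.
by rewrite -(addr0 n%:R) cell_map_side ?earc0//; [exact: walk_adj|exact: itv01_0].
Qed.

Definition disk_faces : {set FT} := [set i | `[< cell M i `<=` inside >]]%SET.

Definition disk_vertices : {set G} := [set u | `[< inside (vpoint u) >]]%SET.

Lemma disk_facesP i : reflect (cell M i `<=` inside) (i \in disk_faces).
Proof. by rewrite inE; exact: asboolP. Qed.

Lemma disk_verticesP u : reflect (inside (vpoint u)) (u \in disk_vertices).
Proof. by rewrite inE; exact: asboolP. Qed.

Lemma mem_disk_vertices u : disk (vpoint u) -> u \in (disk_vertices :|: C0)%SET.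
Proof.
by rewrite inE => /disk_split[/disk_verticesP->//|/cycle_set_vertex->]; rewrite orbT.
Qed.

Lemma disk_faces_border u v : adj u v ->
  border M disk_faces u v = (u \in C0) && (v \in C0).
Proof.
move=> uv; have [p [q pq]] := map_two_sided S_hausdorff S_disk M uv.
have [pe qe] := edge_sides_on pq; rewrite (borderE _ pq).
have [/andP[uC vC]|uvC] := boolP ((u \in C0) && (v \in C0)).
  have := boundary_side_inside pq uC vC.
  by case: disk_facesP => pD; case: disk_facesP => qD // [pq_in qp_in];
    [case: (pq_in pD)|case: pD; exact: qp_in].
rewrite -[X in _ (+) X](_ : (tag p \in disk_faces) = _) ?addbb//.
by apply/disk_facesP/disk_facesP; rewrite (side_inside pe uvC) (side_inside qe uvC).
Qed.

Lemma disk_region : region M C0 disk_faces disk_vertices.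
Proof.
split=> //; first exact: disk_faces_border.
- move=> u v /disk_verticesP ui uv; apply: mem_disk_vertices.
  by have [eD _] := edge_in_disk ui uv; apply: eD; case: (edge_vertex uv).
- move=> u v p /disk_verticesP ui pe; apply/disk_facesP.
  rewrite (side_inside pe); last by rewrite (negbTE (inside_vertex_notin ui)).
  have [_ iD] := edge_in_disk ui (side_adj pe); exact/iD/midpoint_interior.
- move=> i /disk_facesP iD; apply/fintype.subsetP => u /(@face_vertices_walk _ _ _ M)[n <-].
  apply: mem_disk_vertices; rewrite -cell_map_vertex; apply: cell_map_disk => //.
  exact/circle_cdisk/circle_pointP.
Qed.

Variable del : S -> plane R.
Hypotheses (delK : forall z, cdisk z -> del (delta z) = z) (del_cont : cont_on disk del).

Lemma deltaK x : disk x -> delta (del x) = x /\ cdisk (del x).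
Proof. by move=> [z zd <-]; rewrite delK. Qed.

Lemma del_inj : set_inj disk del.
Proof.
move=> x y /set_mem/deltaK[xE _] /set_mem/deltaK[yE _] xy.
by rewrite -xE -yE xy.
Qed.

Lemma norm2_del x : cycle_set C0 x -> norm2 (del x) = 1.
Proof. by rewrite -delta_circle => -[c cc <-]; rewrite delK//; exact: circle_cdisk. Qed.

Lemma arclike_edge u v : adj u v -> edge u v `<=` disk -> arclike (del @` edge u v).
Proof.
move=> uv uvD; have earcD t : itv01 t -> disk (earc u v t) by move=> t01; apply: uvD; exists t.
rewrite /edge image_comp; apply: arclike_path.
  exact: cont_on_comp earcD (cont_on_earc uv) del_cont.
move=> s t /set_mem s01 /set_mem t01 /del_inj st.
by apply: (earc_inj uv); rewrite ?in_itv/= -?itv01E//; apply: st; apply/mem_set/earcD.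
Qed.

Section Parity.
Variable C : {set G}.
Hypotheses (C_triangle : triangle adjG C) (C_disk : cycle_set C `<=` disk).

Let flat_cycle : set (plane R) := del @` cycle_set C.
Let even_at x := even_around flat_cycle (del x).

Lemma compact_flat_cycle : compact flat_cycle.
Proof.
apply: continuous_compact; last exact: cycle_set_compact.
exact: cont_onS del_cont.
Qed.

Lemma flat_cycle_cdisk : flat_cycle `<=` cdisk.
Proof. by move=> _ [x /C_disk/deltaK[_ xd] <-]. Qed.

Lemma flat_cycle_preimage x : disk x -> flat_cycle (del x) -> cycle_set C x.
Proof. by move=> xD [y yC /del_inj <-] //; apply/mem_set => //; exact: C_disk. Qed.

Lemma even_at_connected A x y : connected A -> A `<=` disk ->
  (forall z, A z -> ~ cycle_set C z) -> A x -> A y -> even_at x <-> even_at y.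
Proof.
move=> cA AD nA Ax Ay.
have cdA : connected (del @` A).
  by apply: connected_continuous_connected cA _; exact: cont_onS del_cont.
have nK z : (del @` A) z -> ~ flat_cycle z.
  by move=> [a Aa <-] /(flat_cycle_preimage (AD _ Aa)); exact: nA.
by split; apply: (even_around_connected compact_flat_cycle cdA nK); (by exists x) || (by exists y).
Qed.

Lemma even_at_boundary x : cycle_set C0 x -> ~ cycle_set C x -> even_at x.
Proof.
move=> x0 nx; apply: even_around_outside; [exact: compact_flat_cycle|exact: flat_cycle_cdisk| |].
  by move=> /(flat_cycle_preimage (cycle_disk x0)).
by rewrite norm2_del.
Qed.

Lemma odd_inside x : disk x -> ~ cycle_set C x -> ~ even_at x -> inside x.
Proof. by move=> /disk_split[//|x0] nx []; exact: even_at_boundary. Qed.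

Lemma flat_arcs_meet u v t (f : plane R -> plane R) (A B : set (plane R)) :
  adj u v -> adj u t -> adj v t -> C = [set u; v; t]%SET -> chart f (del \o centred_arc u v) A B ->
  (forall z, A z -> ~ flat_cycle z) -> (forall z, B z -> ~ flat_cycle z) ->
  del @` (edge u t `|` edge v t) `&` f @` cdisk = del @` [set vpoint u; vpoint v].
Proof.
move=> uv ut vt CE fC A_off B_off.
have C_edges := cycle_set_triangle uv ut vt; rewrite -CE in C_edges.
have uvD : edge u v `<=` disk by apply: subset_trans C_disk; rewrite C_edges => x; left.
have tD : edge u t `|` edge v t `<=` disk.
  by apply: subset_trans C_disk; rewrite C_edges => x; right.
rewrite -(edge_meet_triangle uv ut vt) -(set_inj_imageI del_inj uvD tD).
apply/seteqP; split=> x.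
  move=> [tx [z zd xE]]; split=> //.
  have fz_cycle : flat_cycle (f z).
    by rewrite xE; case: tx => y yt <-; exists y => //; rewrite C_edges; right.
  have [/A_off//|/B_off//|[z1 zE]] := chartP fC zd.
  by rewrite -xE zE; exists (centred_arc u v z.1) => //; exact: centred_arc_edge.
move=> [[y]]; rewrite -centred_arc_image => -[r r1 <-] <- tx; split=> //.
by exists (r, 0); [exact/cdisk_real|rewrite (chart_axis fC)].
Qed.

Lemma arclike_two_edges u v t : adj u t -> adj v t -> u <> v -> edge u t `|` edge v t `<=` disk ->
  arclike (del @` (edge u t `|` edge v t)).
Proof.
move=> ut vt uv tD; have [utD vtD] : edge u t `<=` disk /\ edge v t `<=` disk.
  by split; apply: subset_trans tD => x; [left|right].
rewrite image_setU; apply: (@arclikeU _ _ _ (del (vpoint t))).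
- exact: arclike_edge.
- exact: arclike_edge.
- by rewrite (set_inj_imageI del_inj)// edge_meet ?image_set1.
Qed.

Lemma parity_across_edge u v h1 h2 (A B : set (plane R)) : adj u v -> u \in C -> v \in C ->
  half_chart h1 (del \o centred_arc u v) A -> half_chart h2 (del \o centred_arc u v) B ->
  (forall z, A z -> ~ B z) -> (forall z, A z -> ~ flat_cycle z) ->
  (forall z, B z -> ~ flat_cycle z) ->
  exists a b, [/\ A a, B b & even_around flat_cycle a <-> ~ even_around flat_cycle b].
Proof.
move=> uv uC vC hA hB AB A_off B_off.
have [t [ut vt CE]] := triangle_edge symG C_triangle uC vC (adj_neq irrG uv).
have C_edges := cycle_set_triangle uv ut vt; rewrite -CE in C_edges.
have [f [fC _]] := glue_half_charts hA hB AB.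
have meet := flat_arcs_meet uv ut vt CE fC A_off B_off.
have arcs := arclike_two_edges ut vt (adj_neqG uv) _.
have {}arcs : arclike (del @` (edge u t `|` edge v t)).
  by apply: arcs; apply: subset_trans C_disk; rewrite C_edges => x; right.
have flat_cycleE : flat_cycle = lens f 0 `|` del @` (edge u t `|` edge v t).
  by rewrite (chart_lens fC) -image_comp centred_arc_image -image_setU -C_edges.
have ends : del @` [set vpoint u; vpoint v] = [set f (-1, 0); f (1, 0)].
  by rewrite image_setU !image_set1 !(chart_axis fC)/= ?centred_arcN1 ?centred_arc1//;
    apply/andP; split; lra.
rewrite ends in meet.
pose y : plane R := (0, 1 / 2); pose z : plane R := (0, - (1 / 2)).
have [oy oz] : odisk y /\ odisk z by rewrite !odiskE /norm2/= expr0n/=; split; lra.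
have [y2 z2] : 0 < y.2 /\ z.2 < 0 by rewrite /=; lra.
exists (f y), (f z); split.
- exact: chart_upper fC _ (odisk_cdisk oy) y2.
- exact: chart_lower fC _ (odisk_cdisk oz) z2.
- rewrite flat_cycleE; exact: (parity_jump (chart_cont fC) (chart_inj fC) arcs meet oy oz y2 z2).
Qed.

Definition odd_faces : {set FT} :=
  [set i | `[< cell M i `<=` inside /\ forall x, cell M i x -> ~ even_at x >]]%SET.

Definition odd_vertices : {set G} :=
  [set u | [&& u \notin C, `[< inside (vpoint u) >] & `[< ~ even_at (vpoint u) >]]]%SET.

Lemma odd_face_inside i : i \in odd_faces -> cell M i `<=` inside.
Proof. by rewrite inE => /asboolP[]. Qed.

Lemma odd_face_point i A x y : connected A -> A `<=` disk -> (forall z, A z -> ~ cycle_set C z) ->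
  cell M i `<=` A -> cell M i x -> A y -> cell M i `<=` inside -> i \in odd_faces <-> ~ even_at y.
Proof.
move=> cA AD nA iA ix Ay iD.
have evenE z w : A z -> A w -> even_at z <-> even_at w by exact: even_at_connected.
split; first by rewrite inE (evenE y x)//; [move=> /asboolP[_]; exact|exact: iA].
by move=> ny; rewrite inE; apply/asboolP; split=> // z /iA zA; rewrite (evenE z y).
Qed.

Lemma odd_face_cell i x : cell M i `<=` inside -> cell M i x -> i \in odd_faces <-> ~ even_at x.
Proof.
move=> iD ix; apply: (@odd_face_point i (cell M i) x) => //; first exact: cell_connected.
  by move=> y /iD/inside_disk.
by move=> y; exact: cell_notin_cycle.
Qed.

Lemma odd_face_boundary i c : circle c -> cell M i `<=` inside -> ~ cycle_set C (cell_map M i c) ->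
  i \in odd_faces <-> ~ even_at (cell_map M i c).
Proof.
move=> cc iD nc; have := mem_cell M i (@odisk0 R) => i0.
apply: (@odd_face_point i (cell M i `|` [set cell_map M i c]) _ _ _ _ _ _ i0) => //; last by right.
- exact: cell_boundary_connected.
- by move=> x [/iD/inside_disk//|->]; apply: cell_map_disk => //; exact: circle_cdisk.
- by move=> x [/cell_notin_cycle|->].
Qed.

Lemma odd_face_side p u v : on_edge p u v -> ~~ ((u \in C) && (v \in C)) ->
  cell M (tag p) `<=` inside -> tag p \in odd_faces <-> ~ even_at (midpoint u v).
Proof.
move=> pe uvC pD; rewrite -(side_midpoint pe); apply: odd_face_boundary => //.
  exact: circle_pointP.
by rewrite (side_midpoint pe); exact: midpoint_notin_cycle (side_adj pe) uvC.
Qed.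

Lemma mem_odd_vertices u : disk (vpoint u) -> (u \notin C -> ~ even_at (vpoint u)) ->
  u \in (odd_vertices :|: C)%SET.
Proof.
move=> uD odd_u; rewrite !inE orbC; have [//|uC /=] := boolP (u \in C).
have nu : ~ cycle_set C (vpoint u) by move=> /cycle_set_vertex; exact/negP.
by apply/andP; split; apply/asboolP; [apply: odd_inside; auto|auto].
Qed.

Lemma flat_side_half_chart p u v : on_edge p u v -> u \in C -> v \in C ->
  cell M (tag p) `<=` inside ->
  exists h, half_chart h (del \o centred_arc u v) (del @` side_strip p).
Proof.
move=> pe uC vC pD; have stripD : side_strip p `<=` disk.
  by move=> x xp; exact/inside_disk/pD/side_strip_cell.
have arcD (t : R) : axis t -> disk (centred_arc u v t).
  move=> t1; apply: C_disk; apply: (cycle_set_edge uC vC (side_adj pe)).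
  exact: centred_arc_edge.
have [e _ hC] := side_half_chart pe; eexists.
exact: (half_chart_comp del_cont del_inj hC stripD arcD).
Qed.

Lemma flat_cell_notin_cycle i z : cell M i `<=` inside -> (del @` cell M i) z -> ~ flat_cycle z.
Proof.
by move=> iD [x ix <-] /(flat_cycle_preimage (inside_disk (iD x ix))); exact: cell_notin_cycle ix.
Qed.

Lemma odd_faces_inside_edge p q u v : edge_sides u v p q -> u \in C -> v \in C ->
  cell M (tag p) `<=` inside -> cell M (tag q) `<=` inside ->
  (tag p \in odd_faces) (+) (tag q \in odd_faces).
Proof.
move=> pq uC vC pD qD; have [pe qe] := edge_sides_on pq.
have strip_disk r : cell M (tag r) `<=` inside -> side_strip r `<=` disk.
  by move=> rD x xr; exact/inside_disk/rD/side_strip_cell.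
have strip_cycle r z : cell M (tag r) `<=` inside -> (del @` side_strip r) z -> ~ flat_cycle z.
  by move=> rD [x /side_strip_cell xr <-]; apply: (flat_cell_notin_cycle rD); exists x.
have [h hp] := flat_side_half_chart pe uC vC pD; have [k kq] := flat_side_half_chart qe uC vC qD.
have [| | |_ [_ [[a ap <-] [b bq <-] ab]]] := parity_across_edge (side_adj pe) uC vC hp kq.
- move=> _ [x xp <-] [y yq /del_inj]; rewrite !inE => yx.
  by apply: (side_strip_disjoint pq.1 xp); rewrite -yx//;
    [exact: strip_disk yq|exact: strip_disk xp].
- by move=> z; exact: strip_cycle.
- by move=> z; exact: strip_cycle.
have pP := odd_face_cell pD (side_strip_cell ap).
have qP := odd_face_cell qD (side_strip_cell bq).
apply/addbP; apply/idP/idP => [/negP p_even|q_odd].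
  by apply/qP => b_even; apply/p_even/pP => /ab.
by apply/negP => /pP; apply; apply/ab/qP.
Qed.

Lemma odd_face_boundary_edge p u v : on_edge p u v -> u \in C -> v \in C ->
  u \in C0 -> v \in C0 -> cell M (tag p) `<=` inside -> tag p \in odd_faces.
Proof.
move=> pe uC vC uC0 vC0 pD; have uv := side_adj pe.
have arc_cycle (x : R) : axis x -> cycle_set C0 (centred_arc u v x).
  by move=> x1; apply: (cycle_set_edge uC0 vC0 uv); exact: centred_arc_edge.
have arc_disk (x : R) : axis x -> disk (centred_arc u v x) by move=> /arc_cycle/cycle_disk.
have flat_arc_cont : cont_on axis (del \o centred_arc u v).
  exact: cont_on_comp arc_disk (cont_on_centred_arc uv) del_cont.
have flat_arc_inj : set_inj axis (del \o centred_arc u v).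
  move=> x y /set_mem x1 /set_mem y1 /del_inj xy.
  apply: (centred_arc_inj uv (mem_set x1) (mem_set y1)); apply: xy; exact/mem_set/arc_disk.
have [h hp] := flat_side_half_chart pe uC vC pD.
have outer := radial_half_chart flat_arc_cont flat_arc_inj
  (fun t t1 => norm2_del (arc_cycle t t1)).
have [| | |_ [b [[a ap <-] b1 ab]]] := parity_across_edge uv uC vC hp outer.
- move=> _ [x /side_strip_cell xp <-]; have [_ xd] := deltaK (inside_disk (pD _ xp)).
  by rewrite /= ltNge [_ <= 1]xd.
- by move=> _ [x /side_strip_cell xp <-]; apply: (flat_cell_notin_cycle pD); exists x.
- by move=> z /= z1 /flat_cycle_cdisk; rewrite cdiskE leNgt z1.
apply/(odd_face_cell pD (side_strip_cell ap)) => /ab; apply.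
apply: even_around_outside; [exact: compact_flat_cycle|exact: flat_cycle_cdisk| |exact: ltW].
by move=> /flat_cycle_cdisk; rewrite cdiskE leNgt b1.
Qed.

Lemma odd_faces_border u v : adj u v -> border M odd_faces u v = (u \in C) && (v \in C).
Proof.
move=> uv; have [p [q pq]] := map_two_sided S_hausdorff S_disk M uv.
have [pe qe] := edge_sides_on pq; rewrite (borderE _ pq).
have outside r : ~ cell M (tag r) `<=` inside -> (tag r \in odd_faces) = false.
  by move=> rD; apply/negP => /odd_face_inside.
have [/andP[uC0 vC0]|uvC0] := boolP ((u \in C0) && (v \in C0)).
  have one_side r : on_edge r u v -> cell M (tag r) `<=` inside ->
      (tag r \in odd_faces) = (u \in C) && (v \in C).
    move=> re rD; have [/andP[uC vC]|uvC] := boolP ((u \in C) && (v \in C)).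
      exact: odd_face_boundary_edge re uC vC uC0 vC0 rD.
    apply/negP => /(odd_face_side re uvC rD); apply; apply: even_at_boundary.
      exact: cycle_set_edge uC0 vC0 uv _ (midpoint_edge u v).
    exact: midpoint_notin_cycle.
  have pqD := boundary_side_inside pq uC0 vC0.
  have [pD|pD] := pselect (cell M (tag p) `<=` inside).
    by rewrite (one_side _ pe pD) (outside _ (pqD.1 pD)) addbF.
  rewrite (outside _ pD) (one_side _ qe)//.
  by apply: contrapT => qD; apply: pD; exact/pqD.
have sidesD := side_inside _ uvC0.
have [m_in|m_out] := pselect (inside (midpoint u v)); last first.
  rewrite !outside ?sidesD//; apply/esym/negbTE/negP => /andP[uC vC]; apply: m_out.
  have /C_disk/disk_split[//|] := cycle_set_edge uC vC uv (midpoint_edge u v).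
  by move/(midpoint_notin_cycle uv uvC0).
have [pD qD] : cell M (tag p) `<=` inside /\ cell M (tag q) `<=` inside by rewrite !sidesD.
have [/andP[uC vC]|uvC] := boolP ((u \in C) && (v \in C)).
  exact: odd_faces_inside_edge pq uC vC pD qD.
suff -> : (tag p \in odd_faces) = (tag q \in odd_faces) by rewrite addbb.
apply/idP/idP => [/(odd_face_side pe uvC pD)|/(odd_face_side qe uvC qD)] m_odd.
  exact/(odd_face_side qe uvC qD).
exact/(odd_face_side pe uvC pD).
Qed.

Lemma odd_vertexP u : reflect [/\ u \notin C, inside (vpoint u) & ~ even_at (vpoint u)]
  (u \in odd_vertices).
Proof.
rewrite inE; apply: (iffP and3P) => [[uC /asboolP uD /asboolP nu]|[uC uD nu]] //.
by split=> //; exact/asboolP.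
Qed.

Lemma odd_vertex_neighbour u v : u \in odd_vertices -> adj u v -> v \in (odd_vertices :|: C)%SET.
Proof.
move=> /odd_vertexP[uC uD nu] uv; have [eD _] := edge_in_disk uD uv.
have [eu ev] := edge_vertex uv; apply: mem_odd_vertices => [|vC]; first exact: eD.
rewrite -(even_at_connected (edge_connected uv) eD _ eu ev)// => x.
exact: edge_notin_cycle.
Qed.

Lemma odd_vertex_side u v p : u \in odd_vertices -> on_edge p u v -> tag p \in odd_faces.
Proof.
move=> /odd_vertexP[uC uD nu] pe; have uv := side_adj pe; have [eD iD] := edge_in_disk uD uv.
have pD : cell M (tag p) `<=` inside.
  by rewrite (side_inside pe) ?(negbTE (inside_vertex_notin uD))//; exact/iD/midpoint_interior.
apply/(odd_face_side pe _ pD); first by rewrite (negbTE uC).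
rewrite -(even_at_connected (half_open_edge_connected uv) _ _ (half_open_edge_vertex uv))//.
- by move=> x /half_open_edge_edge/eD.
- by move=> x; exact: half_open_edge_notin_cycle.
- exact/interior_half_open_edge/midpoint_interior.
Qed.

Lemma odd_face_vertices i : i \in odd_faces -> face_vertices M i \subset (odd_vertices :|: C)%SET.
Proof.
move=> i_odd; have iD := odd_face_inside i_odd.
apply/fintype.subsetP => u /(@face_vertices_walk _ _ _ M)[n <-]; rewrite -/(walk M i n.+1).
have cc := circle_pointP (n.+1%:R / (degree M i)%:R : R).
apply: mem_odd_vertices => [|wC]; rewrite -cell_map_vertex.
  by apply: cell_map_disk => //; exact: circle_cdisk.
apply/odd_face_boundary => //; rewrite cell_map_vertex => /cycle_set_vertex; exact/negP.
Qed.

Lemma odd_region : region M C odd_faces odd_vertices.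
Proof.
split=> //; [exact: odd_faces_border|exact: odd_vertex_neighbour| |exact: odd_face_vertices].
by move=> u v p; exact: odd_vertex_side.
Qed.

End Parity.

Lemma disk_faces_acyclic : acyclic M disk_faces.
Proof.
move=> Y YD Yb; apply/eqP/negPn/negP => /set0Pn[i iY].
have YD' : closed_cells M Y `<=` disk.
  move=> _ [k kY [z zd <-]]; apply: cell_map_disk => //.
  by apply/disk_facesP; exact: (fintype.subsetP YD).
have flat_compact : compact (del @` closed_cells M Y).
  apply: continuous_compact; last exact: compact_closed_cells.
  exact: cont_onS del_cont.
pose vertices := range (@vpoint R S G) `&` disk.
have vertices_finite : finite_set (del @` vertices).
  by apply/finite_image/finite_setIl/finite_image; exact: finite_finset.
have flat_nbhs z : (del @` closed_cells M Y) z -> ~ (del @` vertices) z ->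
    nbhs z (del @` closed_cells M Y).
  move=> [x xY <-] nx; have [xE xd] := deltaK (YD' _ xY).
  have : nbhs x (closed_cells M Y).
    by apply: closed_cells_nbhs => // u xu; apply: nx; exists x => //; split; [exists u|exact: YD'].
  rewrite nbhsE => -[N [oN Nx] NY].
  have oW := invariance_of_domain_inverse S_hausdorff S_disk (@compact_cdisk R)
    delta_cont delta_inj oN (subset_trans NY YD').
  apply: (@filterS _ _ _ (cdisk `&` delta @^-1` N)) => [y [yd Ny]|].
    by exists (delta y); [exact: NY|exact: delK].
  by apply: open_nbhs_nbhs; split=> //; split; rewrite //= xE.
have i0 := mem_cell M i (@odisk0 R).
have := compact_finite_frontier flat_compact vertices_finite flat_nbhs.
have i0Y := closed_cells_cell iY i0; move=> /(_ _ (imageP del i0Y)).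
move=> [_ [[u _ <-] uD] /del_inj]; rewrite !inE => u0.
by apply: (cell_notin_graph i0); left; exists u => //; apply: u0 => //; exact: YD'.
Qed.

Lemma triangle_in_disk C u : triangle adjG C -> u \in C -> inside (vpoint u) ->
  cycle_set C `<=` disk.
Proof.
move=> tC uC ui; have [v [t [uv ut vt ->]]] := triangle_vertex tC uC.
have [uvD _] := edge_in_disk ui uv; have [utD _] := edge_in_disk ui ut.
rewrite cycle_set_triangle// => x [/uvD//|[/utD//|]].
have [_ ev] := edge_vertex uv; have [_ et] := edge_vertex ut.
have [vi|v0] := disk_split (uvD _ ev); first by have [vtD _] := edge_in_disk vi vt; exact: vtD.
have [ti|t0] := disk_split (utD _ et).
  by rewrite edgeC// => xe; have [tvD _] := edge_in_disk ti (adjG_sym vt); exact: tvD.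
move=> xe; apply: cycle_disk.
exact: cycle_set_edge (cycle_set_vertex v0) (cycle_set_vertex t0) vt _ xe.
Qed.

Lemma disk_facial : (forall u : G, exists v, adj u v) ->
  (forall u v : G, adj u v -> ~ contractible_edge M u v) -> facial M C0.
Proof.
move=> nbr ncontr; have two := map_two_sided S_hausdorff S_disk M.
apply: (empty_region_facial symG irrG two (X := disk_faces)).
rewrite -(@acyclic_region_interior _ _ symG irrG _ M two _ _ _
  (map_closed_corners S_disk (M := M)) disk_faces_acyclic disk_region _ nbr ncontr).
  exact: disk_region.
move=> u C /disk_verticesP ui tC uC; have CD := triangle_in_disk tC uC ui.
exists (odd_faces C), (odd_vertices C); split; first exact: odd_region.
  by apply/fintype.subsetP => i /odd_face_inside/disk_facesP.
by apply/fintype.subsetP => v /odd_vertexP[_ vi _]; exact/disk_verticesP.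
Qed.

End Disk.

Lemma bounds_disk_facial (R : realType) (S : topologicalType) (G : embedded_graph R S)
    (FT : finType) (M : polygonal_map G FT) (C : {set G}) :
  hausdorff_space S -> locally_disk R S -> (forall u : G, exists v, adj u v) ->
  (forall u v : G, adj u v -> ~ contractible_edge M u v) ->
  triangle (@adj R S G) C -> bounds_disk R (cycle_set C) -> facial M C.
Proof.
move=> hS lS nbr ncontr tC [delta [delta_cont delta_inj deltaC]].
have [del delK del_cont] :=
  compact_inverse (0 : plane R) hS (@compact_cdisk R) delta_cont delta_inj.
exact: (disk_facial hS lS delta_cont delta_inj tC deltaC delK del_cont nbr ncontr).
Qed.

(** * Spheres glued from two disks *)

Section Cone.
Variables (R : realType) (k : plane R -> plane R).
Hypotheses (k_cont : cont_on circle k) (k_inj : set_inj circle k).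
Hypothesis k_circle : forall c, circle c -> circle (k c).
Implicit Types z c : plane R.

Definition radius z := Num.sqrt (norm2 z).

Definition direction z : plane R := (radius z)^-1 *: z.

(* At the origin the direction is the junk value 0, but the radius vanishes there. *)
Definition cone z : plane R := radius z *: k (direction z).

Lemma sqr_radius z : radius z ^+ 2 = norm2 z.
Proof. by rewrite sqr_sqrtr// norm2_ge0. Qed.

Lemma radius_gt0 z : z <> 0 -> 0 < radius z.
Proof. by rewrite sqrtr_gt0; exact: norm2_gt0. Qed.

Lemma circle_direction z : z <> 0 -> circle (direction z).
Proof.
by move=> /radius_gt0 z0; rewrite circleE norm2Z -sqr_radius -exprMn mulVf ?gt_eqF// expr1n.
Qed.

Lemma radius_direction z : z <> 0 -> radius z *: direction z = z.
Proof. by move=> /radius_gt0 z0; rewrite scalerA divff ?gt_eqF// scale1r. Qed.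

Lemma radius0 : radius 0 = 0.
Proof. by rewrite /radius norm2_0 sqrtr0. Qed.

Lemma cone0 : cone 0 = 0.
Proof. by rewrite /cone radius0 scale0r. Qed.

Lemma norm2_cone z : norm2 (cone z) = norm2 z.
Proof.
have [->|z0] := pselect (z = 0); first by rewrite cone0.
by rewrite norm2Z sqr_radius (k_circle (circle_direction z0) : norm2 _ = 1) mulr1.
Qed.

Lemma cone_circle c : circle c -> cone c = k c.
Proof.
by move=> cc; rewrite /cone /direction /radius (cc : norm2 c = 1) sqrtr1 invr1 !scale1r.
Qed.

Lemma cone_inj : injective cone.
Proof.
move=> z w zw; have radiusE : radius z = radius w by rewrite /radius -norm2_cone zw norm2_cone.
have [z0|z0] := pselect (z = 0).
  by rewrite z0 radius0 in radiusE *; apply/esym/norm2_eq0; rewrite -sqr_radius -radiusE expr0n.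
have w0 : w <> 0 by move=> w0; have := radius_gt0 z0; rewrite radiusE w0 radius0 ltxx.
rewrite -(radius_direction z0) -(radius_direction w0) radiusE; congr (_ *: _).
apply: k_inj; rewrite ?inE; [exact: circle_direction|exact: circle_direction|].
by apply: (scalerI (lt0r_neq0 (radius_gt0 w0))); rewrite -{1}radiusE.
Qed.

Lemma cone_surj : (forall c, circle c -> exists2 c', circle c' & k c' = c) ->
  forall w, exists z, cone z = w.
Proof.
move=> k_surj w; have [->|w0] := pselect (w = 0); first by exists 0; exact: cone0.
have [c cc kc] := k_surj _ (circle_direction w0); exists (radius w *: c).
have radiusE : radius (radius w *: c) = radius w.
  by rewrite {1}/radius norm2Z sqr_radius (cc : norm2 c = 1) mulr1.
rewrite /cone /direction radiusE scalerA mulVf ?gt_eqF ?radius_gt0// scale1r kc.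
exact: radius_direction.
Qed.

Lemma cont_on_radius (D : set (plane R)) : cont_on D radius.
Proof. by apply: cont_on_sqrt; apply: cont_on_norm2; exact: cont_on_id. Qed.

Lemma cont_on_cone : cont_on setT cone.
Proof.
have cone_away : cont_on [set z : plane R | z <> 0] cone.
  apply: cont_onZ; first exact: cont_on_radius.
  apply: (@cont_on_comp _ _ _ _ circle direction) => //; first exact: circle_direction.
  apply: cont_onZ; last exact: cont_on_id.
  by apply: cont_onV; [move=> z /radius_gt0 z0; rewrite gt_eqF|exact: cont_on_radius].
apply: near_cont_on => z N _; have [->|z0] := pselect (z = 0).
  rewrite cone0 => /nbhs_ballP[r /= r0 rN].
  have : \forall y \near (0 : plane R), norm2 y < r ^+ 2.
    have := cont_on_near (cont_on_norm2 (@cont_on_id _ setT)) (I : setT (0 : plane R)).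
    move=> /(_ [set t : R | t < r ^+ 2]); rewrite /= norm2_0 => near.
    apply: filterS (near _) => [y /(_ I)//|]; apply: open_nbhs_nbhs; split; first exact: open_lt.
    by rewrite /= exprn_gt0.
  apply: filterS => y yr _; apply: rN.
  move: yr; rewrite -norm2_cone /norm2 => yr.
  split; rewrite /= -ball_normE /ball_/= sub0r normrN -(@ltr_pXn2r _ 2) ?nnegrE ?normr_ge0 ?ltW//
    real_normK ?num_real//; apply: le_lt_trans yr; by rewrite ?lerDl ?lerDr sqr_ge0.
have open_away : nbhs z [set z : plane R | z <> 0].
  apply: open_nbhs_nbhs; split=> //.
  by apply: closed_openC; apply: compact_closed; [exact: hausdorff_plane|exact: compact_set1].
move=> /(cont_on_near cone_away z0); apply: filterS2 open_away => y y0 /(_ y0) Ny _.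
exact: Ny.
Qed.

End Cone.

Section GluedDisks.
Variable R : realType.
Implicit Types (p q : plane R * R) (z : plane R).
Local Notation sphere_set := (@unit_sphere R).

Lemma unit_sphereE p : sphere_set p = (norm2 p.1 + p.2 ^+ 2 = 1).
Proof. by []. Qed.

Lemma unit_sphere_cdisk p : sphere_set p -> cdisk p.1.
Proof. by rewrite unit_sphereE cdiskE => <-; rewrite lerDl sqr_ge0. Qed.

Lemma unit_sphere_odisk p : sphere_set p -> p.2 <> 0 -> odisk p.1.
Proof.
by rewrite unit_sphereE odiskE => <- /eqP p2; rewrite ltrDl exprn_even_gt0.
Qed.

Lemma unit_sphere_circle p : sphere_set p -> p.2 = 0 -> circle p.1.
Proof. by rewrite unit_sphereE circleE => + p2; rewrite p2 expr0n addr0. Qed.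

Lemma unit_sphere_height p q : sphere_set p -> sphere_set q -> p.1 = q.1 -> p.2 ^+ 2 = q.2 ^+ 2.
Proof. by rewrite !unit_sphereE => ps qs pq; move: ps; rewrite pq -qs => /addrI. Qed.

Lemma closed_unit_sphere : closed sphere_set.
Proof.
apply: (@closed_preimage_cont_on _ _ (fun p => norm2 p.1 + p.2 ^+ 2) [set 1]).
  apply: cont_onD; first by apply: cont_on_norm2; apply: cont_on_fst; exact: cont_on_id.
  by apply: cont_onX; apply: cont_on_snd; exact: cont_on_id.
exact: closed_eq.
Qed.

Lemma compact_unit_sphere : compact sphere_set.
Proof.
apply: (@subclosed_compact _ _ (cdisk `*` [set` `[-1 : R, 1]])); first exact: closed_unit_sphere.
  by apply: compact_setX; [exact: compact_cdisk|exact: segment_compact].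
move=> p ps; split; first exact: unit_sphere_cdisk.
move: ps; rewrite unit_sphereE /= in_itv/= => ps; have := norm2_ge0 p.1.
by move=> ?; apply/andP; split; nra.
Qed.

Lemma unit_sphere_lift z : cdisk z ->
  exists2 h : R, 0 <= h & sphere_set (z, h) /\ sphere_set (z, - h).
Proof.
rewrite cdiskE -subr_ge0 => zd; exists (Num.sqrt (1 - norm2 z)); first exact: sqrtr_ge0.
by rewrite !unit_sphereE /= sqrrN sqr_sqrtr// subrKC.
Qed.

Variables (S : topologicalType) (f g : plane R -> S).
Hypotheses (S_hausdorff : hausdorff_space S).
Hypotheses (f_cont : cont_on cdisk f) (g_cont : cont_on cdisk g).
Hypotheses (f_inj : set_inj cdisk f) (g_inj : set_inj cdisk g).
Hypothesis fg_disjoint : f @` odisk `&` g @` odisk = set0.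
Hypothesis fg_cover : f @` cdisk `|` g @` cdisk = setT.

Section Agreeing.
Hypothesis fg_circle : forall c, circle c -> f c = g c.

Let glue p := if 0 <= p.2 then f p.1 else g p.1.

Let glue_lower p : sphere_set p -> p.2 <= 0 -> glue p = g p.1.
Proof.
move=> ps p_le; rewrite /glue; case: ifPn => // p_ge; apply: fg_circle.
by apply: unit_sphere_circle => //; apply/eqP; rewrite eq_le p_le.
Qed.

Let disk_neq z w : cdisk z -> odisk w -> f z <> g w.
Proof.
move=> /cdisk_split[oz|cz] ow zw.
  have : (f @` odisk `&` g @` odisk) (f z) by split; [exists z|exists w].
  by rewrite fg_disjoint.
by apply: (odisk_image_circle g_inj ow); exists z; rewrite // -fg_circle.
Qed.

Let glue_cont : cont_on sphere_set glue.
Proof.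
have closed_height (A : set R) : closed A -> closed (sphere_set `&` [set p : plane R * R | A p.2]).
  move=> cA; apply: closedI; first exact: closed_unit_sphere.
  by apply: (closed_preimage_cont_on _ cA); apply: cont_on_snd; exact: cont_on_id.
have cont_proj (h : plane R -> S) (D : set (plane R * R)) : D `<=` sphere_set -> cont_on cdisk h ->
    cont_on D (fun p => h p.1).
  move=> DS; apply: cont_on_comp => [p /DS/unit_sphere_cdisk//|].
  by apply: cont_on_fst; exact: cont_on_id.
have -> : sphere_set = sphere_set `&` [set p : plane R * R | 0 <= p.2] `|`
    sphere_set `&` [set p : plane R * R | p.2 <= 0].
  by apply/seteqP; split=> [p ps|p [[]|[]]//]; have [p0|/ltW p0] := leP 0 p.2; [left|right].
apply: cont_onU; [exact: closed_height (@closed_ge R 0)|exact: closed_height (@closed_le R 0)| |].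
  apply: (@eq_cont_on _ _ _ (fun p => f p.1)) => [p [_ /= p0]|]; first by rewrite /glue p0.
  by apply: cont_proj => // p [].
apply: (@eq_cont_on _ _ _ (fun p => g p.1)) => [p [ps /= p0]|]; first by rewrite glue_lower.
by apply: cont_proj => // p [].
Qed.

Let glue_inj : set_inj sphere_set glue.
Proof.
move=> p q /set_mem ps /set_mem qs.
have disk_p := unit_sphere_cdisk ps; have disk_q := unit_sphere_cdisk qs.
have same_height (x y : R) : 0 <= x -> 0 <= y -> x ^+ 2 = y ^+ 2 -> x = y.
  by move=> x0 y0 /eqP; rewrite eqrXn2// => /eqP.
rewrite /glue; case: (leP 0 p.2) => p0; case: (leP 0 q.2) => q0 pq.
- have {}pq : p.1 = q.1 by apply: f_inj pq; exact/mem_set.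
  rewrite [p]surjective_pairing [q]surjective_pairing -pq; congr pair.
  exact: same_height (unit_sphere_height ps qs pq).
- by case: (disk_neq disk_p (unit_sphere_odisk qs _) pq) => q2; rewrite q2 ltxx in q0.
- by case: (disk_neq disk_q (unit_sphere_odisk ps _) (esym pq)) => p2; rewrite p2 ltxx in p0.
- have {}pq : p.1 = q.1 by apply: g_inj pq; exact/mem_set.
  rewrite [p]surjective_pairing [q]surjective_pairing -pq; congr pair; apply: oppr_inj.
  by apply: same_height; rewrite ?oppr_ge0 ?ltW// !sqrrN (unit_sphere_height ps qs pq).
Qed.

Let glue_surj x : exists2 p, sphere_set p & glue p = x.
Proof.
have : (f @` cdisk `|` g @` cdisk) x by rewrite fg_cover.
case=> -[z /unit_sphere_lift[h h0 [zs zs']] <-].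
  by exists (z, h); rewrite // /glue h0.
by exists (z, - h); rewrite // glue_lower//= oppr_le0.
Qed.

Lemma agreeing_disks_sphere : sphere R S.
Proof.
have [inv invK inv_cont] :=
  compact_inverse (0 : plane R * R) S_hausdorff compact_unit_sphere glue_cont glue_inj.
have glueT : glue @` sphere_set = setT.
  by apply/seteqP; split=> // x _; have [p ps <-] := glue_surj x; exists p.
rewrite glueT in inv_cont; exists inv, glue; split=> //.
- by move=> x _; have [p ps <-] := glue_surj x; rewrite invK.
- by move=> p ps; rewrite invK.
Qed.

End Agreeing.
End GluedDisks.

Lemma common_boundary_sphere (R : realType) (S : topologicalType) (f g : plane R -> S) :
  hausdorff_space S -> cont_on cdisk f -> cont_on cdisk g -> set_inj cdisk f -> set_inj cdisk g ->
  f @` circle = g @` circle -> f @` odisk `&` g @` odisk = set0 ->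
  f @` cdisk `|` g @` cdisk = setT -> sphere R S.
Proof.
move=> S_hausdorff fc gc fI gI fg_circle disjoint cover.
have [inv invK inv_cont] := compact_inverse (0 : plane R) S_hausdorff (@compact_cdisk R) gc gI.
pose k := inv \o f.
have kP c : circle c -> circle (k c) /\ g (k c) = f c.
  move=> cc; have [c' c'c gc'] : (g @` circle) (f c) by rewrite -fg_circle; exists c.
  by rewrite /k /= -gc' invK//; exact: circle_cdisk.
have k_cont : cont_on circle k.
  apply: (@cont_on_comp _ _ _ _ (g @` cdisk)) inv_cont.
    by move=> c /kP[ck <-]; exists (k c) => //; exact: circle_cdisk.
  by apply: cont_onS fc; exact: circle_cdisk.
have k_inj : set_inj circle k.
  move=> c c' /set_mem cc /set_mem cc' kk.
  apply: fI; [exact/mem_set/circle_cdisk|exact/mem_set/circle_cdisk|].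
  by have [_ <-] := kP c cc; have [_ <-] := kP c' cc'; rewrite kk.
have k_circle c : circle c -> circle (k c) by move=> /kP[].
have k_surj c : circle c -> exists2 c', circle c' & k c' = c.
  move=> cc; have [c' cc' fc'] : (f @` circle) (g c) by rewrite fg_circle; exists c.
  by exists c'; rewrite // /k /= fc' invK//; exact: circle_cdisk.
have cone_cdisk z : cdisk (cone k z) = cdisk z by rewrite !cdiskE norm2_cone.
have cone_image : (g \o cone k) @` cdisk = g @` cdisk.
  apply/seteqP; split=> _ [z zd <-]; first by exists (cone k z); rewrite ?cone_cdisk.
  have [w wz] := cone_surj k_surj z; exists w; last by rewrite /= wz.
  by rewrite -wz cone_cdisk in zd.
apply: (@agreeing_disks_sphere R S f (g \o cone k)) => //.
- apply: (@cont_on_comp _ _ _ _ cdisk) gc; first by move=> z; rewrite cone_cdisk.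
  by apply: cont_onS (cont_on_cone k_cont k_circle) => z _.
- move=> z w /set_mem zd /set_mem wd zw; apply: (cone_inj k_inj k_circle).
  by apply: gI zw; apply/mem_set; rewrite cone_cdisk.
- rewrite -subset0 -disjoint; apply: setIS => _ [z zd <-]; exists (cone k z) => //.
  by move: zd; rewrite !odiskE norm2_cone.
- by rewrite cone_image.
- by move=> c cc; rewrite /= cone_circle//; case: (kP c cc).
Qed.

(** * Three-cycles and triangular faces *)

Section ThreeCycles.
Variables (R : realType) (S : topologicalType) (G : embedded_graph R S).
Local Notation adjG := (@adj R S G).
Implicit Types (C T : {set G}) (u v : G) (w : 'I_3 -> G).

Lemma ord3_successor (i j : 'I_3) : i != j -> j = ordS i \/ i = ordS j.
Proof.
by case: i j => [[|[|[|//]]] i] [[|[|[|//]]] j] // _; [left|right|right|left|left|right];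
  exact: val_inj.
Qed.

Lemma closed_walk3_adj w i j : closed_walk w -> i != j -> adj (w i) (w j).
Proof. by move=> cw /ord3_successor[->|->]; [|rewrite adj_sym]; exact: cw. Qed.

Lemma closed_walk3_triangle w : closed_walk w -> triangle adjG [set w i | i : 'I_3]%SET.
Proof.
move=> cw; split.
  rewrite card_imset ?card_ord// => i j wij; apply/eqP/negPn/negP => /(closed_walk3_adj cw).
  by rewrite wij adj_irr.
move=> _ _ /imsetP[i _ ->] /imsetP[j _ ->] wij; apply: closed_walk3_adj => //.
by apply: contraNneq wij => ->.
Qed.

Lemma closed_walk3_set w : closed_walk w -> walk_set w = cycle_set [set w i | i : 'I_3]%SET.
Proof.
move=> cw; apply/seteqP; split=> x.
  by move=> [i _ xe]; apply: cycle_set_edge xe; rewrite ?imset_f//; exact: cw.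
move=> [_ [_ [/imsetP[i _ ->] /imsetP[j _ ->] wij xe]]].
have : i != j by apply: contraTneq wij => ->; rewrite adj_irr.
move=> /ord3_successor[jE|iE]; first by exists i; rewrite // -jE.
by exists j; rewrite // -iE edgeC// adj_sym.
Qed.

Lemma triangle_three_cycle C : triangle adjG C -> three_cycle G (cycle_set C).
Proof.
move=> tC; have [u uC] : exists u, u \in C by apply/card_gt0P; case: tC => ->.
have [v [t [uv ut vt CE]]] := triangle_vertex tC uC.
pose w (i : 'I_3) : G := nth u [:: u; v; t] i.
have cw : closed_walk w by case=> [[|[|[|//]]] i]; rewrite /w//= adj_sym.
exists w => //; rewrite closed_walk3_set//; congr cycle_set; apply/esym/eqP.
rewrite eqEcard (closed_walk3_triangle cw).1 tC.1 andbT.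
apply/fintype.subsetP => _ /imsetP[[[|[|[|//]]] i] _ ->]; by rewrite CE !inE eqxx ?orbT.
Qed.

Lemma three_cycle_triangle (C : set S) : three_cycle G C ->
  exists2 T, triangle adjG T & C = cycle_set T.
Proof.
move=> [w cw ->]; rewrite closed_walk3_set//.
by exists [set w i | i : 'I_3]%SET => //; exact: closed_walk3_triangle.
Qed.

Lemma edge_cycle_set C u v : adj u v -> edge u v `<=` cycle_set C <-> u \in C /\ v \in C.
Proof.
move=> uv; split=> [uvC|[uC vC]]; last exact: cycle_set_edge.
exact/andP/(cycle_set_interior uv (midpoint_interior u v))/uvC/midpoint_edge.
Qed.

Lemma cycle_set_inj C T : triangle adjG C -> triangle adjG T -> cycle_set C = cycle_set T -> C = T.
Proof.
move=> tC tT CT; apply/eqP; rewrite eqEcard tC.1 tT.1 andbT.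
by apply/fintype.subsetP => u uC; apply: cycle_set_vertex; rewrite -CT; exact: vertex_cycle_set.
Qed.

End ThreeCycles.

Section TriangularFaces.
Variables (R : realType) (S : topologicalType) (G : embedded_graph R S).
Local Notation adjG := (@adj R S G).
Local Notation symG := (@adj_sym R S G).
Local Notation irrG := (@adj_irr R S G).
Variables (FT : finType) (M : polygonal_map G FT).
Implicit Types (i j : FT) (C : {set G}) (u v : G).

Lemma walk_ordS i (n : 'I_(degree M i)) : walk M i (ordS n) = walk M i n.+1.
Proof. by apply: walk_eqmod; rewrite /= modn_mod. Qed.

Lemma cell_boundary_walk i : boundary_walk (cell M i) (fun n : 'I_(degree M i) => walk M i n).
Proof.
split=> [n|]; first by rewrite walk_ordS; exact: walk_adj.
exists (cell_map M i); split; [exact: cell_map_cont|exact: cell_map_inj| |].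
  exact: param_image (cell_mapP M i).
by move=> n t t01; rewrite walk_ordS; exact: cell_map_side.
Qed.

Lemma degree3_boundary_walk i : degree M i = 3%N -> exists w : 'I_3 -> G,
  boundary_walk (cell M i) w /\ [set w n | n : 'I_3]%SET = face_vertices M i.
Proof.
move=> i3; have := cell_boundary_walk i; rewrite /face_vertices i3 => bw.
by exists (fun n => walk M i n).
Qed.

Lemma facial_triangle C : facial M C -> triangle adjG C.
Proof.
by move=> [i i3 ->]; have [w [[cw _] <-]] := degree3_boundary_walk i3; exact: closed_walk3_triangle.
Qed.

Lemma facial_bounds_three_face C : facial M C -> bounds_three_face G (cycle_set C).
Proof.
move=> [i i3 ->]; have [w [bw wE]] := degree3_boundary_walk i3; have [cw _] := bw.
exists (cell M i), w; split=> //; first exact: cell_face.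
by rewrite closed_walk3_set// wE.
Qed.

Lemma contractible_edge_contractible u v : adj u v -> contractible_edge M u v -> contractible u v.
Proof.
move=> uv [T1 [T2 [T12 f1 f2 only]]].
exists (cycle_set T1), (cycle_set T2); split.
- by move=> /(cycle_set_inj (facial_triangle f1) (facial_triangle f2)); exact/eqP.
- apply/seteqP; split=> C.
    move=> [/three_cycle_triangle[T tT ->] /(edge_cycle_set T uv)[uT vT]].
    by have [|->|->] := (only T).1; [split|left|right].
  have through T : T = T1 \/ T = T2 -> three_cycle G (cycle_set T) /\ edge u v `<=` cycle_set T.
    by move=> /only[tT uT vT]; split; [exact: triangle_three_cycle|exact/edge_cycle_set].
  by case=> ->; apply: through; [left|right].
- exact: facial_bounds_three_face.
- exact: facial_bounds_three_face.
Qed.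

Lemma degree3_cell_map_circle i : degree M i = 3%N ->
  cell_map M i @` circle = cycle_set (face_vertices M i).
Proof.
move=> i3; apply/seteqP; split=> [_ [z cz <-]|x].
  have [n [t [_ /andP[t0 t1] _ ->]]] := cell_map_circle M i cz.
  apply: cycle_set_edge (mem_walk M i n) (mem_walk M i n.+1) (walk_adj M i n) _ _.
  by exists t; rewrite //= in_itv/= t0 ltW.
move=> [u [v [uF vF uv xe]]].
have [n nE] := degree3_side symG irrG i3 (adj_neq irrG uv) uF vF.
have {}xe : edge (walk M i n) (walk M i n.+1) x.
  by move: nE => /eq_set2P[[-> ->]|[-> ->]] //; rewrite edgeC// adj_sym.
have [t t01 <-] := xe; exists (circle_point ((n%:R + t) / (degree M i)%:R)).
  exact: circle_pointP.
by rewrite cell_map_side.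
Qed.

Lemma degree3_side_param_inj i n k (t s : R) : degree M i = 3%N ->
  (n < degree M i)%N -> (k < degree M i)%N -> 0 <= t < 1 -> 0 <= s < 1 ->
  earc (walk M i n) (walk M i n.+1) t = earc (walk M i k) (walk M i k.+1) s -> n = k /\ t = s.
Proof.
move=> i3 ni ki.
have walk_inj n' k' : (n' < degree M i)%N -> (k' < degree M i)%N ->
    walk M i n' = walk M i k' -> n' = k'.
  move=> n'i k'i /(degree3_walk_inj irrG i3).
  by rewrite !modn_small.
have start n' k' (s' : R) : (n' < degree M i)%N -> (k' < degree M i)%N -> 0 <= s' < 1 ->
    vpoint (walk M i n') = earc (walk M i k') (walk M i k'.+1) s' -> n' = k' /\ 0 = s'.
  move=> n'i k'i /andP[s0 s1] /esym/(earc_vpoint (walk_adj M i k')).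
  rewrite itv01E s0 ltW// => /(_ isT)[[-> /walk_inj->]//|[s_eq1 _]].
  by rewrite s_eq1 ltxx in s1.
move=> t01 s01 ts; have [t_eq0|t_neq0] := eqVneq t 0.
  by move: ts; rewrite t_eq0 earc0 ?walk_adj//; exact: start.
have [s_eq0|s_neq0] := eqVneq s 0.
  have [//|kn t0] := start k n t ki ni t01; last by rewrite -t0 eqxx in t_neq0.
  by rewrite ts s_eq0 earc0// walk_adj.
move: t01 s01 => /andP[t0 t1] /andP[s0 s1].
have t_itv : t \in `]0, 1[ by rewrite in_itv/= lt_neqAle eq_sym t_neq0 t0.
have s_itv : s \in `]0, 1[ by rewrite in_itv/= lt_neqAle eq_sym s_neq0 s0.
have [[kn _]|[kn kn']] := earc_disjoint (walk_adj M i n) (walk_adj M i k) t_itv s_itv ts.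
  have nk := walk_inj _ _ ki ni kn; rewrite nk in ts; split=> //.
  by apply: earc_inj ts; rewrite ?walk_adj// in_itv/= ?t0 ?s0 ltW.
have : (k = n.+1 %[mod degree M i])%N.
  exact: degree3_walk_inj irrG _ _ _ _ _ i3 kn.
rewrite -addn1 => kE; have : walk M i k.+1 = walk M i n.+2.
  by apply: walk_eqmod; rewrite -addn1 -modnDml kE modnDml addn1 addn1.
by rewrite kn' => /esym nn; have := walk_adj2 M i n; rewrite nn adj_irr.
Qed.

Lemma degree3_cell_map_inj i : degree M i = 3%N -> set_inj cdisk (cell_map M i).
Proof.
move=> i3; have circle_odisk_neq z z' : circle z -> odisk z' -> cell_map M i z <> cell_map M i z'.
  move=> cz oz' zz'; apply: (cell_notin_graph (mem_cell M i oz')).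
  by rewrite -zz'; exact: cell_map_graph.
move=> z z' /set_mem/cdisk_split[oz|cz] /set_mem/cdisk_split[oz'|cz'] zz'.
- by apply: cell_map_inj zz'; exact/mem_set.
- by case: (circle_odisk_neq _ _ cz' oz).
- by case: (circle_odisk_neq _ _ cz oz').
have [n [t [ni t01 zE tE]]] := cell_map_circle M i cz.
have [k [s [ki s01 z'E sE]]] := cell_map_circle M i cz'.
have := degree3_side_param_inj i3 ni ki t01 s01 (etrans (esym tE) (etrans zz' sE)).
by move=> [nk ts]; rewrite zE z'E nk ts.
Qed.

Hypotheses (S_hausdorff : hausdorff_space S) (S_disk : locally_disk R S).
Hypothesis G_connected : forall u v : G, connect adjG u v.
Variables (i1 i2 : FT).
Hypothesis twin : twin_faces M i1 i2.

Let all_vertices : face_vertices M i1 = [set: G]%SET.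
Proof.
exact: (twin_faces_vertices symG irrG
  (map_closed_corners S_disk (M := M)) G_connected twin).
Qed.

Lemma twin_faces_card : #|G| = 3%N.
Proof.
have [_ i1_3 _ _] := twin.
have [tG _] : triangle adjG (face_vertices M i1) by apply: facial_triangle; exists i1.
by rewrite -cardsT -all_vertices.
Qed.

Lemma twin_faces_sphere : sphere R S.
Proof.
have [i12 i1_3 i2_3 i12E] := twin.
have cells x : ~ graph_set G x -> cell M i1 x \/ cell M i2 x.
  move=> /(cell_cover M)[i ix].
  have [ii|ii] := twin_faces_only symG irrG i
    (map_two_sided S_hausdorff S_disk M) (map_closed_corners S_disk (M := M)) G_connected twin.
    by left; rewrite -ii.
  by right; rewrite -ii.
have circle1 := degree3_cell_map_circle i1_3.
have graph_circle : graph_set G `<=` cell_map M i1 @` circle.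
  have vertexT u : u \in face_vertices M i1 by rewrite all_vertices inE.
  rewrite circle1 => x [[u _ <-]|[u [v [uv xe]]]]; last exact: cycle_set_edge xe.
  by apply: vertex_cycle_set => //; apply: facial_triangle; exists i1.
apply: (@common_boundary_sphere _ _ (cell_map M i1) (cell_map M i2)) => //.
- exact: cell_map_cont.
- exact: cell_map_cont.
- exact: degree3_cell_map_inj.
- exact: degree3_cell_map_inj.
- by rewrite circle1 degree3_cell_map_circle// i12E.
- rewrite -subset0 => x [[z oz zx] [z' oz' z'x]]; apply: i12.
  by apply: (@cell_disjoint _ _ _ _ M _ _ x); [rewrite -zx|rewrite -z'x]; exact: mem_cell.
apply/seteqP; split=> // x _; have [/graph_circle[z cz zx]|/cells[]] := pselect (graph_set G x).
- by left; exists z => //; exact: circle_cdisk.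
- by left; exact: cell_sub_image.
- by right; exact: cell_sub_image.
Qed.

End TriangularFaces.

Lemma adjacent_neighbour (R : realType) (S : topologicalType) (G : embedded_graph R S) (u v : G) :
  (forall a b : G, connect (@adj R S G) a b) -> adj u v -> forall a : G, exists b, adj a b.
Proof.
move=> conn uv a; have /connectP[[|b s] /= as_path ua] := conn a u; first by exists v; rewrite -ua.
by exists b; case/andP: as_path.
Qed.

Theorem theorem2 (R : realType) (S : topologicalType) (G : embedded_graph R S)
    (hS : surface R S) (hG : irreducible_map G)
    (hK3 : ~ (sphere R S /\ #|G| = 3%N)) :
  forall u v : G, adj u v -> essentially_noncontractible u v.
Proof.
move=> u v uv; have [_ S_hausdorff S_disk] := hS; have [[_ conn _] irr ncontr] := hG.
apply: contrapT => inessential; apply: hK3.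
have [FT [M]] := face_irreducible_finite_polygonal S_disk irr.
have no_contractible a b : adj a b -> ~ contractible_edge M a b.
  by move=> ab /(contractible_edge_contractible ab); exact: ncontr.
have all_facial (C : {set G}) : triangle (@adj R S G) C -> u \in C -> v \in C -> facial M C.
  move=> tC uC vC; apply: (bounds_disk_facial S_hausdorff S_disk) => //.
    exact: adjacent_neighbour conn uv.
  apply: contrapT => essC; apply: inessential; exists (cycle_set C); split=> //.
    exact: triangle_three_cycle.
  exact/edge_cycle_set.
have [/(no_contractible _ _ uv)//|[i1 [i2 [twin _ _]]]] :=
  facial_edge_contractible_or_twin (@adj_sym _ _ G) (@adj_irr _ _ G)
    (map_two_sided S_hausdorff S_disk M) (map_closed_corners S_disk (M := M)) uv all_facial.
split; first exact: (twin_faces_sphere S_hausdorff S_disk conn twin).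
exact: (twin_faces_card S_disk conn twin).
Qed.
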